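(* Let $S$ be a commutative unital ring such that $\operatorname{Spec} S$ is a noetherian topological space, and let $R = S^{\mathrm{abs}}$ be the absolutely flat approximation of $S$. Then there is an order preserving bijection between the collection of subsets of $\operatorname{Spec} R$ and the collection of localising subcategories of $\mathsf{D}(R)$ (both ordered by inclusion), given by the mutually inverse assignments $$\tau(W) = \langle k(P) \mid P \in W\rangle \quad (W \subseteq \operatorname{Spec} R), \qquad \sigma(\mathcal{L}) = \{P \in \operatorname{Spec} R \mid k(P)\otimes \mathcal{L} \neq 0\} \quad (\mathcal{L}\subseteq \mathsf{D}(R) \text{ localising}).$$
   Context: All rings are commutative and unital. A ring $R$ is absolutely flat (von Neumann regular) if for every $r\in R$ there is $x\in R$ with $r=r^2x$. The absolutely flat approximation of a ring $S$ is the absolutely flat ring $S^{\mathrm{abs}}$ together with the ring map $S\to S^{\mathrm{abs}}$ which is universal among ring maps from $S$ to absolutely flat rings (i.e. the unit of the left adjoint to the inclusion of absolutely flat rings into commutative rings); explicitly $S^{\mathrm{abs}} = S[x_s \mid s\in S]/(s^2x_s - s,\ x_s^2 s - x_s \mid s\in S)$. $\mathsf{D}(R)$ is the unbounded derived category of $R$-modules with its tensor product $\otimes=\otimes_R$ (over an absolutely flat ring all modules are flat). For $P\in\operatorname{Spec} R$, $k(P)$ is the residue field at $P$ (which equals $R_P$), regarded as an object of $\mathsf{D}(R)$. A localising subcategory is a full triangulated subcategory closed under arbitrary coproducts; $\langle \mathcal{C}\rangle$ denotes the smallest localising subcategory containing $\mathcal{C}$. The condition $k(P)\otimes\mathcal{L}\neq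 0$ means that $k(P)\otimes X\neq 0$ for some $X\in\mathcal{L}$. *)

(* Defs.v *)
From HB Require Import structures.
From mathcomp Require Import all_boot all_order all_algebra ring.
From mathcomp Require Import boolp classical_sets topology.

Set Implicit Arguments.
Unset Strict Implicit.
Unset Printing Implicit Defensive.

Import GRing.Theory.
Local Open Scope classical_set_scope.
Local Open Scope ring_scope.

(* Rings are [comPzRingType]s, so that the zero ring is allowed; the ideals of
   [ring_quotient] are only available over nontrivial rings. *)
Record Spec (R : comPzRingType) := PrimeIdeal {
  prime_set :> R -> Prop;
  prime0 : prime_set 0;
  primeD : forall x y, prime_set x -> prime_set y -> prime_set (x + y);
  primeMl : forall a x, prime_set x -> prime_set (a * x);
  prime1 : ~ prime_set 1;
  primeM : forall x y, prime_set (x * y) -> prime_set x \/ prime_set y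
}.

HB.instance Definition _ (R : comPzRingType) := gen_eqMixin (Spec R).
HB.instance Definition _ (R : comPzRingType) := gen_choiceMixin (Spec R).

Section Zariski.
Variable R : comPzRingType.

Definition zeros (E : set R) : set (Spec R) := [set P : Spec R | E `<=` prime_set P].

Definition zariski_open : set_system (Spec R) :=
  [set U | exists E, U = ~` zeros E].

Lemma zariski_openT : zariski_open setT.
Proof.
exists setT; apply/seteqP; split=> // P _ /= TP.
exact: (@prime1 _ P (TP 1 I)).
Qed.

Lemma zariski_openI : setI_closed zariski_open.
Proof.
move=> _ _ [E ->] [F ->].
exists [set x | exists a b, [/\ E a, F b & x = a * b]].
apply/seteqP; split=> [P [/= nEP nFP] EFP|P /= nEF].
  apply: nFP => b Fb; apply: contrapT => nPb; apply: nEP => a Ea.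
  have [//|//|//] := @primeM _ P a b.
  by apply: EFP; exists a, b.
split=> /= sP; apply: nEF => _ [a [b [Ea Fb ->]]].
  by rewrite mulrC; apply: primeMl; apply: sP.
by apply: primeMl; apply: sP.
Qed.

Lemma zariski_open_bigU (I : Type) (f : I -> set (Spec R)) :
  (forall i, zariski_open (f i)) -> zariski_open (\bigcup_i f i).
Proof.
move=> fo; exists [set x | exists2 E, (exists i, f i = ~` zeros E) & E x].
apply/seteqP; split=> [P [i _] fiP sP|P /= nP].
  have [E fE] := fo i; move: fiP; rewrite fE; apply=> x Ex.
  by apply: sP; exists E => //; exists i.
apply: contrapT => nf; apply: nP => x [E [i fE] Ex].
apply: contrapT => nPx; apply: nf; exists i => //.
by rewrite fE => /(_ x Ex).
Qed.

End Zariski.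

HB.instance Definition _ (R : comPzRingType) :=
  isOpenTopological.Build (Spec R) (@zariski_openT R) (@zariski_openI R)
    (@zariski_open_bigU R).

Definition noetherian_space (T : topologicalType) : Prop :=
  forall F : nat -> set T,
    (forall n, closed (F n)) -> (forall n, F n.+1 `<=` F n) ->
  exists N, forall n, (N <= n)%N -> F n = F N.

Definition absolutely_flat (R : comPzRingType) : Prop :=
  forall r : R, exists x : R, r = r ^+ 2 * x.

Definition absolutely_flat_approximation (S R : comPzRingType)
    (eta : {rmorphism S -> R}) : Prop :=
  absolutely_flat R /\
  forall (T : comPzRingType) (f : {rmorphism S -> T}), absolutely_flat T ->
  exists g : {rmorphism R -> T},
    (forall s, g (eta s) = f s) /\
    (forall g' : {rmorphism R -> T}, (forall s, g' (eta s) = f s) -> g' =1 g).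

Definition mklin (R : pzRingType) (U V : lmodType R) (f : U -> V)
    (fl : linear f) : {linear U -> V} :=
  HB.pack f (GRing.isLinear.Build R U V _ f fl).

(* A module whose axioms hold up to a congruence. *)
Record premodule (R : pzRingType) := Premodule {
  pm_car : Type;
  pm_rel : pm_car -> pm_car -> Prop;
  pm_zero : pm_car;
  pm_opp : pm_car -> pm_car;
  pm_add : pm_car -> pm_car -> pm_car;
  pm_scale : R -> pm_car -> pm_car;
  pm_refl : forall x, pm_rel x x;
  pm_sym : forall x y, pm_rel x y -> pm_rel y x;
  pm_trans : forall x y z, pm_rel x y -> pm_rel y z -> pm_rel x z;
  pm_opp_rel : forall x y, pm_rel x y -> pm_rel (pm_opp x) (pm_opp y);
  pm_add_rel : forall x x' y y', pm_rel x x' -> pm_rel y y' ->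
    pm_rel (pm_add x y) (pm_add x' y');
  pm_scale_rel : forall a x y, pm_rel x y ->
    pm_rel (pm_scale a x) (pm_scale a y);
  pm_addA : forall x y z,
    pm_rel (pm_add x (pm_add y z)) (pm_add (pm_add x y) z);
  pm_addC : forall x y, pm_rel (pm_add x y) (pm_add y x);
  pm_add0 : forall x, pm_rel (pm_add pm_zero x) x;
  pm_addN : forall x, pm_rel (pm_add (pm_opp x) x) pm_zero;
  pm_scaleA : forall a b x,
    pm_rel (pm_scale a (pm_scale b x)) (pm_scale (a * b) x);
  pm_scale1 : forall x, pm_rel (pm_scale 1 x) x;
  pm_scaleDr : forall a x y,
    pm_rel (pm_scale a (pm_add x y)) (pm_add (pm_scale a x) (pm_scale a y));
  pm_scaleDl : forall a b x,
    pm_rel (pm_scale (a + b) x) (pm_add (pm_scale a x) (pm_scale b x))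
}.

Section QuotientModule.
Variables (R : pzRingType) (p : premodule R).

Definition quotmod : Type := {A : set (pm_car p) | exists x, A = pm_rel x}.

Definition qcl (x : pm_car p) : quotmod :=
  exist (fun A : set (pm_car p) => exists x, A = pm_rel x) (pm_rel x)
    (ex_intro _ x erefl).

Definition qrepr (q : quotmod) : pm_car p := projT1 (cid (proj2_sig q)).

Lemma qclP x y : qcl x = qcl y <-> pm_rel x y.
Proof.
split=> [/(congr1 (fun q : quotmod => proj1_sig q y)) /= ->|xy].
  exact: pm_refl.
apply: eq_exist; apply/funext => z; apply/propext; split=> h.
  exact: pm_trans (pm_sym xy) h.
exact: pm_trans xy h.
Qed.

Lemma qreprK : cancel qrepr qcl.
Proof.
case=> A eA; rewrite /qrepr; case: cid => x /= Ax.
by apply: eq_exist.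
Qed.

Lemma qrepr_rel x : pm_rel (qrepr (qcl x)) x.
Proof. by apply/qclP; rewrite qreprK. Qed.

HB.instance Definition _ := gen_eqMixin quotmod.
HB.instance Definition _ := gen_choiceMixin quotmod.

Definition q_add (x y : quotmod) := qcl (pm_add (qrepr x) (qrepr y)).
Definition q_opp (x : quotmod) := qcl (pm_opp (qrepr x)).
Definition q_scale (a : R) (x : quotmod) := qcl (pm_scale a (qrepr x)).

Lemma q_addE x y : q_add (qcl x) (qcl y) = qcl (pm_add x y).
Proof. by apply/qclP; apply: pm_add_rel; apply: qrepr_rel. Qed.
Lemma q_oppE x : q_opp (qcl x) = qcl (pm_opp x).
Proof. by apply/qclP; apply: pm_opp_rel; apply: qrepr_rel. Qed.
Lemma q_scaleE a x : q_scale a (qcl x) = qcl (pm_scale a x).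
Proof. by apply/qclP; apply: pm_scale_rel; apply: qrepr_rel. Qed.

Lemma q_addA : associative q_add.
Proof.
move=> x y z; rewrite -(qreprK x) -(qreprK y) -(qreprK z) !q_addE.
by apply/qclP/pm_addA.
Qed.
Lemma q_addC : commutative q_add.
Proof.
by move=> x y; rewrite -(qreprK x) -(qreprK y) !q_addE; apply/qclP/pm_addC.
Qed.
Lemma q_add0 : left_id (qcl (pm_zero p)) q_add.
Proof. by move=> x; rewrite -(qreprK x) !q_addE; apply/qclP/pm_add0. Qed.
Lemma q_addN : left_inverse (qcl (pm_zero p)) q_opp q_add.
Proof.
by move=> x; rewrite -(qreprK x) q_oppE q_addE; apply/qclP/pm_addN.
Qed.

HB.instance Definition _ :=
  GRing.isZmodule.Build quotmod q_addA q_addC q_add0 q_addN.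

Lemma q_scaleA a b v : q_scale a (q_scale b v) = q_scale (a * b) v.
Proof. by rewrite -(qreprK v) !q_scaleE; apply/qclP/pm_scaleA. Qed.
Lemma q_scale1 : left_id 1 q_scale.
Proof. by move=> v; rewrite -(qreprK v) q_scaleE; apply/qclP/pm_scale1. Qed.
Lemma q_scaleDr : right_distributive q_scale +%R.
Proof.
move=> a x y; change (q_scale a (q_add x y) = q_add (q_scale a x) (q_scale a y)).
rewrite -(qreprK x) -(qreprK y) !(q_scaleE, q_addE).
exact/qclP/pm_scaleDr.
Qed.
Lemma q_scaleDl v : {morph q_scale^~ v : a b / a + b}.
Proof.
move=> a b; change (q_scale (a + b) v = q_add (q_scale a v) (q_scale b v)).
rewrite -(qreprK v) !(q_scaleE, q_addE).
exact/qclP/pm_scaleDl.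
Qed.

HB.instance Definition _ := GRing.Zmodule_isLmodule.Build R quotmod
  q_scaleA q_scale1 q_scaleDr q_scaleDl.

Lemma qclD x y : qcl (pm_add x y) = qcl x + qcl y.
Proof. by rewrite -q_addE. Qed.
Lemma qclZ a x : qcl (pm_scale a x) = a *: qcl x.
Proof. by rewrite -q_scaleE. Qed.

End QuotientModule.

Section ResidueField.
Variables (R : comPzRingType) (P : Spec R).

(* Fractions num / den with den outside P; two of them are identified when
   they agree in the fraction field of R / P. *)
Record prefrac := Prefrac { num : R; den : R; denP : ~ P den }.

Definition frac_rel (x y : prefrac) : Prop :=
  P (num x * den y - num y * den x).

Let notPM a b : ~ P a -> ~ P b -> ~ P (a * b).
Proof. by move=> Pa Pb /primeM[]. Qed.

Let frac_relP x y c : P c -> num x * den y - num y * den x = c -> frac_rel x y.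
Proof. by rewrite /frac_rel => Pc ->. Qed.

Let frac_eq x y : num x * den y - num y * den x = 0 -> frac_rel x y.
Proof. exact/frac_relP/prime0. Qed.

Definition frac_zero := @Prefrac 0 1 (@prime1 R P).
Definition frac_opp x := @Prefrac (- num x) (den x) (@denP x).
Definition frac_add x y := @Prefrac (num x * den y + num y * den x)
  (den x * den y) (notPM (@denP x) (@denP y)).
Definition frac_scale (a : R) x := @Prefrac (a * num x) (den x) (@denP x).

Definition residue_premodule : premodule R.
Proof.
refine (@Premodule R prefrac frac_rel frac_zero frac_opp frac_add frac_scale
  _ _ _ _ _ _ _ _ _ _ _ _ _ _).
- by move=> x; apply: frac_eq; ring.
- by move=> x y /(primeMl (-1)) h; apply: (frac_relP h); ring.
- move=> x y z xy yz.
  have [||//] := @primeM _ P (den y) (num x * den z - num z * den x).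
    have := primeD (primeMl (den z) xy) (primeMl (den x) yz).
    by congr (prime_set P _); ring.
  by move/(@denP y).
- by move=> x y /(primeMl (-1)) h; apply: (frac_relP h) => /=; ring.
- move=> x x' y y' /(primeMl (den y * den y')) h /(primeMl (den x * den x')) h'.
  by apply: (frac_relP (primeD h h')) => /=; ring.
- by move=> a x y /(primeMl a) h; apply: (frac_relP h) => /=; ring.
- by move=> x y z; apply: frac_eq => /=; ring.
- by move=> x y; apply: frac_eq => /=; ring.
- by move=> x; apply: frac_eq => /=; ring.
- by move=> x; apply: frac_eq => /=; ring.
- by move=> a b x; apply: frac_eq => /=; ring.
- by move=> x; apply: frac_eq => /=; ring.
- by move=> a x y; apply: frac_eq => /=; ring.
- by move=> a b x; apply: frac_eq => /=; ring.
Defined.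

(* The residue field k(P) = Frac (R / P), as an R-module. *)
Definition residue : lmodType R := quotmod residue_premodule.

End ResidueField.

Section Tensor.
Variables (R : comPzRingType) (M N : lmodType R).

(* Formal sums of pairs [(m, n)] modulo the smallest congruence making
   [(m, n)] bilinear. *)
Inductive tensor_rel : seq (M * N) -> seq (M * N) -> Prop :=
| tensor_refl s : tensor_rel s s
| tensor_sym s t : tensor_rel s t -> tensor_rel t s
| tensor_trans s t u : tensor_rel s t -> tensor_rel t u -> tensor_rel s u
| tensor_cat s s' t t' :
    tensor_rel s s' -> tensor_rel t t' -> tensor_rel (s ++ t) (s' ++ t')
| tensor_catC s t : tensor_rel (s ++ t) (t ++ s)
| tensor_0l n : tensor_rel [:: (0, n)] [::]
| tensor_Dl m m' n : tensor_rel [:: (m + m', n)] [:: (m, n); (m', n)]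
| tensor_Dr m n n' : tensor_rel [:: (m, n + n')] [:: (m, n); (m, n')]
| tensor_Zlr a m n : tensor_rel [:: (a *: m, n)] [:: (m, a *: n)].

Definition tensor_scale (a : R) (s : seq (M * N)) : seq (M * N) :=
  [seq (a *: p.1, p.2) | p <- s].

Let tensor_scale_rel a s t :
  tensor_rel s t -> tensor_rel (tensor_scale a s) (tensor_scale a t).
Proof.
rewrite /tensor_scale => st; elim: st => {s t} /=.
- by move=> s; exact: tensor_refl.
- by move=> s t _; exact: tensor_sym.
- by move=> s t u _ st _; exact: tensor_trans st.
- by move=> s s' t t' _ ss' _ tt'; rewrite !map_cat; exact: tensor_cat.
- by move=> s t; rewrite !map_cat; exact: tensor_catC.
- by move=> n; rewrite scaler0; exact: tensor_0l.
- by move=> m m' n; rewrite scalerDr; exact: tensor_Dl.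
- by move=> m n n'; exact: tensor_Dr.
- by move=> b m n; rewrite scalerA mulrC -scalerA; exact: tensor_Zlr.
Qed.

Let tensor_map_rel (f g : M * N -> seq (M * N)) s :
  (forall p, tensor_rel (f p) (g p)) ->
  tensor_rel (flatten (map f s)) (flatten (map g s)).
Proof.
move=> fg; elim: s => [|p s IHs] /=; first exact: tensor_refl.
exact: tensor_cat.
Qed.

Let flatten_cat2 (f g : M * N -> M * N) s :
  tensor_rel (flatten [seq [:: f p; g p] | p <- s]) (map f s ++ map g s).
Proof.
elim: s => [|p s IHs] /=; first exact: tensor_refl.
apply: (@tensor_trans _ ([:: f p; g p] ++ (map f s ++ map g s))).
  by rewrite -[f p :: _]/([:: f p; g p] ++ _); exact: tensor_cat (tensor_refl _) _.
apply: (@tensor_cat [:: f p] [:: f p]); first exact: tensor_refl.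
rewrite -[g p :: map g s]/([:: g p] ++ map g s) catA.
rewrite -[X in tensor_rel X]/(([:: g p] ++ map f s) ++ map g s).
by apply: tensor_cat; [exact: tensor_catC|exact: tensor_refl].
Qed.

Definition tensor_premodule : premodule R.
Proof.
refine (@Premodule R (seq (M * N)) tensor_rel [::] (tensor_scale (-1)) cat
  tensor_scale tensor_refl tensor_sym tensor_trans
  (@tensor_scale_rel (-1)) tensor_cat tensor_scale_rel _ tensor_catC
  _ _ _ _ _ _).
- by move=> s t u; rewrite catA; exact: tensor_refl.
- by move=> s; exact: tensor_refl.
- move=> s; rewrite -[X in tensor_rel (_ ++ X)](map_id s).
  refine (tensor_trans
    (tensor_sym (flatten_cat2 (fun p => ((-1) *: p.1, p.2)) id s)) _).
  rewrite [X in tensor_rel _ X](_ : _ = flatten [seq [::] | _ <- s]); last first.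
    by elim: s.
  apply: tensor_map_rel => -[m n] /=.
  refine (tensor_trans (tensor_sym (tensor_Dl ((-1) *: m) m n)) _).
  by rewrite scaleN1r addNr; exact: tensor_0l.
- move=> a b s; rewrite /tensor_scale -map_comp.
  under eq_map => p do rewrite /= scalerA.
  exact: tensor_refl.
- move=> s; rewrite -[X in tensor_rel _ X]map_id /tensor_scale.
  under eq_map => p do rewrite scale1r -surjective_pairing.
  exact: tensor_refl.
- by move=> a s t; rewrite /tensor_scale map_cat; exact: tensor_refl.
- move=> a b s.
  refine (tensor_trans _ (flatten_cat2 (fun p => (a *: p.1, p.2))
    (fun p => (b *: p.1, p.2)) s)).
  rewrite -[X in tensor_rel X]flatten_seq1 -map_comp.
  by apply: tensor_map_rel => -[m n] /=; rewrite scalerDl; exact: tensor_Dl.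
Defined.

Definition tensor : lmodType R := quotmod tensor_premodule.

End Tensor.

Section TensorMap.
Variables (R : comPzRingType) (M N N' : lmodType R) (g : {linear N -> N'}).

Definition pretensor_map (s : seq (M * N)) : seq (M * N') :=
  [seq (p.1, g p.2) | p <- s].

Lemma pretensor_map_rel s t :
  tensor_rel s t -> tensor_rel (pretensor_map s) (pretensor_map t).
Proof.
rewrite /pretensor_map => st; elim: st => {s t} /=.
- by move=> s; exact: tensor_refl.
- by move=> s t _; exact: tensor_sym.
- by move=> s t u _ st _; exact: tensor_trans st.
- by move=> s s' t t' _ ss' _ tt'; rewrite !map_cat; exact: tensor_cat.
- by move=> s t; rewrite !map_cat; exact: tensor_catC.
- by move=> n; exact: tensor_0l.
- by move=> m m' n; exact: tensor_Dl.
- by move=> m n n'; rewrite linearD; exact: tensor_Dr.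
- by move=> b m n; rewrite linearZ; exact: tensor_Zlr.
Qed.

Definition tensor_map_fun (x : tensor M N) : tensor M N' :=
  qcl (p := tensor_premodule M N') (pretensor_map (qrepr x)).

Lemma tensor_mapE s :
  tensor_map_fun (qcl (p := tensor_premodule M N) s) =
  qcl (p := tensor_premodule M N') (pretensor_map s).
Proof. by apply/qclP/pretensor_map_rel/(qrepr_rel (p := tensor_premodule M N)). Qed.

Lemma tensor_map_linear : linear tensor_map_fun.
Proof.
move=> a x y; rewrite -(qreprK x) -(qreprK y) -qclZ -qclD !tensor_mapE.
rewrite -qclZ -qclD; congr qcl => /=.
by rewrite /pretensor_map /tensor_scale map_cat -!map_comp.
Qed.

Definition tensor_map : {linear tensor M N -> tensor M N'} :=
  mklin tensor_map_linear.

End TensorMap.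

Record complex (R : comPzRingType) := Complex {
  cobj :> int -> lmodType R;
  diff : forall n, {linear cobj n -> cobj (n + 1)};
  diffK : forall n x, diff (n + 1) (diff n x) = 0
}.

Record chain_map (R : comPzRingType) (X Y : complex R) := ChainMap {
  cmap :> forall n, {linear X n -> Y n};
  cmapC : forall n x, cmap (n + 1) (diff X n x) = diff Y n (cmap n x)
}.

Section Complexes.
Variable R : comPzRingType.
Implicit Types X Y Z W : complex R.

Lemma chain_id_linear X n : linear (@id (X n)).
Proof. by []. Qed.

Definition chain_id X : chain_map X X :=
  @ChainMap R X X (fun n => mklin (@chain_id_linear X n)) (fun _ _ => erefl).

Lemma chain_comp_linear X Y Z (f : chain_map X Y) (g : chain_map Y Z) n :
  linear (fun x => g n (f n x)).
Proof. by move=> a x y; rewrite !linearP. Qed.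

Lemma chain_compC X Y Z (f : chain_map X Y) (g : chain_map Y Z) n x :
  g (n + 1) (f (n + 1) (diff X n x)) = diff Z n (g n (f n x)).
Proof. by rewrite !cmapC. Qed.

Definition chain_comp X Y Z (f : chain_map X Y) (g : chain_map Y Z) :
  chain_map X Z :=
  @ChainMap R X Z (fun n => mklin (@chain_comp_linear X Y Z f g n))
    (@chain_compC X Y Z f g).

(* f - g = d h + h d; the degrees n + 1 exhaust Z. *)
Definition homotopic X Y (f g : chain_map X Y) : Prop :=
  exists h : forall n, {linear X (n + 1) -> Y n}, forall n (x : X (n + 1)),
    f (n + 1) x - g (n + 1) x = diff Y n (h n x) + h (n + 1) (diff X (n + 1) x).

(* H^(n+1)(f) is injective and surjective for every n. *)
Definition quasi_iso X Y (f : chain_map X Y) : Prop := forall n,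
  (forall x : X (n + 1), diff X (n + 1) x = 0 ->
     (exists y, f (n + 1) x = diff Y n y) -> exists z, x = diff X n z) /\
  (forall y : Y (n + 1), diff Y (n + 1) y = 0 ->
     exists2 x : X (n + 1), diff X (n + 1) x = 0 &
     exists z, y = f (n + 1) x + diff Y n z).

Lemma quasi_iso_id X : quasi_iso (chain_id X).
Proof.
move=> n; split=> [x _ //|y dy]; exists y => //.
by exists 0; rewrite linear0 addr0.
Qed.

Lemma quasi_iso_comp X Y Z (f : chain_map X Y) (g : chain_map Y Z) :
  quasi_iso f -> quasi_iso g -> quasi_iso (chain_comp f g).
Proof.
move=> qf qg n; have [fi fs] := qf n; have [gi gs] := qg n.
split=> [x dx [z /= gfx]|z /gs[y /fs[x dx [y' ->] [z' ->]]]] /=.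
  by apply: fi => //; apply: gi; [rewrite -cmapC dx linear0|exists z].
exists x => //; exists (g n y' + z').
by rewrite !linearD addrA cmapC.
Qed.

Lemma shift_linear X n : linear (fun x => - diff X (n + 1) x).
Proof. by move=> a x y; rewrite linearP opprD scalerN. Qed.

Lemma shiftK X n x : - diff X (n + 1 + 1) (- diff X (n + 1) x) = 0.
Proof. by rewrite linearN opprK diffK. Qed.

Definition shift X : complex R :=
  @Complex R (fun n => X (n + 1)) (fun n => mklin (@shift_linear X n))
    (@shiftK X).

Lemma shift_mapC X Y (f : chain_map X Y) n x :
  f (n + 1 + 1) (- diff X (n + 1) x) = - diff Y (n + 1) (f (n + 1) x).
Proof. by rewrite linearN cmapC. Qed.

Definition shift_map X Y (f : chain_map X Y) : chain_map (shift X) (shift Y) :=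
  @ChainMap R (shift X) (shift Y) (fun n => f (n + 1)) (@shift_mapC X Y f).

Lemma quasi_iso_shift X Y (f : chain_map X Y) :
  quasi_iso f -> quasi_iso (shift_map f).
Proof.
move=> qf n; have [fi fs] := qf (n + 1); split=> /=.
  move=> x /eqP; rewrite oppr_eq0 => /eqP dx [y fx].
  have [|z ->] := fi x dx; first by exists (- y); rewrite fx linearN.
  by exists (- z); rewrite linearN opprK.
move=> y /eqP; rewrite oppr_eq0 => /eqP /fs[x dx [z ->]].
by exists x; rewrite ?dx ?oppr0 //; exists (- z); rewrite linearN opprK.
Qed.

Section Cone.
Variables (X Y : complex R) (f : chain_map X Y).

Definition cone_obj (n : int) : lmodType R := (X (n + 1)%R * Y n)%type.

Definition cone_diff n (p : cone_obj n) : cone_obj (n + 1) :=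
  (- diff X (n + 1) p.1, f (n + 1) p.1 + diff Y n p.2).

Lemma cone_diff_linear n : linear (@cone_diff n).
Proof.
move=> a [x y] [x' y']; congr pair => /=.
  by rewrite linearP opprD scalerN.
by rewrite !linearP /= scalerDr addrACA.
Qed.

Lemma cone_diffK n (p : cone_obj n) : cone_diff (cone_diff p) = 0.
Proof.
congr pair => /=; first by rewrite linearN opprK diffK.
by rewrite linearN linearD diffK addr0 cmapC addNr.
Qed.

Definition cone : complex R :=
  @Complex R cone_obj (fun n => mklin (@cone_diff_linear n)) cone_diffK.

Lemma cone_in_linear n : linear (fun y : Y n => (0, y) : cone n).
Proof. by move=> a y y'; congr pair; rewrite /= scaler0 addr0. Qed.

Lemma cone_inC n (y : Y n) :
  (0, diff Y n y) = diff cone n (0, y) :> cone (n + 1).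
Proof. by congr pair; rewrite /= linear0 ?oppr0 ?add0r. Qed.

Definition cone_in : chain_map Y cone :=
  @ChainMap R Y cone (fun n => mklin (@cone_in_linear n)) cone_inC.

Lemma cone_out_linear n : linear (fun p : cone n => p.1 : shift X n).
Proof. by []. Qed.

Definition cone_out : chain_map cone (shift X) :=
  @ChainMap R cone (shift X) (fun n => mklin (@cone_out_linear n))
    (fun _ _ => erefl).

End Cone.

(* The homotopy pushout of Z <-s- Y -g-> W, i.e. the cone of
   (s, -g) : Y -> Z (+) W. *)
Section Pushout.
Variables (Y Z W : complex R) (s : chain_map Y Z) (g : chain_map Y W).

Definition hpo_obj (n : int) : lmodType R := (Y (n + 1)%R * (Z n * W n))%type.

Definition hpo_diff n (p : hpo_obj n) : hpo_obj (n + 1) :=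
  (- diff Y (n + 1) p.1,
   (s (n + 1) p.1 + diff Z n p.2.1, - g (n + 1) p.1 + diff W n p.2.2)).

Lemma hpo_diff_linear n : linear (@hpo_diff n).
Proof.
move=> a [y [z w]] [y' [z' w']]; congr (_, (_, _)) => /=.
- by rewrite linearP opprD scalerN.
- by rewrite !linearP /= scalerDr addrACA.
- by rewrite !linearP /= scalerDr addrACA.
Qed.

Lemma hpo_diffK n (p : hpo_obj n) : hpo_diff (hpo_diff p) = 0.
Proof.
congr (_, (_, _)) => /=; first by rewrite linearN opprK diffK.
  by rewrite linearN linearD diffK addr0 cmapC addNr.
by rewrite linearN linearD diffK addr0 cmapC opprK linearN addrN.
Qed.

Definition hpo : complex R :=
  @Complex R hpo_obj (fun n => mklin (@hpo_diff_linear n)) hpo_diffK.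

Lemma hpo_inl_linear n : linear (fun z : Z n => (0, (z, 0)) : hpo n).
Proof. by move=> a z z'; congr (_, (_, _)); rewrite /= scaler0 addr0. Qed.

Lemma hpo_inlC n (z : Z n) :
  (0, (diff Z n z, 0)) = diff hpo n (0, (z, 0)) :> hpo (n + 1).
Proof. by congr (_, (_, _)); rewrite /= ?linear0 ?oppr0 ?add0r ?linear0. Qed.

Definition hpo_inl : chain_map Z hpo :=
  @ChainMap R Z hpo (fun n => mklin (@hpo_inl_linear n)) hpo_inlC.

Lemma hpo_inr_linear n : linear (fun w : W n => (0, (0, w)) : hpo n).
Proof. by move=> a w w'; congr (_, (_, _)); rewrite /= scaler0 addr0. Qed.

Lemma hpo_inrC n (w : W n) :
  (0, (0, diff W n w)) = diff hpo n (0, (0, w)) :> hpo (n + 1).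
Proof. by congr (_, (_, _)); rewrite /= ?linear0 ?oppr0 ?add0r ?linear0. Qed.

Definition hpo_inr : chain_map W hpo :=
  @ChainMap R W hpo (fun n => mklin (@hpo_inr_linear n)) hpo_inrC.

Lemma quasi_iso_hpo_inr : quasi_iso s -> quasi_iso hpo_inr.
Proof.
move=> qs n; have [si ss] := qs n; have [si' _] := qs (n + 1); split=> /=.
  move=> w _ [[y [z w']] [/esym/eqP dy sy ->]].
  move: dy; rewrite oppr_eq0 => /eqP dy.
  have [|y0 y0E] := si _ dy.
    by exists (- z); rewrite linearN; apply/eqP; rewrite -addr_eq0 -sy.
  by exists (w' - g n y0); rewrite linearB /= -cmapC -y0E [LHS]addrC.
move=> [y [z w]] /= [/eqP dy sy gy]; move: dy; rewrite oppr_eq0 => /eqP dy.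
have [|y0 y0E] := si' _ dy.
  by exists (- z); rewrite linearN; apply/eqP; rewrite -addr_eq0 sy.
have [|y1 dy1 [z0 z0E]] := ss (z + s (n + 1) y0).
  by rewrite linearD /= -cmapC -y0E [LHS]addrC sy.
have dyy : diff Y (n + 1) (y0 - y1) = y by rewrite linearB /= dy1 subr0.
exists (w - g (n + 1) (y0 - y1)).
  by rewrite linearB /= -cmapC dyy [LHS]addrC.
exists (- (y0 - y1), (z0, 0)); congr (_, (_, _)) => /=.
- by rewrite linearN opprK dyy add0r.
- by rewrite add0r linearN linearB opprB /= addrAC -z0E addrK.
- by rewrite linear0 addr0 linearN opprK subrK.
Qed.

End Pushout.

(* D(R) is the localisation of the homotopy category of complexes at the
   quasi-isomorphisms.  A morphism X -> Y is a left fraction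
   X --dnum--> dapex <--dden-- Y with dden a quasi-isomorphism; [deq] is
   equality of morphisms. *)
Record dmor X Y := Dmor {
  dapex : complex R;
  dnum : chain_map X dapex;
  dden : chain_map Y dapex;
  dden_qi : quasi_iso dden
}.

Definition deq X Y (a b : dmor X Y) : Prop :=
  exists (T : complex R) (u : chain_map (dapex a) T) (v : chain_map (dapex b) T),
    [/\ quasi_iso (chain_comp (dden a) u),
        homotopic (chain_comp (dnum a) u) (chain_comp (dnum b) v) &
        homotopic (chain_comp (dden a) u) (chain_comp (dden b) v)].

Definition dof X Y (f : chain_map X Y) : dmor X Y :=
  Dmor f (@quasi_iso_id Y).

Definition did X : dmor X X := dof (chain_id X).

(* [dcomp a b] is first a, then b. *)
Definition dcomp X Y Z (a : dmor X Y) (b : dmor Y Z) : dmor X Z :=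
  @Dmor X Z (hpo (dden a) (dnum b))
    (chain_comp (dnum a) (hpo_inl (dden a) (dnum b)))
    (chain_comp (dden b) (hpo_inr (dden a) (dnum b)))
    (quasi_iso_comp (@dden_qi _ _ b) (quasi_iso_hpo_inr _ (@dden_qi _ _ a))).

Definition dshift X Y (a : dmor X Y) : dmor (shift X) (shift Y) :=
  @Dmor (shift X) (shift Y) (shift (dapex a)) (shift_map (dnum a))
    (shift_map (dden a)) (quasi_iso_shift (@dden_qi _ _ a)).

Definition is_diso X Y (a : dmor X Y) : Prop :=
  exists b : dmor Y X, deq (dcomp a b) (did X) /\ deq (dcomp b a) (did Y).

Definition disomorphic X Y : Prop := exists a : dmor X Y, is_diso a.

Definition exact_triangle X Y Z
    (u : dmor X Y) (v : dmor Y Z) (w : dmor Z (shift X)) : Prop :=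
  exists (A B : complex R) (f : chain_map A B)
         (a : dmor X A) (b : dmor Y B) (c : dmor Z (cone f)),
    [/\ is_diso a, is_diso b & is_diso c] /\
    [/\ deq (dcomp u b) (dcomp a (dof f)),
        deq (dcomp v c) (dcomp b (dof (cone_in f))) &
        deq (dcomp w (dshift a)) (dcomp c (dof (cone_out f)))].

Definition is_coproduct (I : Type) (X : I -> complex R) (C : complex R)
    (i : forall k, dmor (X k) C) : Prop :=
  forall (Y : complex R) (g : forall k, dmor (X k) Y),
    exists h : dmor C Y, (forall k, deq (dcomp (i k) h) (g k)) /\
      (forall h' : dmor C Y,
        (forall k, deq (dcomp (i k) h') (g k)) -> deq h' h).

Definition stalk_obj (M : lmodType R) (n : int) : lmodType R :=
  if n is Posz 0 then M else 'rV[R]_0.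

Definition stalk (M : lmodType R) : complex R :=
  @Complex R (stalk_obj M) (fun _ => \0) (fun _ _ => erefl).

Definition dzero : complex R := stalk 'rV[R]_0.

Lemma mtensorK (M : lmodType R) X n (x : tensor M (X n)) :
  tensor_map M (diff X (n + 1)) (tensor_map M (diff X n) x) = 0.
Proof.
rewrite -(qreprK x) /= !tensor_mapE; apply/qclP => /=.
elim: (qrepr x) => [|[m y] s IHs] /=; first exact: tensor_refl.
rewrite diffK; apply: (@tensor_cat _ _ _ [:: (m, 0)] [::]) => //.
have := tensor_Zlr 0 m (0 : X (n + 1 + 1)); rewrite scale0r scaler0.
by move=> /tensor_sym/tensor_trans; apply; exact: tensor_0l.
Qed.

(* The total complex of M[0] (x) X, which has M (x) X^n in degree n.  It
   represents the tensor product of D(R) as soon as M is flat, hence for every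
   M when R is absolutely flat. *)
Definition mtensor (M : lmodType R) X : complex R :=
  @Complex R (fun n => tensor M (X n)) (fun n => tensor_map M (diff X n))
    (@mtensorK M X).

(* A full subcategory of D(R), closed under isomorphism, is given by its class
   of objects.  Being closed under [shift] in both directions, such a class has
   the two-out-of-three property for exact triangles. *)
Definition triangulated (L : complex R -> Prop) : Prop :=
  [/\ L dzero,
      forall X Y, disomorphic X Y -> L X -> L Y,
      forall X, L X <-> L (shift X) &
      forall X Y Z (u : dmor X Y) (v : dmor Y Z) (w : dmor Z (shift X)),
        exact_triangle u v w -> L X -> L Y -> L Z].

Definition localising (L : complex R -> Prop) : Prop :=
  triangulated L /\
  forall (I : Type) (X : I -> complex R) (C : complex R)
         (i : forall k, dmor (X k) C),
    is_coproduct i -> (forall k, L (X k)) -> L C.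

Definition generated (C : complex R -> Prop) : complex R -> Prop :=
  fun X => forall L, localising L -> (forall Y, C Y -> L Y) -> L X.

Definition tau (W : set (Spec R)) : complex R -> Prop :=
  generated (fun X => exists2 P, W P & X = stalk (residue P)).

Definition sigma (L : complex R -> Prop) : set (Spec R) :=
  [set P | exists2 X, L X & ~ disomorphic (mtensor (residue P) X) dzero].

End Complexes.

(* Main.v *)
Require Import Defs.
From HB Require Import structures.
From mathcomp Require Import all_boot all_order all_algebra ring.
From mathcomp Require Import boolp classical_sets topology.

Set Implicit Arguments.
Unset Strict Implicit.
Unset Printing Implicit Defensive.

Import GRing.Theory.
Local Open Scope classical_set_scope.
Local Open Scope ring_scope.

(** Why the theorem holds.  Over an absolutely flat ring every prime [P] is
    maximal, and [k(P) = R / P] is obtained from [R] by dividing out what is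
    killed by an idempotent outside [P].  So tensoring with [k(P)] is an exact
    localisation [X |-> X_P], and [k(P) (x) k(Q) = 0] for [P <> Q].  The
    complexes with [X_P] acyclic form a localising class that contains [k(Q)]
    for [Q <> P] but not [k(P)]; hence [sigma (tau W) = W] ([sigma_tau]).

    For a localising class [L] three facts give [tau (sigma L) = L]
    ([tau_sigma]).
    - [X] in [L] implies [X_P] in [L] ([localising_localization]).
    - [X_P] is a complex of vector spaces over [k(P)]: it is built from copies
      of [k(P)] ([localising_killed]), and if it is not acyclic then it has a
      shift of [k(P)] as a direct factor ([localising_residue]).
    - If all [X_P] are in [L] then so is [X] ([local_to_global]).

    The common engine is a devissage ([localising_devissage]).  Suppose that
    every complex [A] of a family receives a map from an object of [L] which is
    surjective in homology and whose cone is in the family again.  Attaching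
    these cones forever yields a sequence [A = A_0 -> A_1 -> ...] whose maps
    vanish in homology, while the cones of [A -> A_n] are in [L]; their mapping
    telescope is in [L] and is a shift of [A].  A sequence thus
    suffices where a filtration would be transfinite.  With [eA] the direct summand cut out
    by an idempotent [e], it shows that the fibre of [X -> X_P] is in [L] as
    soon as all [eX] with [e] in [P] are ([localising_fibre]): the source used
    at each stage is the sum of the [eA] over the idempotents [e] of [P].  The
    same devissage, with sums of shifts of [k(P)], handles complexes of
    [k(P)]-vector spaces.

    The noetherian hypothesis enters in [colon_prime] only: if [J] is a proper
    ideal of [R], then the spectrum of [R / J] has an isolated point, cut out by
    an idempotent [g].  Indeed [1] can be cut down by the idempotents generated
    by elements of [S] only finitely often, the corresponding closed sets of
    [Spec S] being strictly decreasing.  Once no element of [S] splits the piece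
    [g], each of them is zero or invertible there; as [S] generates [R] up to
    inverses ([approx_generated]), the piece is a field.  In [local_to_global],
    [J] is generated by the idempotents [e] with [eX] in [L]; at an isolated
    point [P] both [(gX)_P = X_P] and the fibre of [gX -> (gX)_P] are in [L], so
    that [g] is in [J], which is absurd.

    In D(R) itself only a few things are done by hand: an isomorphism is a pair
    of quasi-isomorphisms with the same target ([disomorphicP]), a chain map and
    its cone form an exact triangle ([exact_triangle_cone]), and the direct sum
    of complexes is a coproduct ([dsumC_coproduct]).
    All the rest is a computation with cycles and boundaries. *)

(** * Sums and opposites in abelian groups *)
Section ZmodTactic.
Variable V : zmodType.

Inductive zexp := ZVar of nat | ZZero | ZAdd of zexp & zexp | ZOpp of zexp.

Fixpoint zeval (env : seq V) (e : zexp) : V :=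
  match e with
  | ZVar i => nth 0 env i
  | ZZero => 0
  | ZAdd a b => zeval env a + zeval env b
  | ZOpp a => - zeval env a
  end.

Fixpoint znf (e : zexp) : seq nat * seq nat :=
  match e with
  | ZVar i => ([:: i], [::])
  | ZZero => ([::], [::])
  | ZAdd a b => ((znf a).1 ++ (znf b).1, (znf a).2 ++ (znf b).2)
  | ZOpp a => ((znf a).2, (znf a).1)
  end.

Lemma zevalE env e :
  zeval env e = \sum_(i <- (znf e).1) env`_i - \sum_(i <- (znf e).2) env`_i.
Proof.
elim: e => [i||a IHa b IHb|a IHa] /=.
- by rewrite big_seq1 big_nil subr0.
- by rewrite !big_nil subr0.
- by rewrite IHa IHb !big_cat /= opprD addrACA.
- by rewrite IHa opprB.
Qed.

Lemma zeval_eq env e e' :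
  perm_eq ((znf e).1 ++ (znf e').2) ((znf e').1 ++ (znf e).2) ->
  zeval env e = zeval env e'.
Proof.
move=> p; rewrite !zevalE; apply/eqP; rewrite subr_eq addrAC eq_sym subr_eq eq_sym.
by rewrite -!big_cat /=; apply/eqP/perm_big.
Qed.

End ZmodTactic.

Ltac zm_find same x l :=
  lazymatch l with
  | ?y :: ?l' =>
    match constr:(Set) with
    | _ => let _ := match constr:(Set) with _ => same x y end in constr:(O)
    | _ => let n := zm_find same x l' in constr:(S n)
    end
  end.
(* The same atom may be written with different structure instances; only the
   second search sees through this. *)
Ltac zm_index x l :=
  match constr:(Set) with
  | _ => zm_find ltac:(fun a b => constr_eq a b) x l
  | _ => zm_find ltac:(fun a b => unify a b) x l
  end.
Ltac zm_add x l :=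
  match constr:(Set) with
  | _ => let _ := zm_index x l in l
  | _ => constr:(x :: l)
  end.
Ltac zm_vars t l :=
  lazymatch t with
  | (?a + ?b)%R => let l := zm_vars a l in zm_vars b l
  | (- ?a)%R => zm_vars a l
  | (0)%R => l
  | _ => zm_add t l
  end.
Ltac zm_reify t l :=
  lazymatch t with
  | (?a + ?b)%R =>
    let a := zm_reify a l in let b := zm_reify b l in constr:(ZAdd a b)
  | (- ?a)%R => let a := zm_reify a l in constr:(ZOpp a)
  | (0)%R => constr:(ZZero)
  | _ => let i := zm_index t l in constr:(ZVar i)
  end.
(** Decides equations between sums and opposites, by counting how often each
    atom occurs with each sign. *)
Ltac zmod :=
  lazymatch goal with
  | |- @eq ?T ?x ?y =>
    let l := zm_vars x (@nil T) in let l := zm_vars y l in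
    let e := zm_reify x l in let e' := zm_reify y l in
    exact (@zeval_eq _ l e e' isT)
  end.

(** * Cycles, boundaries, homotopies *)
Section Basics.
Variable R : comPzRingType.

Lemma scaler_comm (M : lmodType R) a b (x : M) : a *: (b *: x) = b *: (a *: x).
Proof. by rewrite !scalerA mulrC. Qed.

Implicit Types X Y Z W : complex R.

(** Degrees are written [n + 1], so that a boundary has an explicit source and
    no cast between the modules in degrees [n] and [n - 1 + 1] is needed. *)
Definition cycle X n (x : X (n + 1)) : Prop := diff X (n + 1) x = 0.
Definition boundary X n (x : X (n + 1)) : Prop := exists z : X n, x = diff X n z.
Definition acyclic X : Prop := forall n (x : X (n + 1)), cycle x -> boundary x.

Lemma boundary0 X n : boundary (0 : X (n + 1)).
Proof. by exists 0; rewrite linear0. Qed.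
Lemma boundaryD X n (x y : X (n + 1)) :
  boundary x -> boundary y -> boundary (x + y).
Proof. by move=> [u ->] [v ->]; exists (u + v); rewrite linearD. Qed.
Lemma boundaryN X n (x : X (n + 1)) : boundary x -> boundary (- x).
Proof. by move=> [u ->]; exists (- u); rewrite linearN. Qed.
Lemma boundaryB X n (x y : X (n + 1)) :
  boundary x -> boundary y -> boundary (x - y).
Proof. by move=> bx /boundaryN; exact: boundaryD. Qed.
Lemma boundaryZ X n a (x : X (n + 1)) : boundary x -> boundary (a *: x).
Proof. by move=> [u ->]; exists (a *: u); rewrite linearZ. Qed.
Lemma boundary_diff X n (z : X n) : boundary (diff X n z).
Proof. by exists z. Qed.
Lemma boundary_trans X n (x y : X (n + 1)) :
  boundary (x - y) -> boundary y -> boundary x.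
Proof. by move=> h /(boundaryD h); rewrite subrK. Qed.

Lemma cycle0 X n : cycle (0 : X (n + 1)).
Proof. exact: linear0. Qed.
Lemma cycleD X n (x y : X (n + 1)) : cycle x -> cycle y -> cycle (x + y).
Proof. by rewrite /cycle linearD => -> ->; rewrite addr0. Qed.
Lemma cycleN X n (x : X (n + 1)) : cycle x -> cycle (- x).
Proof. by rewrite /cycle linearN => ->; rewrite oppr0. Qed.
Lemma cycleB X n (x y : X (n + 1)) : cycle x -> cycle y -> cycle (x - y).
Proof. by move=> bx /cycleN; exact: cycleD. Qed.
Lemma cmap_cycle X Y (f : chain_map X Y) n (x : X (n + 1)) :
  cycle x -> cycle (f (n + 1) x).
Proof. by rewrite /cycle -cmapC => ->; rewrite linear0. Qed.
Lemma cmap_boundary X Y (f : chain_map X Y) n (x : X (n + 1)) :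
  boundary x -> boundary (f (n + 1) x).
Proof. by move=> [z ->]; exists (f n z); rewrite cmapC. Qed.

Definition hom_inj X Y (f : chain_map X Y) : Prop :=
  forall n (x : X (n + 1)), cycle x -> boundary (f (n + 1) x) -> boundary x.
Definition hom_surj X Y (f : chain_map X Y) : Prop :=
  forall n (y : Y (n + 1)), cycle y ->
    exists2 x : X (n + 1), cycle x & boundary (y - f (n + 1) x).

Lemma quasi_isoP X Y (f : chain_map X Y) :
  quasi_iso f <-> hom_inj f /\ hom_surj f.
Proof.
split=> [qf|[fi fs] n].
  split=> n; have [fi fs] := qf n; first exact: fi.
  move=> y cy; have [x cx [z ->]] := fs y cy; exists x => //.
  by rewrite addrAC subrr add0r; exists z.
split=> [x|y cy]; first exact: fi.
have [x cx [z e]] := fs n y cy; exists x => //; exists z.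
by rewrite -e [RHS]addrC subrK.
Qed.

Lemma int_succ_ind (P : int -> Prop) : (forall n, P (n + 1)) -> forall n, P n.
Proof. by move=> h n; rewrite -(subrK 1 n). Qed.

Lemma cone_eq X Y (f : chain_map X Y) n (p q : cone f n) :
  p.1 = q.1 -> p.2 = q.2 -> p = q.
Proof. by case: p q => [a b] [c d] /= -> ->. Qed.

Lemma acyclic_qi X Y (f : chain_map X Y) : quasi_iso f -> acyclic X <-> acyclic Y.
Proof.
move/quasi_isoP => [fi fs]; split=> [aX n y cy|aY n x cx].
  have [x cx b] := fs n y cy; apply: boundary_trans b _.
  exact/cmap_boundary/aX.
by apply: fi => //; apply/aY/cmap_cycle.
Qed.

Lemma acyclic_quasi_iso X Y (f : chain_map X Y) :
  acyclic X -> acyclic Y -> quasi_iso f.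
Proof.
move=> aX aY; apply/quasi_isoP; split=> [n x cx _|n y cy]; first exact: aX.
by exists 0; [exact: cycle0|rewrite linear0 subr0; exact: aY].
Qed.

Lemma homotopic_eq X Y (f g : chain_map X Y) :
  (forall n x, f n x = g n x) -> homotopic f g.
Proof.
by move=> e; exists (fun _ => \0) => n x; rewrite e subrr linear0 addr0.
Qed.

Lemma lincomb_linear (U V : lmodType R) (a : R) (f g : {linear U -> V}) :
  linear (fun x => f x + a *: g x).
Proof.
by move=> b x y; rewrite !linearP /= !scalerDr addrACA.
Qed.

Lemma homotopic_sym X Y (f g : chain_map X Y) : homotopic f g -> homotopic g f.
Proof.
move=> [h hE]; exists (fun n => mklin (lincomb_linear (-1) \0 (h n))) => n x /=.
by rewrite !add0r linearZ /= -scalerDr -hE scaleN1r opprB.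
Qed.

Lemma homotopic_trans X Y (f g k : chain_map X Y) :
  homotopic f g -> homotopic g k -> homotopic f k.
Proof.
move=> [h hE] [h' hE'].
exists (fun n => mklin (lincomb_linear 1 (h n) (h' n))) => n x /=.
by rewrite !scale1r linearD addrACA -hE -hE' addrA subrK.
Qed.

Lemma comp_linear (U V V' : lmodType R) (f : {linear U -> V})
  (g : {linear V -> V'}) : linear (fun x => g (f x)).
Proof. by move=> a x y; rewrite !linearP. Qed.

Definition lcomp (U V V' : lmodType R) (f : {linear U -> V})
  (g : {linear V -> V'}) : {linear U -> V'} := mklin (comp_linear f g).

Lemma homotopic_compl X Y Z (f g : chain_map X Y) (k : chain_map Y Z) :
  homotopic f g -> homotopic (chain_comp f k) (chain_comp g k).
Proof.
move=> [h hE]; exists (fun n => lcomp (h n) (k n)) => n x /=.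
by rewrite -linearB hE linearD cmapC.
Qed.

Lemma homotopic_compr X Y Z (k : chain_map X Y) (f g : chain_map Y Z) :
  homotopic f g -> homotopic (chain_comp k f) (chain_comp k g).
Proof.
move=> [h hE]; exists (fun n => lcomp (k (n + 1)) (h n)) => n x /=.
by rewrite hE cmapC.
Qed.

Lemma homotopic_boundary X Y (f g : chain_map X Y) n (x : X (n + 1)) :
  homotopic f g -> cycle x -> boundary (f (n + 1) x - g (n + 1) x).
Proof.
by move=> [h ->] ->; rewrite linear0 addr0; exact: boundary_diff.
Qed.

Lemma homotopic_boundaryE X Y (f g : chain_map X Y) n (x : X (n + 1)) :
  homotopic f g -> cycle x -> boundary (g (n + 1) x) -> boundary (f (n + 1) x).
Proof. by move=> fg /(homotopic_boundary fg); exact: boundary_trans. Qed.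

Lemma homotopic_quasi_iso X Y (f g : chain_map X Y) :
  homotopic f g -> quasi_iso f -> quasi_iso g.
Proof.
move=> fg /quasi_isoP[fi fs]; apply/quasi_isoP; split=> [n x cx b|n y cy].
  by apply: fi => //; apply: homotopic_boundaryE fg cx b.
have [x cx b] := fs n y cy; exists x => //.
have := boundaryD b (homotopic_boundary fg cx).
by rewrite addrA subrK.
Qed.

Lemma quasi_iso_cancell X Y Z (f : chain_map X Y) (g : chain_map Y Z) :
  quasi_iso f -> quasi_iso (chain_comp f g) -> quasi_iso g.
Proof.
move=> /quasi_isoP[fi fs] /quasi_isoP[gi gs].
apply/quasi_isoP; split=> [n y cy b|n z cz].
  have [x cx bx] := fs n y cy; apply: (boundary_trans bx).
  apply: cmap_boundary; apply: gi => //=.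
  have := cmap_boundary g bx; rewrite linearB => /boundaryN; rewrite opprB.
  by move/boundary_trans; apply.
by have [x cx b] := gs n z cz; exists (f (n + 1) x) => //; exact: cmap_cycle.
Qed.

Lemma cmap_eq_quasi_iso X Y (f g : chain_map X Y) :
  (forall n x, f n x = g n x) -> quasi_iso f -> quasi_iso g.
Proof. by move=> e; apply/homotopic_quasi_iso/homotopic_eq. Qed.

Section HpoMap.
Variables (Y Z W T : complex R) (s : chain_map Y Z) (g : chain_map Y W).
Variables (p : chain_map Z T) (q : chain_map W T).
Hypothesis pq : homotopic (chain_comp s p) (chain_comp g q).

(** A chain map out of the homotopy pushout is a pair of chain maps on [Z] and
    [W] with a homotopy between their restrictions to [Y], which is its value on
    the shifted component. *)
Lemma hpo_map_ex : exists u : chain_map (hpo s g) T,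
  (forall n z, u n (hpo_inl s g n z) = p n z) /\
  (forall n w, u n (hpo_inr s g n w) = q n w).
Proof.
have [h hE] := pq.
pose u n (x : hpo s g n) := p n x.2.1 + q n x.2.2 + h n x.1.
have ul n : linear (u n).
  move=> a [y [z w]] [y' [z' w']]; rewrite /u /= !linearP /= !scalerDr.
  by rewrite [RHS]addrACA; congr (_ + _); exact: addrACA.
have uC n x : mklin (ul (n + 1)) (diff (hpo s g) n x) =
    diff T n (mklin (ul n) x).
  case: x => y [z w]; rewrite /= /u /= !linearD !linearN /= !cmapC.
  move: (hE n y) => /= /eqP; rewrite subr_eq => /eqP ->.
  by zmod.
exists (ChainMap uC); split=> n x /=; rewrite /u /= !linear0 !addr0 //.
by rewrite add0r.
Qed.

End HpoMap.

Lemma hpo_homotopic Y Z W (s : chain_map Y Z) (g : chain_map Y W) :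
  homotopic (chain_comp s (hpo_inl s g)) (chain_comp g (hpo_inr s g)).
Proof.
pose h n (y : Y (n + 1)) : hpo s g n := (y, (0, 0)).
have hl n : linear (h n).
  by move=> a y y'; congr (_, (_, _)); rewrite /= scaler0 addr0.
exists (fun n => mklin (hl n)) => n y; congr (_, (_, _)) => /=.
- by zmod.
- by rewrite ?linear0; zmod.
- by rewrite ?linear0; zmod.
Qed.

End Basics.

(** * Fractions in the derived category *)
Section DerivedMorphisms.
Variable R : comPzRingType.
Implicit Types X Y Z W T : complex R.

(** A composite of fractions lives on a homotopy pushout.  Mapping out of the
    latter is mapping out of the two apexes, so that equality of a composite
    with another fraction can be tested without opening the pushout. *)
Lemma deq_dcompl X Y Z (a : dmor X Y) (b : dmor Y Z) (c : dmor X Z) T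
    (p : chain_map (dapex a) T) (q : chain_map (dapex b) T)
    (v : chain_map (dapex c) T) :
  homotopic (chain_comp (dden a) p) (chain_comp (dnum b) q) ->
  quasi_iso (chain_comp (dden b) q) ->
  homotopic (chain_comp (dnum a) p) (chain_comp (dnum c) v) ->
  homotopic (chain_comp (dden b) q) (chain_comp (dden c) v) ->
  deq (dcomp a b) c.
Proof.
move=> pq qq nn dd; have [u [ul ur]] := hpo_map_ex pq.
exists T, u, v; split.
- by apply: cmap_eq_quasi_iso qq => n x /=; rewrite (ur n).
- apply: homotopic_trans nn; apply: homotopic_eq => n x /=; exact: ul.
- apply: homotopic_trans dd; apply: homotopic_eq => n x /=; exact: ur.
Qed.

Lemma deq_dcomp2 X Y Y' Z (a : dmor X Y) (b : dmor Y Z)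
    (a' : dmor X Y') (b' : dmor Y' Z) T
    (p : chain_map (dapex a) T) (q : chain_map (dapex b) T)
    (p' : chain_map (dapex a') T) (q' : chain_map (dapex b') T) :
  homotopic (chain_comp (dden a) p) (chain_comp (dnum b) q) ->
  homotopic (chain_comp (dden a') p') (chain_comp (dnum b') q') ->
  quasi_iso (chain_comp (dden b) q) ->
  homotopic (chain_comp (dnum a) p) (chain_comp (dnum a') p') ->
  homotopic (chain_comp (dden b) q) (chain_comp (dden b') q') ->
  deq (dcomp a b) (dcomp a' b').
Proof.
move=> pq pq' qq nn dd; have [v [vl vr]] := hpo_map_ex pq'.
apply: (@deq_dcompl _ _ _ a b (dcomp a' b') T p q v) => //.
  by apply: homotopic_trans nn _; apply: homotopic_eq => n x /=; rewrite (vl n).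
by apply: homotopic_trans dd _; apply: homotopic_eq => n x /=; rewrite (vr n).
Qed.

Lemma is_diso_dof X Y (f : chain_map X Y) : quasi_iso f -> is_diso (dof f).
Proof.
move=> qf; pose b := @Dmor _ _ _ _ (chain_id Y) f qf; exists b; split.
  apply: (@deq_dcompl _ _ _ (dof f) b (did X) Y (chain_id Y) (chain_id Y) f) => //.
  all: try exact: homotopic_eq.
apply: (@deq_dcompl _ _ _ b (dof f) (did Y) Y (chain_id Y) (chain_id Y) (chain_id Y)).
all: try exact: homotopic_eq.
exact: quasi_iso_comp (quasi_iso_id _) (quasi_iso_id _).
Qed.

Lemma disomorphic_quasi_iso X Y (f : chain_map X Y) :
  quasi_iso f -> disomorphic X Y.
Proof. by move=> qf; exists (dof f); exact: is_diso_dof. Qed.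

Lemma disomorphic_sym X Y : disomorphic X Y -> disomorphic Y X.
Proof. by move=> [a [b [ab ba]]]; exists b, a. Qed.

(** The two equations satisfied by the inverse of a fraction [X -f-> A <-s- Y]
    make [f] injective and surjective in homology.  Invariance of a property
    under isomorphism in D(R) is thereby reduced to quasi-isomorphisms. *)
Lemma disomorphicP X Y : disomorphic X Y ->
  exists A (f : chain_map X A) (s : chain_map Y A), quasi_iso f /\ quasi_iso s.
Proof.
move=> [[A f s qs] [[B g t qt] [[T [u [v [/= q1 n1 d1]]]]
  [T' [u' [v' [/= q2 n2 d2]]]]]]].
exists A, f, s; split=> //.
have {n1 d1 q1}q1 : quasi_iso (chain_comp (chain_comp f (hpo_inl s g)) u).
  apply: homotopic_quasi_iso q1; apply: homotopic_trans d1 _.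
  exact: homotopic_sym.
have q3 : quasi_iso (chain_comp (hpo_inr t f) u').
  by apply: (quasi_iso_cancell qs); apply: cmap_eq_quasi_iso q2.
apply/quasi_isoP; split=> [n x cx b|n y cy].
  have [i _] := (iffLR (quasi_isoP _) q1).
  exact: i cx (cmap_boundary (chain_comp (hpo_inl s g) u) b).
have [_ ss] := (iffLR (quasi_isoP _) qs).
have [_ ts] := (iffLR (quasi_isoP _) qt).
have [z cz bz] := ss n y cy.
have [x cx bx] := ts n (g (n + 1) z) (cmap_cycle g cz).
exists x => //; rewrite -(subrK (s (n + 1) z) y) -addrA; apply: boundaryD => //.
have [i _] := (iffLR (quasi_isoP _) q3); apply: i.
  by apply: cycleB; apply: cmap_cycle.
(* In homology, with [l] and [r] the maps to the pushout of [t] and [f]: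
   u' r (s z) = u' l (g z) = u' l (t x) = u' r (f x). *)
have h1 := homotopic_boundary n2 cz.
have h2 := homotopic_boundary d2 cz.
have h3 := homotopic_boundary (homotopic_compl u' (hpo_homotopic t f)) cx.
have h4 := cmap_boundary (chain_comp (hpo_inl t f) u') bx.
rewrite !linearB /= in h1 h2 h3 h4 *.
have := boundaryD (boundaryB h2 h1) (boundaryD h4 h3).
by congr boundary; zmod.
Qed.

Lemma exact_triangle_cone X Y (f : chain_map X Y) :
  exact_triangle (dof f) (dof (cone_in f)) (dof (cone_out f)).
Proof.
exists X, Y, f, (did X), (did Y), (did (cone f)); split.
  by split; apply/is_diso_dof/quasi_iso_id.
have qid Z : quasi_iso (chain_comp (chain_id Z) (chain_id Z)).
  exact: quasi_iso_comp (quasi_iso_id _) (quasi_iso_id _).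
split.
- apply: (@deq_dcomp2 _ _ _ _ (dof f) (did Y) (did X) (dof f) Y (chain_id Y)
    (chain_id Y) f (chain_id Y)); try exact: homotopic_eq.
  exact: qid.
- apply: (@deq_dcomp2 _ _ _ _ (dof (cone_in f)) (did _) (did _) (dof (cone_in f))
    (cone f) (chain_id _) (chain_id _) (cone_in f) (chain_id _));
    try exact: homotopic_eq.
  exact: qid.
- apply: (@deq_dcomp2 _ _ _ _ (dof (cone_out f)) (dshift (did _)) (did _)
    (dof (cone_out f)) (shift X) (chain_id _) (chain_id _) (cone_out f)
    (chain_id _)); try exact: homotopic_eq.
  by apply: cmap_eq_quasi_iso (quasi_iso_id _).
Qed.

End DerivedMorphisms.

(** * Direct sums of modules *)
Section DirectSum.
Variables (R : comPzRingType) (I : Type) (M : I -> lmodType R).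

Definition dsum_eval (N : lmodType R) (phi : forall i, {linear M i -> N})
    (s : seq {i : I & M i}) : N :=
  \sum_(p <- s) phi (projT1 p) (projT2 p).

(** Two formal sums are identified when no family of linear maps separates
    them, which makes the universal property immediate. *)
Definition dsum_rel (s t : seq {i : I & M i}) : Prop :=
  forall (N : lmodType R) (phi : forall i, {linear M i -> N}),
    dsum_eval phi s = dsum_eval phi t.

Definition dsum_scale (a : R) (s : seq {i : I & M i}) : seq {i : I & M i} :=
  [seq existT M (projT1 p) (a *: projT2 p) | p <- s].

Lemma dsum_eval_cat (N : lmodType R) (phi : forall i, {linear M i -> N}) s t :
  dsum_eval phi (s ++ t) = dsum_eval phi s + dsum_eval phi t.
Proof. exact: big_cat. Qed.

Lemma dsum_eval_scale (N : lmodType R) (phi : forall i, {linear M i -> N}) a s :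
  dsum_eval phi (dsum_scale a s) = a *: dsum_eval phi s.
Proof.
rewrite /dsum_eval big_map scaler_sumr; apply: eq_bigr => p _ /=.
by rewrite linearZ.
Qed.

Definition dsum_premodule : premodule R.
Proof.
refine (@Premodule R (seq {i : I & M i}) dsum_rel [::] (dsum_scale (-1)) cat
  dsum_scale _ _ _ _ _ _ _ _ _ _ _ _ _ _).
- by [].
- by move=> s t st N phi; rewrite st.
- by move=> s t u st tu N phi; rewrite st.
- by move=> s t st N phi; rewrite !dsum_eval_scale st.
- by move=> s s' t t' ss' tt' N phi; rewrite !dsum_eval_cat ss' tt'.
- by move=> a s t st N phi; rewrite !dsum_eval_scale st.
- by move=> s t u N phi; rewrite !dsum_eval_cat addrA.
- by move=> s t N phi; rewrite !dsum_eval_cat [LHS]addrC.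
- by [].
- by move=> s N phi; rewrite dsum_eval_cat dsum_eval_scale scaleN1r addNr
    /dsum_eval big_nil.
- by move=> a b s N phi; rewrite !dsum_eval_scale scalerA.
- by move=> s N phi; rewrite dsum_eval_scale scale1r.
- by move=> a s t N phi; rewrite !(dsum_eval_scale, dsum_eval_cat) scalerDr.
- by move=> a b s N phi; rewrite !(dsum_eval_scale, dsum_eval_cat) scalerDl.
Defined.

Definition dsum : lmodType R := quotmod dsum_premodule.

Lemma dsum_qcl_eq (s t : seq {i : I & M i}) :
  (forall (N : lmodType R) (phi : forall i, {linear M i -> N}),
    dsum_eval phi s = dsum_eval phi t) ->
  qcl (p := dsum_premodule) s = qcl (p := dsum_premodule) t.
Proof. by move=> st; exact/qclP. Qed.

Definition dsum_lift_fun (N : lmodType R) (phi : forall i, {linear M i -> N})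
  (x : dsum) : N := dsum_eval phi (qrepr x).

Lemma dsum_lift_qcl (N : lmodType R) (phi : forall i, {linear M i -> N}) s :
  dsum_lift_fun phi (qcl (p := dsum_premodule) s) = dsum_eval phi s.
Proof. exact: (qrepr_rel (p := dsum_premodule)). Qed.

Lemma dsum_lift_linear (N : lmodType R) (phi : forall i, {linear M i -> N}) :
  linear (dsum_lift_fun phi).
Proof.
move=> a x y; rewrite -(qreprK x) -(qreprK y) -qclZ -qclD !dsum_lift_qcl.
by rewrite dsum_eval_cat dsum_eval_scale.
Qed.

Definition dsum_lift (N : lmodType R) (phi : forall i, {linear M i -> N}) :
  {linear dsum -> N} := mklin (dsum_lift_linear phi).

Definition dsum_inj_fun i (x : M i) : dsum :=
  qcl (p := dsum_premodule) [:: existT M i x].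

Lemma dsum_inj_linear i : linear (@dsum_inj_fun i).
Proof.
move=> a x y; rewrite /dsum_inj_fun -qclZ -qclD; apply: dsum_qcl_eq => N phi.
by rewrite /dsum_eval /= !big_cons !big_nil !addr0 /= linearP linearZ.
Qed.

Definition dsum_inj i : {linear M i -> dsum} := mklin (@dsum_inj_linear i).

Lemma dsum_lift_inj (N : lmodType R) (phi : forall i, {linear M i -> N}) i x :
  dsum_lift phi (dsum_inj i x) = phi i x.
Proof. by rewrite /= dsum_lift_qcl /dsum_eval big_seq1. Qed.

Lemma dsum_ind (Q : dsum -> Prop) :
  Q 0 -> (forall i x y, Q y -> Q (dsum_inj i x + y)) -> forall x, Q x.
Proof.
move=> Q0 QD x; rewrite -(qreprK x); elim: (qrepr x) => [|[i y] s IHs] //.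
rewrite (_ : qcl _ = dsum_inj i y + qcl (p := dsum_premodule) s); first exact: QD.
by rewrite -qclD.
Qed.

Lemma dsum_ext (N : lmodType R) (f g : {linear dsum -> N}) :
  (forall i x, f (dsum_inj i x) = g (dsum_inj i x)) -> forall x, f x = g x.
Proof.
move=> fg; apply: dsum_ind => [|i x y e]; first by rewrite !linear0.
by rewrite !linearD fg e.
Qed.

(** Equality of indices is decided classically, since the index type of a
    coproduct is arbitrary. *)
Definition transport_lin i j : {linear M j -> M i} :=
  match pselect (j = i) with
  | left e => match e in _ = k return {linear M j -> M k} with erefl => idfun end
  | right _ => \0
  end.

Definition dsum_proj i : {linear dsum -> M i} := dsum_lift (transport_lin i).

Lemma dsum_proj_inj i x : dsum_proj i (dsum_inj i x) = x.
Proof.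
rewrite /dsum_proj dsum_lift_inj /transport_lin; case: pselect => // e.
by rewrite (Prop_irrelevance e erefl).
Qed.

Lemma dsum_proj_neq i j x : j <> i -> dsum_proj i (dsum_inj j x) = 0.
Proof.
by move=> ji; rewrite /dsum_proj dsum_lift_inj /transport_lin; case: pselect.
Qed.

(** Finiteness of supports, in the form of a finite sum of components.  The
    induction needs the equation for all repetition-free lists that contain a
    support, since the support of a sum is not known exactly. *)
Lemma dsum_decomp x :
  exists s : seq I, x = \sum_(i <- s) dsum_inj i (dsum_proj i x).
Proof.
suff [s0 h] : exists s0 : seq {classic I}, forall s : seq {classic I}, uniq s ->
    {subset s0 <= s} -> x = \sum_(i <- s) dsum_inj i (dsum_proj i x).
  exists (undup s0); apply: h => [|i]; first exact: undup_uniq.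
  by rewrite mem_undup.
move: x; apply: dsum_ind => [|i x y [s0 h]].
  by exists [::] => s _ _; rewrite big1 // => i _; rewrite !linear0.
exists (i :: s0) => s us s0s.
under eq_bigr => j _ do rewrite linearD [dsum_inj _ _]linearD.
rewrite big_split /= -h //; last by move=> j js; apply: s0s; rewrite inE js orbT.
rewrite (bigD1_seq (i : {classic I})) //=; last by apply: s0s; rewrite inE eqxx.
rewrite [dsum_lift_fun _ _]dsum_proj_inj big1 ?addr0 // => j ji.
rewrite [dsum_lift_fun _ _]dsum_proj_neq; first exact: (linear0 (dsum_inj j)).
by move=> ij; rewrite ij eqxx in ji.
Qed.

End DirectSum.

(** * Direct sums of complexes are coproducts *)
Section DirectSumComplex.
Variables (R : comPzRingType) (I : Type).
Implicit Types X Y : I -> complex R.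

Definition dsum_map (M N : I -> lmodType R) (f : forall i, {linear M i -> N i}) :
  {linear dsum M -> dsum N} := dsum_lift (fun i => lcomp (f i) (dsum_inj N i)).

Lemma dsum_map_inj (M N : I -> lmodType R) (f : forall i, {linear M i -> N i}) i x :
  dsum_map f (dsum_inj M i x) = dsum_inj N i (f i x).
Proof. exact: dsum_lift_inj. Qed.

Lemma dsum_proj_map (M N : I -> lmodType R) (f : forall i, {linear M i -> N i}) i x :
  dsum_proj N i (dsum_map f x) = f i (dsum_proj M i x).
Proof.
move: x; apply: (dsum_ext (f := lcomp (dsum_map f) (dsum_proj N i))
  (g := lcomp (dsum_proj M i) (f i))) => j x.
change (dsum_proj N i (dsum_map f (dsum_inj M j x)) =
  f i (dsum_proj M i (dsum_inj M j x))).
rewrite dsum_map_inj; case: (pselect (j = i)) => [ji|ji].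
  by subst j; rewrite !dsum_proj_inj.
by rewrite !dsum_proj_neq // linear0.
Qed.

Lemma dsumK X n (x : dsum (fun i => X i n)) :
  dsum_map (fun i => diff (X i) (n + 1)) (dsum_map (fun i => diff (X i) n) x) = 0.
Proof.
pose d n := dsum_map (fun i => diff (X i) n).
apply: (dsum_ext (f := lcomp (d n) (d (n + 1))) (g := \0)) => i {}x.
change (d (n + 1) (d n (dsum_inj (fun i => X i n) i x)) = 0).
by rewrite /d !dsum_map_inj diffK linear0.
Qed.

Definition dsumC X : complex R :=
  @Complex R (fun n => dsum (fun i => X i n))
    (fun n => dsum_map (fun i => diff (X i) n)) (@dsumK X).

Lemma dsumC_injC X i n (x : X i n) :
  dsum_inj (fun i => X i (n + 1)) i (diff (X i) n x) =
  diff (dsumC X) n (dsum_inj (fun i => X i n) i x).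
Proof. by symmetry; exact: dsum_map_inj. Qed.

Definition dsumC_inj X i : chain_map (X i) (dsumC X) :=
  @ChainMap R (X i) (dsumC X) (fun n => dsum_inj (fun i => X i n) i)
    (@dsumC_injC X i).

Lemma dsumC_projC X i n (x : dsumC X n) :
  dsum_proj (fun i => X i (n + 1)) i (diff (dsumC X) n x) =
  diff (X i) n (dsum_proj (fun i => X i n) i x).
Proof. exact: dsum_proj_map. Qed.

Definition dsumC_proj X i : chain_map (dsumC X) (X i) :=
  @ChainMap R (dsumC X) (X i) (fun n => dsum_proj (fun i => X i n) i)
    (@dsumC_projC X i).

Lemma dsumC_proj_inj X i n x : dsumC_proj X i n (dsumC_inj X i n x) = x.
Proof. exact: (dsum_proj_inj (M := fun i => X i n)). Qed.
Lemma dsumC_proj_neq X i j n x :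
  j <> i -> dsumC_proj X i n (dsumC_inj X j n x) = 0.
Proof. exact: (dsum_proj_neq (M := fun i => X i n)). Qed.
Lemma dsumC_decomp X n (x : dsumC X n) :
  exists s : seq I, x = \sum_(i <- s) dsumC_inj X i n (dsumC_proj X i n x).
Proof. exact: (dsum_decomp (M := fun i => X i n)). Qed.
Lemma dsumC_ind X n (Q : dsumC X n -> Prop) :
  Q 0 -> (forall i x y, Q y -> Q (dsumC_inj X i n x + y)) -> forall x, Q x.
Proof. exact: (dsum_ind (M := fun i => X i n)). Qed.

Lemma dsumC_liftC X (Y : complex R) (f : forall i, chain_map (X i) Y) n (x : dsumC X n) :
  dsum_lift (fun i => f i (n + 1)) (diff (dsumC X) n x) =
  diff Y n (dsum_lift (fun i => f i n) x).
Proof.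
pose l n := dsum_lift (fun i => f i n).
apply: (dsum_ext (f := lcomp (diff (dsumC X) n) (l (n + 1)))
  (g := lcomp (l n) (diff Y n))) => i {}x.
change (l (n + 1) (diff (dsumC X) n (dsumC_inj X i n x)) =
  diff Y n (l n (dsum_inj (fun i => X i n) i x))).
rewrite -cmapC [LHS](dsum_lift_inj (fun i => f i (n + 1))) cmapC.
by rewrite [X in _ = diff Y n X](dsum_lift_inj (fun i => f i n)).
Qed.

Definition dsumC_lift X (Y : complex R) (f : forall i, chain_map (X i) Y) :
  chain_map (dsumC X) Y :=
  @ChainMap R (dsumC X) Y (fun n => dsum_lift (fun i => f i n))
    (@dsumC_liftC X Y f).

Lemma dsumC_lift_inj X (Y : complex R) (f : forall i, chain_map (X i) Y) i n x :
  dsumC_lift f n (dsumC_inj X i n x) = f i n x.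
Proof. exact: (dsum_lift_inj (M := fun i => X i n)). Qed.

Lemma dsumC_ext X (Y : complex R) (f g : chain_map (dsumC X) Y) n :
  (forall i x, f n (dsumC_inj X i n x) = g n (dsumC_inj X i n x)) ->
  forall x, f n x = g n x.
Proof. exact: (dsum_ext (M := fun i => X i n)). Qed.

Definition dsumC_map X Y (f : forall i, chain_map (X i) (Y i)) :
  chain_map (dsumC X) (dsumC Y) :=
  dsumC_lift (fun i => chain_comp (f i) (dsumC_inj Y i)).

Lemma dsumC_map_inj X Y (f : forall i, chain_map (X i) (Y i)) i n x :
  dsumC_map f n (dsumC_inj X i n x) = dsumC_inj Y i n (f i n x).
Proof. exact: (dsumC_lift_inj (fun i => chain_comp (f i) (dsumC_inj Y i))). Qed.

Lemma dsumC_proj_map X Y (f : forall i, chain_map (X i) (Y i)) i n x :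
  dsumC_proj Y i n (dsumC_map f n x) = f i n (dsumC_proj X i n x).
Proof. exact: (dsum_proj_map (fun i => f i n)). Qed.

Lemma dsumC_homotopic X (Y : complex R) (f g : chain_map (dsumC X) Y) :
  (forall i, homotopic (chain_comp (dsumC_inj X i) f) (chain_comp (dsumC_inj X i) g)) ->
  homotopic f g.
Proof.
move=> fg.
have fg' i : exists h : forall n, {linear X i (n + 1) -> Y n},
    forall n (x : X i (n + 1)), f (n + 1) (dsumC_inj X i (n + 1) x) -
      g (n + 1) (dsumC_inj X i (n + 1) x) =
      diff Y n (h n x) + h (n + 1) (diff (X i) (n + 1) x).
  exact: fg.
pose h i := projT1 (cid (fg' i)); have hE i := projT2 (cid (fg' i)).
pose H n := dsum_lift (fun i => h i n); exists H => n x.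
rewrite -scaleN1r -[H (n + 1) _]scale1r.
move: x; apply: (dsum_ext
  (f := mklin (lincomb_linear (-1) (f (n + 1)) (g (n + 1))))
  (g := mklin (lincomb_linear 1 (lcomp (H n) (diff Y n))
     (lcomp (diff (dsumC X) (n + 1)) (H (n + 1)))))) => i x.
change (f (n + 1) (dsumC_inj X i (n + 1) x) +
  (-1) *: g (n + 1) (dsumC_inj X i (n + 1) x) =
  diff Y n (H n (dsum_inj (fun i => X i (n + 1)) i x)) +
  1 *: H (n + 1) (diff (dsumC X) (n + 1) (dsumC_inj X i (n + 1) x))).
rewrite scaleN1r scale1r -cmapC hE; congr (diff Y n _ + _); symmetry.
  exact: (dsum_lift_inj (fun i => h i n)).
exact: (dsum_lift_inj (fun i => h i (n + 1))).
Qed.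

Lemma dsumC_cycle X n (x : dsumC X (n + 1)) i :
  cycle x -> cycle (dsumC_proj X i (n + 1) x).
Proof. exact: cmap_cycle. Qed.

Lemma boundary_sum (X : complex R) n (s : seq I) (F : I -> X (n + 1)) :
  (forall i, boundary (F i)) -> boundary (\sum_(i <- s) F i).
Proof.
by move=> h; apply: big_ind => // [|x y]; [exact: boundary0|exact: boundaryD].
Qed.

Lemma dsumC_boundary X n (x : dsumC X (n + 1)) :
  (forall i, boundary (dsumC_proj X i (n + 1) x)) -> boundary x.
Proof.
move=> h; have [s ->] := dsumC_decomp x.
by apply: boundary_sum => i; apply: cmap_boundary.
Qed.

Lemma dsumC_map_quasi_iso X Y (f : forall i, chain_map (X i) (Y i)) :
  (forall i, quasi_iso (f i)) -> quasi_iso (dsumC_map f).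
Proof.
move=> qf; have fi i := (iffLR (quasi_isoP _) (qf i)).1.
have fs i := (iffLR (quasi_isoP _) (qf i)).2.
apply/quasi_isoP; split=> [n x cx b|n y cy].
  apply: dsumC_boundary => i; apply: fi; first exact: dsumC_cycle.
  by rewrite -dsumC_proj_map; apply: cmap_boundary.
have zex i := cid2 (fs i n _ (dsumC_cycle i cy)).
pose z i := s2val (zex i).
have cz i : cycle (z i) := s2valP (zex i).
have bz i : boundary (dsumC_proj Y i (n + 1) y - f i (n + 1) (z i)) :=
  s2valP' (zex i).
have [s ys] := dsumC_decomp y.
exists (\sum_(i <- s) dsumC_inj X i (n + 1) (z i)).
  apply: (big_ind (@cycle _ _ _)) => [|u v|i _]; [exact: cycle0|exact: cycleD|].
  by apply: cmap_cycle.
rewrite [X in X - _]ys (linear_sum (dsumC_map f (n + 1))) -sumrB; apply: boundary_sum => i.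
by rewrite dsumC_map_inj -linearB; apply: cmap_boundary.
Qed.

Definition dsumC_fold (Z : complex R) : chain_map (dsumC (fun _ => Z)) Z :=
  dsumC_lift (fun _ => chain_id Z).

Lemma dsumC_fold_inj (Z : complex R) i n (z : Z n) :
  dsumC_fold Z n (dsumC_inj (fun _ => Z) i n z) = z.
Proof. exact: (dsumC_lift_inj (fun _ => chain_id Z)). Qed.

(** The pushout of [sum Y -> sum A i] along the folding map [sum Y -> Y] glues
    the targets of all the maps [Y -> A i] along their common source. *)
Lemma hpo_fold_homotopic (Y : complex R) (A : I -> complex R)
    (s : forall i, chain_map Y (A i)) i :
  homotopic (chain_comp (chain_comp (s i) (dsumC_inj A i))
               (hpo_inl (dsumC_map s) (dsumC_fold Y)))
            (hpo_inr (dsumC_map s) (dsumC_fold Y)).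
Proof.
have h := homotopic_compr (dsumC_inj (fun _ => Y) i)
  (hpo_homotopic (dsumC_map s) (dsumC_fold Y)).
apply: (homotopic_trans _ (homotopic_trans h _)); apply: homotopic_eq => n x.
  congr (hpo_inl _ _ n _); exact/esym/dsumC_map_inj.
congr (hpo_inr _ _ n _); exact: dsumC_fold_inj.
Qed.

(** Direct sums of complexes are coproducts in D(R).  A family of fractions
    [X i -> A i <- Y] is summed up by the homotopy pushout of
    [sum A i <- sum Y -> Y]; uniqueness is obtained by summing up in the same
    way the complexes where the given equalities of fractions are witnessed. *)
Lemma dsumC_coproduct X : is_coproduct (fun i => dof (dsumC_inj X i)).
Proof.
move=> Y g.
pose A i := dapex (g i); pose s i : chain_map Y (A i) := dden (g i).
pose f i : chain_map (X i) (A i) := dnum (g i).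
pose S := dsumC_map s; pose F := dsumC_map f.
have qS : quasi_iso S by apply: dsumC_map_quasi_iso => i; exact: dden_qi.
pose h := @Dmor R (dsumC X) Y _ (chain_comp F (hpo_inl S (dsumC_fold Y)))
  (hpo_inr S (dsumC_fold Y)) (quasi_iso_hpo_inr (dsumC_fold Y) qS).
exists h; split=> [i|h' h'E].
  apply: (@deq_dcompl _ _ _ _ (dof (dsumC_inj X i)) h (g i) (dapex h) (dnum h)
     (chain_id _) (chain_comp (dsumC_inj A i) (hpo_inl S (dsumC_fold Y)))).
  - exact: homotopic_eq.
  - exact: cmap_eq_quasi_iso (dden_qi h).
  - apply: homotopic_eq => n x; congr (hpo_inl S _ n _).
    exact: (dsumC_map_inj f).
  - apply: homotopic_sym; apply: homotopic_trans (hpo_fold_homotopic s i).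
    exact: homotopic_eq.
pose B := dapex h'; pose s' : chain_map Y B := dden h'.
pose f' : chain_map (dsumC X) B := dnum h'.
have wit i : exists T, exists u : chain_map B T, exists v : chain_map (A i) T,
    [/\ quasi_iso (chain_comp s' u),
        homotopic (chain_comp (chain_comp (dsumC_inj X i) f') u)
                  (chain_comp (f i) v) &
        homotopic (chain_comp s' u) (chain_comp (s i) v)].
  have [T [u [v [q n d]]]] := h'E i; pose inr := hpo_inr (chain_id (dsumC X)) f'.
  exists T, (chain_comp inr u), v; split; first exact: cmap_eq_quasi_iso q.
    apply: homotopic_trans n; apply: homotopic_sym.
    have := homotopic_compr (dsumC_inj X i)
      (homotopic_compl u (hpo_homotopic (chain_id (dsumC X)) f')).
    by apply: homotopic_trans; exact: homotopic_eq.
  by apply: homotopic_trans d; exact: homotopic_eq.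
pose T i := projT1 (cid (wit i)); have wit1 i := projT2 (cid (wit i)).
pose u i : chain_map B (T i) := projT1 (cid (wit1 i)).
have wit2 i := projT2 (cid (wit1 i)).
pose v i : chain_map (A i) (T i) := projT1 (cid (wit2 i)).
have qu i : quasi_iso (chain_comp s' (u i)) by case: (projT2 (cid (wit2 i))).
have nuv i : homotopic (chain_comp (chain_comp (dsumC_inj X i) f') (u i))
  (chain_comp (f i) (v i)) by case: (projT2 (cid (wit2 i))).
have duv i : homotopic (chain_comp s' (u i)) (chain_comp (s i) (v i)).
  by case: (projT2 (cid (wit2 i))).
clearbody T u v; clear wit wit1 wit2.
pose U := dsumC_map u; pose inl := hpo_inl U (dsumC_fold B).
pose inr := hpo_inr U (dsumC_fold B).
have qU : quasi_iso U.
  apply: dsumC_map_quasi_iso => i; exact: quasi_iso_cancell (dden_qi h') (qu i).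
have Us' i : homotopic (chain_comp (chain_comp s' (u i))
    (chain_comp (dsumC_inj T i) inl)) (chain_comp s' inr).
  by apply: homotopic_trans (homotopic_compr s' (hpo_fold_homotopic u i));
    exact: homotopic_eq.
have hq : homotopic (chain_comp S (chain_comp (dsumC_map v) inl))
    (chain_comp (dsumC_fold Y) (chain_comp s' inr)).
  apply: dsumC_homotopic => i.
  apply: (homotopic_trans _ (homotopic_trans
    (homotopic_sym (homotopic_compl (chain_comp (dsumC_inj T i) inl) (duv i)))
    (homotopic_trans (Us' i) _))); apply: homotopic_eq => n x.
    congr (inl n _); rewrite [LHS]/= -[RHS]/(dsumC_inj T i n (v i n (s i n x))).
    by rewrite -(dsumC_map_inj v) -(dsumC_map_inj s).
  by congr (inr n (s' n _)); rewrite dsumC_fold_inj.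
have [w [wl wr]] := hpo_map_ex hq.
exists (hpo U (dsumC_fold B)), inr, w; split.
- apply: quasi_iso_comp (dden_qi h') _; exact: quasi_iso_hpo_inr.
- apply: dsumC_homotopic => i.
  have := homotopic_compl (chain_comp (dsumC_inj T i) inl) (nuv i).
  have := homotopic_compr (chain_comp (dsumC_inj X i) f') (hpo_fold_homotopic u i).
  move=> /homotopic_sym h1 h2; apply: (homotopic_trans (homotopic_trans _ h1)).
    exact: homotopic_eq.
  apply: (homotopic_trans (homotopic_trans _ h2)); first exact: homotopic_eq.
  apply: homotopic_eq => n x; rewrite [RHS](wl n).
  congr (inl n _); rewrite -[LHS]/(dsumC_inj T i n (v i n (f i n x))).
  by rewrite -(dsumC_map_inj v) -(dsumC_map_inj f).
- by apply: homotopic_eq => n x; rewrite [RHS](wr n).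
Qed.

End DirectSumComplex.

(** * Short exact sequences and localising classes *)
Section ShortExact.
Variables (R : comPzRingType) (A B C : complex R).
Variables (i : chain_map A B) (p : chain_map B C).

(** For a degreewise exact sequence [C] is the cone of [i], and the shift of [A]
    is the cone of [p], up to quasi-isomorphism. *)
Definition short_exact : Prop := forall n,
  [/\ forall x, i n x = 0 -> x = 0,
      forall y, p n y = 0 -> exists x, y = i n x,
      forall x, p n (i n x) = 0 &
      forall z, exists y, p n y = z].

Hypothesis ip : short_exact.

Let i_inj n x : i n x = 0 -> x = 0. Proof. by case: (ip n) => h _ _ _; exact: h. Qed.
Let ip_exact n y : p n y = 0 -> exists x, y = i n x.
Proof. by case: (ip n) => _ h _ _; exact: h. Qed.
Let pi0 n x : p n (i n x) = 0. Proof. by case: (ip n). Qed.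
Let p_surj n z : exists y, p n y = z. Proof. by case: (ip n). Qed.

Lemma cone_coker_linear n : linear (fun x : cone i n => p n x.2).
Proof. by move=> a x y /=; rewrite linearP. Qed.

Lemma cone_cokerC n (x : cone i n) :
  p (n + 1) (i (n + 1) x.1 + diff B n x.2) = diff C n (p n x.2).
Proof. by rewrite linearD /= pi0 add0r cmapC. Qed.

Definition cone_coker : chain_map (cone i) C :=
  @ChainMap R (cone i) C (fun n => mklin (@cone_coker_linear n)) cone_cokerC.

Lemma cone_coker_quasi_iso : quasi_iso cone_coker.
Proof.
apply/quasi_isoP; split=> n.
  move=> [a b] [/= /eqP]; rewrite oppr_eq0 => /eqP da iab [c pb].
  have [b' b'c] := p_surj c; rewrite /= -b'c -cmapC in pb.
  have [|a' a'E] := @ip_exact _ (b - diff B n b'); first by rewrite linearB /= pb subrr.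
  have bE : b = i (n + 1) a' + diff B n b' by rewrite -a'E subrK.
  exists (a', b'); apply: cone_eq => //=; apply/esym/eqP; rewrite -subr_eq0.
  apply/eqP/i_inj; rewrite linearB linearN /= cmapC -opprD; apply/eqP; rewrite oppr_eq0.
  apply/eqP; rewrite [LHS]addrC -[RHS]iab; congr (_ + _).
  by rewrite [in RHS]bE linearD diffK addr0.
move=> c dc; have [b bc] := p_surj c; subst c.
have [|a aE] := @ip_exact _ (diff B (n + 1) b); first by rewrite cmapC.
exists (- a, b); last by rewrite /= subrr; exact: boundary0.
apply: cone_eq => /=; last by rewrite linearN aE addNr.
by rewrite linearN opprK; apply: i_inj; rewrite cmapC -aE diffK.
Qed.

Lemma ker_cone_linear n : linear (fun a : shift A n => (i (n + 1) a, 0) : cone p n).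
Proof. by move=> a x y; apply: cone_eq; rewrite /= ?linearP ?scaler0 ?addr0. Qed.

Lemma ker_coneC n (x : shift A n) :
  (i (n + 1 + 1) (- diff A (n + 1) x), 0) =
  diff (cone p) n (i (n + 1) x, 0) :> cone p (n + 1).
Proof.
by apply: cone_eq; rewrite /= ?linearN ?cmapC //= linear0 addr0 pi0.
Qed.

Definition ker_cone : chain_map (shift A) (cone p) :=
  @ChainMap R (shift A) (cone p) (fun n => mklin (@ker_cone_linear n)) ker_coneC.

Lemma ker_cone_quasi_iso : quasi_iso ker_cone.
Proof.
apply/quasi_isoP; split=> n.
  move=> a ca [[b c] [/= iaE /esym/eqP]]; rewrite addr_eq0 => /eqP dc.
  have [b0 b0c] := p_surj c; rewrite -b0c -cmapC in dc.
  have [|a0 a0E] := @ip_exact _ (b + diff B n b0).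
    by rewrite linearD /= dc addNr.
  exists a0 => /=; apply/eqP; rewrite -subr_eq0; apply/eqP/i_inj.
  rewrite linearB linearN /= iaE cmapC -a0E linearD diffK addr0.
  by rewrite opprK addNr.
move=> [b c] [/= /eqP]; rewrite oppr_eq0 => /eqP db pbc.
have [b0 b0c] := p_surj c; rewrite -b0c -cmapC in pbc *.
have [|a aE] := @ip_exact _ (b + diff B (n + 1) b0); first by rewrite linearD.
exists a.
  rewrite /cycle /=; apply/eqP; rewrite oppr_eq0; apply/eqP/i_inj.
  by rewrite cmapC -aE linearD diffK addr0.
exists (b0, 0); apply: cone_eq => /=; last by rewrite !linear0; zmod.
by rewrite -aE; zmod.
Qed.

End ShortExact.

Lemma cone_in_quasi_iso (R : comPzRingType) (X Y : complex R)
    (f : chain_map X Y) : acyclic X -> quasi_iso (cone_in f).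
Proof.
move=> aX; apply/quasi_isoP; split=> n.
  move=> y cy [[a y'] e].
  have ya : y = f (n + 1) a + diff Y n y' := congr1 snd e.
  have [a' a'E] : boundary a.
    apply: aX; apply/eqP; rewrite -oppr_eq0; apply/eqP.
    exact/esym/(congr1 fst e).
  by exists (f n a' + y'); rewrite ya a'E linearD cmapC.
move=> [a y] c.
have da : cycle a by apply/eqP; rewrite -oppr_eq0; apply/eqP/(congr1 fst c).
have ay : f _ a + diff Y (n + 1) y = 0 := congr1 snd c.
have [a' a'E] := aX _ _ da.
exists (y + f _ a'); first by rewrite /cycle linearD -cmapC -a'E [LHS]addrC.
exists (- a', 0); apply: (cone_eq (f := f)).
  change (a - 0 = - diff X (n + 1) (- a')).
  by rewrite (linearN (diff X (n + 1))) opprK subr0.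
change (y - (y + f (n + 1) a') = f (n + 1) (- a') + diff Y n 0).
by rewrite (linearN (f (n + 1))) (linear0 (diff Y n)); zmod.
Qed.

Section Closure.
Variables (R : comPzRingType) (L : complex R -> Prop).
Hypothesis locL : localising L.
Implicit Types X Y Z : complex R.

Lemma rV0_eq0 n (x : dzero R n) : x = 0.
Proof. by case: n x => [[|n]|n] x; exact: thinmx0. Qed.

Lemma acyclic_dzero : acyclic (dzero R).
Proof. by move=> n x _; rewrite (rV0_eq0 x); exact: boundary0. Qed.

Lemma chain_zeroC X Y n (x : X n) : (\0 : {linear X (n + 1) -> Y (n + 1)}) (diff X n x) =
  diff Y n ((\0 : {linear X n -> Y n}) x).
Proof. by rewrite /= linear0. Qed.

Definition chain_zero X Y : chain_map X Y :=
  @ChainMap R X Y (fun n => \0) (@chain_zeroC X Y).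

Lemma localising_dzero : L (dzero R). Proof. by case: locL => [[]]. Qed.

Lemma localising_quasi_iso X Y (f : chain_map X Y) : quasi_iso f -> L X <-> L Y.
Proof.
move=> /disomorphic_quasi_iso xy; case: locL => [[_ h _ _] _]; split; apply: h => //.
exact: disomorphic_sym.
Qed.

Lemma localising_acyclic X : acyclic X -> L X.
Proof.
move=> aX; apply/(localising_quasi_iso (f := chain_zero X (dzero R))); last exact: localising_dzero.
exact/acyclic_quasi_iso/acyclic_dzero.
Qed.

Lemma localising_shift X : L X <-> L (shift X).
Proof. by case: locL => [[_ _ h _] _]; exact: h. Qed.

Lemma localising_cone X Y (f : chain_map X Y) : L X -> L Y -> L (cone f).
Proof. by case: locL => [[_ _ _ h] _]; exact/h/exact_triangle_cone. Qed.

Lemma localising_dsum I (X : I -> complex R) : (forall i, L (X i)) -> L (dsumC X).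
Proof. by case: locL => [_ h]; apply: h; exact: dsumC_coproduct. Qed.

Lemma localising_coker X Y Z (i : chain_map X Y) (p : chain_map Y Z) :
  short_exact i p -> L X -> L Y -> L Z.
Proof.
by move=> ip LX LY; apply/(localising_quasi_iso (cone_coker_quasi_iso ip))/localising_cone.
Qed.

Lemma localising_ker X Y Z (i : chain_map X Y) (p : chain_map Y Z) :
  short_exact i p -> L Y -> L Z -> L X.
Proof.
move=> ip LY LZ; apply: (iffRL (localising_shift _)).
by apply/(localising_quasi_iso (ker_cone_quasi_iso ip))/localising_cone.
Qed.

Lemma short_exact_cone X Y (f : chain_map X Y) :
  short_exact (cone_in f) (cone_out f).
Proof.
move=> n; split=> [y []//|[x y] /= ->|//|x]; first by exists y.
by exists (x, 0).
Qed.

(** Rotation: the cone of [i] is [Z], and it is an extension of a shift of [X]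
    by [Y]. *)
Lemma localising_ext X Y Z (i : chain_map X Y) (p : chain_map Y Z) :
  short_exact i p -> L X -> L Z -> L Y.
Proof.
move=> ip LX LZ; apply: localising_ker (short_exact_cone i) _ _; last exact: (iffLR (localising_shift _)).
exact/(localising_quasi_iso (cone_coker_quasi_iso ip)).
Qed.

Lemma localising_cone_source X Y (f : chain_map X Y) : L Y -> L (cone f) -> L X.
Proof.
by move=> LY Lf; apply: (iffRL (localising_shift _)); exact: localising_coker (short_exact_cone f) LY Lf.
Qed.

Lemma localising_cone_target X Y (f : chain_map X Y) : L X -> L (cone f) -> L Y.
Proof.
by move=> LX Lf; apply: localising_ker (short_exact_cone f) Lf _; exact: (iffLR (localising_shift _)).
Qed.

End Closure.

(** * Mapping telescopes *)
Section Telescope.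
Variables (R : comPzRingType) (G : nat -> complex R) (Y : complex R).
Variables (s : forall n, chain_map (G n) (G n.+1)) (f : forall n, chain_map (G n) Y).
Hypothesis fs : forall n k (x : G n k), f n.+1 k (s n k x) = f n k x.
Hypothesis f_surj : forall k (y : Y (k + 1)), cycle y ->
  exists n, exists2 x : G n (k + 1), cycle x & boundary (y - f n (k + 1) x).
Hypothesis f_inj : forall n k (x : G n (k + 1)),
  cycle x -> boundary (f n (k + 1) x) -> boundary (s n (k + 1) x).

Let SG := dsumC G.
Let inj n k : {linear G n k -> SG k} := dsumC_inj G n k.
Let proj n k : {linear SG k -> G n k} := dsumC_proj G n k.

Lemma tel_step_linear n k :
  linear (fun x : G n k => inj n k x - inj n.+1 k (s n k x)).
Proof. by move=> a x y; rewrite !linearP /= scalerDr scalerN; zmod. Qed.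

Lemma tel_stepC n k (x : G n k) :
  inj n (k + 1) (diff (G n) k x) - inj n.+1 (k + 1) (s n (k + 1) (diff (G n) k x)) =
  diff SG k (inj n k x - inj n.+1 k (s n k x)).
Proof. by rewrite linearB /inj /SG -!cmapC. Qed.

(** The components of [1 - shift] on the direct sum of the [G n]. *)
Definition tel_step n : chain_map (G n) SG :=
  @ChainMap R (G n) SG (fun k => mklin (@tel_step_linear n k)) (@tel_stepC n).

Definition tel_map : chain_map SG SG := dsumC_lift tel_step.

Lemma tel_map_inj n k x :
  tel_map k (inj n k x) = inj n k x - inj n.+1 k (s n k x).
Proof. exact: (dsumC_lift_inj tel_step). Qed.

Lemma tel_map_proj0 k x : proj 0%N k (tel_map k x) = proj 0%N k x.
Proof.
apply: (dsumC_ext (f := chain_comp tel_map (dsumC_proj G 0%N))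
  (g := dsumC_proj G 0%N)) => i {}x.
change (proj 0%N k (tel_map k (inj i k x)) = proj 0%N k (inj i k x)).
by rewrite tel_map_inj linearB /= [X in _ - X]dsumC_proj_neq // subr0.
Qed.

Lemma tel_map_projS n k x :
  proj n.+1 k (tel_map k x) = proj n.+1 k x - s n k (proj n k x).
Proof.
have step_linear : linear (fun x : SG k => proj n.+1 k x - s n k (proj n k x)).
  by move=> a u v; rewrite !linearP /= scalerDr scalerN; zmod.
move: x; apply: (dsum_ext (f := lcomp (tel_map k) (proj n.+1 k))
  (g := mklin step_linear)) => i x.
change (proj n.+1 k (tel_map k (inj i k x)) =
  proj n.+1 k (inj i k x) - s n k (proj n k (inj i k x))).
rewrite tel_map_inj linearB; congr (_ - _).
have [ni|ni] := pselect (i = n).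
  by subst i; rewrite [LHS]dsumC_proj_inj; congr (s n k _); rewrite [RHS]dsumC_proj_inj.
rewrite [LHS]dsumC_proj_neq; last by case.
by rewrite [X in s n k X]dsumC_proj_neq // linear0.
Qed.

Let F := dsumC_lift f.

Lemma tel_lift_inj n k x : F k (inj n k x) = f n k x.
Proof. exact: (dsumC_lift_inj f). Qed.

Lemma tel_lift_map k x : F k (tel_map k x) = 0.
Proof.
apply: (dsumC_ext (f := chain_comp tel_map F) (g := chain_zero SG Y)) => i {}x.
change (F k (tel_map k (inj i k x)) = 0).
by rewrite tel_map_inj (linearB (F k)) !tel_lift_inj fs subrr.
Qed.

Lemma tel_cone_linear k : linear (fun p : cone tel_map k => F k p.2).
Proof. by move=> a p q; exact: (linearP (F k)). Qed.

Lemma tel_coneC k (p : cone tel_map k) :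
  F (k + 1) (tel_map (k + 1) p.1 + diff SG k p.2) = diff Y k (F k p.2).
Proof. by rewrite (linearD (F (k + 1))) tel_lift_map add0r cmapC. Qed.

Definition tel_cone : chain_map (cone tel_map) Y :=
  @ChainMap R (cone tel_map) Y (fun k => mklin (@tel_cone_linear k)) tel_coneC.

Let tel_eqv k (y y' : SG (k + 1)) : Prop :=
  exists2 w, cycle w & boundary (y - y' - tel_map (k + 1) w).

Let tel_eqv_trans k (y y' y'' : SG (k + 1)) :
  tel_eqv y y' -> tel_eqv y' y'' -> tel_eqv y y''.
Proof.
move=> [w cw b] [w' cw' b']; exists (w + w'); first exact: cycleD.
by have := boundaryD b b'; congr boundary; rewrite (linearD (tel_map _)); zmod.
Qed.

Let tel_eqvD k (y y' z z' : SG (k + 1)) :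
  tel_eqv y y' -> tel_eqv z z' -> tel_eqv (y + z) (y' + z').
Proof.
move=> [w cw b] [w' cw' b']; exists (w + w'); first exact: cycleD.
by have := boundaryD b b'; congr boundary; rewrite (linearD (tel_map _)); zmod.
Qed.

Let tel_eqv_inj n k (x : G n (k + 1)) : cycle x ->
  tel_eqv (inj n _ x) (inj n.+1 _ (s n _ x)).
Proof.
move=> cx; exists (inj n _ x); first exact: (cmap_cycle (dsumC_inj G n)).
by rewrite tel_map_inj subrr; exact: boundary0.
Qed.

Let tel_eqv_refl k (y : SG (k + 1)) : tel_eqv y y.
Proof.
by exists 0; [exact: cycle0|rewrite linear0 subrr subr0; exact: boundary0].
Qed.

Let tel_eqv_later n m k (x : G n (k + 1)) : (n <= m)%N -> cycle x ->
  exists2 x' : G m (k + 1), cycle x' & tel_eqv (inj n _ x) (inj m _ x').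
Proof.
move=> + cx; elim: m => [|m IHm].
  by rewrite leqn0 => /eqP n0; subst n; exists x.
rewrite leq_eqVlt => /orP[/eqP nm|]; first by subst n; exists x.
rewrite ltnS => /IHm[x' cx' xx']; exists (s m _ x'); first exact: cmap_cycle.
exact: tel_eqv_trans xx' (tel_eqv_inj cx').
Qed.

Let tel_eqv_single k (y : SG (k + 1)) : cycle y ->
  exists n, exists2 x : G n (k + 1), cycle x & tel_eqv y (inj n _ x).
Proof.
move=> cy; have [t ->] := dsumC_decomp y; elim: t => [|i t [N [x cx e]]].
  exists 0%N, 0; first exact: cycle0.
  by rewrite big_nil linear0; exact: tel_eqv_refl.
have [x1 cx1 e1] := tel_eqv_later (leq_addr N i) (dsumC_cycle i cy).
have [x2 cx2 e2] := tel_eqv_later (leq_addl i N) cx.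
exists (i + N)%N, (x1 + x2); first exact: cycleD.
rewrite big_cons linearD; apply: tel_eqvD => //.
exact: tel_eqv_trans e e2.
Qed.

(** Modulo the image of [1 - shift] a cycle of the direct sum can be moved to a
    single late stage, and there it dies one step later if it dies in [Y]. *)
Lemma tel_kernel k (y : SG (k + 1)) : cycle y -> boundary (F (k + 1) y) ->
  exists2 w, cycle w & boundary (y - tel_map (k + 1) w).
Proof.
move=> cy bF; have [n [x cx e]] := tel_eqv_single cy.
have bx : boundary (s n (k + 1) x).
  apply: f_inj => //; have [w cw b] := e.
  rewrite -tel_lift_inj; apply: boundary_trans bF.
  have := boundaryN (cmap_boundary F b).
  by rewrite !(linearB (F (k + 1))) tel_lift_map subr0 opprB.
have [w cw b] := tel_eqv_trans e (tel_eqv_inj cx); exists w => //.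
have := boundaryD b (cmap_boundary (dsumC_inj G n.+1) bx).
by congr boundary; rewrite /inj; zmod.
Qed.

(** The mapping telescope computes the colimit in homology.  Injectivity has
    two halves: the component in the source of [1 - shift] is a boundary,
    stage by stage, and the other one is controlled by [tel_kernel]. *)
Lemma tel_cone_quasi_iso : quasi_iso tel_cone.
Proof.
apply/quasi_isoP; split=> k; last first.
  move=> y /f_surj[n [x cx b]]; exists (0, inj n _ x).
    apply: cone_eq.
      change (- diff SG (k + 1 + 1) 0 = 0).
      by rewrite (linear0 (diff SG (k + 1 + 1))) oppr0.
    change (tel_map (k + 1 + 1) 0 + diff SG (k + 1) (inj n _ x) = 0).
    rewrite (linear0 (tel_map (k + 1 + 1))) add0r.
    exact: (cmap_cycle (dsumC_inj G n)).
  change (boundary (y - F (k + 1) (inj n (k + 1) x))).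
  by rewrite tel_lift_inj.
move=> [x y] c bF; rewrite -[tel_cone _ _]/(F (k + 1) y) in bF.
have xy : tel_map (k + 1 + 1) x + diff SG (k + 1) y = 0 := congr1 snd c.
have [x' x'E] : boundary x.
  apply: dsumC_boundary => n.
  have bxy i : boundary (proj i _ (tel_map _ x)).
    apply: (cmap_boundary (dsumC_proj G i)).
    exists (- y); rewrite linearN; apply/eqP; rewrite -addr_eq0.
    exact/eqP.
  elim: n => [|n IHn]; first by rewrite -[X in boundary X]tel_map_proj0.
  have := boundaryD (bxy n.+1) (cmap_boundary (s n) IHn).
  by rewrite tel_map_projS; congr boundary; rewrite /proj; zmod.
have [||w cw [v vE]] := @tel_kernel k (y + tel_map _ x').
- by rewrite /cycle linearD -cmapC -x'E [LHS]addrC.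
- by rewrite (linearD (F (k + 1))) tel_lift_map addr0.
exists (w - x', v); apply: cone_eq.
  change (x = - diff SG (k + 1) (w - x')).
  by rewrite (linearB (diff SG (k + 1))) cw x'E; zmod.
change (y = tel_map (k + 1) (w - x') + diff SG k v).
by rewrite (linearB (tel_map (k + 1))) -vE; zmod.
Qed.

Lemma localising_telescope (L : complex R -> Prop) :
  localising L -> (forall n, L (G n)) -> L Y.
Proof.
move=> locL LG; apply/(localising_quasi_iso locL tel_cone_quasi_iso).
by apply: localising_cone => //; exact: localising_dsum.
Qed.

End Telescope.

(** * Retracts and devissage *)
Section Devissage.
Variables (R : comPzRingType) (L : complex R -> Prop).
Hypothesis locL : localising L.
Implicit Types X Y : complex R.

(** A retract is the colimit of the constant sequence whose transition maps are
    the corresponding idempotent. *)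
Lemma localising_retract X Y (i : chain_map Y X) (p : chain_map X Y) :
  (forall n y, p n (i n y) = y) -> L X -> L Y.
Proof.
move=> pi LX; apply: (localising_telescope (G := fun _ => X)
  (s := fun _ => chain_comp p i) (f := fun _ => p)) => //.
- by move=> n k x; rewrite /= pi.
- move=> k y cy; exists 0%N, (i (k + 1) y); first exact: cmap_cycle.
  by rewrite pi subrr; exact: boundary0.
- by move=> n k x cx b /=; exact: cmap_boundary.
Qed.

(** Attaching to [A] the cone of a map from an object of [L] that is surjective
    in homology kills the homology of [A].  If this can be repeated forever
    then the colimit is acyclic, while the cones of the maps from [A] to the
    stages of the construction are extensions of objects of [L]; so their
    colimit, which is a shift of [A], is in [L]. *)
Lemma localising_devissage (T : complex R -> Prop) :
  (forall A, T A -> exists F (f : chain_map F A),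
     [/\ L F, hom_surj f & T (cone f)]) ->
  forall A, T A -> L A.
Proof.
move=> next A0 TA0.
pose step (A : {A | T A}) := cid (next _ (proj2_sig A)).
pose F A := projT1 (step A).
have f_ex A : exists f : chain_map (F A) (proj1_sig A),
  [/\ L (F A), hom_surj f & T (cone f)] := projT2 (step A).
pose f A : chain_map (F A) (proj1_sig A) := projT1 (cid (f_ex A)).
have LF A : L (F A) by case: (projT2 (cid (f_ex A))).
have f_surj A : hom_surj (f A) by case: (projT2 (cid (f_ex A))).
have Tf A : T (cone (f A)) by case: (projT2 (cid (f_ex A))).
(* [C n] is the n-th stage, [t n] its inclusion into the next one, [c n] the
   map to it from the initial complex, and [s n : cone (c n) -> cone (c n.+1)]
   has a shift of the attached object as its cokernel [o n]. *)
pose A n := iter n (fun A => exist T _ (Tf A)) (exist T A0 TA0).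
pose C n := proj1_sig (A n).
pose t n : chain_map (C n) (C n.+1) := cone_in (f (A n)).
pose c := fix c n : chain_map A0 (C n) :=
  if n is m.+1 then chain_comp (c m) (t m) else chain_id A0.
have tl n k : linear (fun p : cone (c n) k => (p.1, t n k p.2) : cone (c n.+1) k).
  by move=> a p q; apply: cone_eq => //; exact: (linearP (t n k)).
have tC n k (p : cone (c n) k) : (- diff A0 (k + 1) p.1,
    t n (k + 1) (c n (k + 1) p.1 + diff (C n) k p.2)) =
    diff (cone (c n.+1)) k (p.1, t n k p.2) :> cone (c n.+1) (k + 1).
  by apply: cone_eq => //; rewrite [LHS](linearD (t n (k + 1))) cmapC.
pose s n : chain_map (cone (c n)) (cone (c n.+1)) :=
  @ChainMap R _ _ (fun k => mklin (@tl n k)) (tC n).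
have ol n k : linear (fun p : cone (c n.+1) k => p.2.1 : shift (F (A n)) k).
  by [].
have oC n k (p : cone (c n.+1) k) : (diff (cone (c n.+1)) k p).2.1 =
    diff (shift (F (A n))) k p.2.1.
  by rewrite /= add0r.
pose o n : chain_map (cone (c n.+1)) (shift (F (A n))) :=
  @ChainMap R _ _ (fun k => mklin (@ol n k)) (oC n).
have so n : short_exact (s n) (o n).
  move=> k; split.
  - by move=> [a b] [/= -> ->].
  - by move=> [a [b b']] /= ->; exists (a, b').
  - by [].
  - by move=> z; exists (0, (z, 0)).
have LG n : L (cone (c n)).
  elim: n => [|n IHn]; last by apply: (localising_ext locL (so n)) => //;
    apply: (iffLR (localising_shift locL _)).
  apply: localising_acyclic => // k [a b] [/= /eqP]; rewrite oppr_eq0 => /eqP da ab.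
  exists (b, 0); apply: cone_eq => /=; last by rewrite linear0 addr0.
  by apply/eqP; rewrite -addr_eq0; apply/eqP.
apply: (iffRL (localising_shift locL _)).
apply: (localising_telescope (s := s) (f := fun n => cone_out (c n))) => //.
  move=> k a ca; have da : diff A0 (k + 1 + 1) a = 0.
    by apply/eqP; rewrite -oppr_eq0; apply/eqP.
  have [b cb [z bz]] := f_surj (A 0%N) _ _ da.
  exists 1%N, (a, (- b, - z)); last by rewrite /= subrr; exact: boundary0.
  apply: cone_eq => /=; first by rewrite da oppr0.
  apply: (cone_eq (f := f (A 0%N))) => /=; first by rewrite linearN cb; zmod.
  by rewrite !linearN /= -bz; zmod.
move=> n k [a b] [/= _ ab] [a' /= aa'].
have [|b1 cb1 [z bz]] := f_surj (A n) _ (b - c n (k + 1) a').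
  by rewrite /cycle linearB /= -cmapC -ab aa' linearN; zmod.
exists (a', (b1, z)); apply: cone_eq => //=; apply: (cone_eq (f := f (A n))) => /=.
  by rewrite cb1; zmod.
by rewrite -bz; zmod.
Qed.

End Devissage.

(** * Localisation at idempotents *)
Section Localization.
Variable R : comPzRingType.
Implicit Types X Y A B : complex R.

(** The multiplicative sets at which to localise.  Over an absolutely flat ring
    every element is a multiple of an idempotent that it generates, so that
    idempotents suffice; for them fractions can be avoided. *)
Record idem_system := IdemSystem {
  idems :> R -> Prop;
  idems_ne : exists t, idems t;
  idems_idem : forall t, idems t -> t * t = t;
  idemsM : forall t u, idems t -> idems u -> idems (t * u)
}.

Section Modules.
Variables (T : idem_system) (M : lmodType R).

Definition locM_rel (x y : M) : Prop := exists2 t, T t & t *: x = t *: y.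

Lemma locM_rel_eq x y : x = y -> locM_rel x y.
Proof. by move=> ->; have [t Tt] := idems_ne T; exists t. Qed.

(** Inverting idempotents amounts to dividing out what they kill: an idempotent
    acts as the identity on what it does not kill. *)
Definition locM_premodule : premodule R.
Proof.
refine (@Premodule R M locM_rel 0 -%R +%R *:%R _ _ _ _ _ _ _ _ _ _ _ _ _ _).
- by move=> x; exact: locM_rel_eq.
- by move=> x y [t Tt e]; exists t.
- move=> x y z [t Tt e] [u Tu e']; exists (t * u); first exact: idemsM.
  by rewrite -!scalerA -e' [LHS]scaler_comm e [RHS]scaler_comm.
- by move=> x y [t Tt e]; exists t => //; rewrite !scalerN e.
- move=> x x' y y' [t Tt e] [u Tu e']; exists (t * u); first exact: idemsM.
  rewrite -!scalerA !scalerDr e' [X in X + _]scaler_comm e.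
  by rewrite -[X in _ = X + _]scaler_comm.
- by move=> a x y [t Tt e]; exists t => //; rewrite ![t *: (a *: _)]scaler_comm e.
- by move=> x y z; apply: locM_rel_eq; rewrite addrA.
- by move=> x y; apply: locM_rel_eq; rewrite addrC.
- by move=> x; apply: locM_rel_eq; rewrite add0r.
- by move=> x; apply: locM_rel_eq; rewrite addNr.
- by move=> a b x; apply: locM_rel_eq; rewrite scalerA.
- by move=> x; apply: locM_rel_eq; rewrite scale1r.
- by move=> a x y; apply: locM_rel_eq; rewrite scalerDr.
- by move=> a b x; apply: locM_rel_eq; rewrite scalerDl.
Defined.

Definition locM : lmodType R := quotmod locM_premodule.

Definition locM_qcl (x : M) : locM := qcl (p := locM_premodule) x.

Lemma locM_proj_linear : linear locM_qcl.
Proof. by move=> a x y; rewrite /locM_qcl -qclZ -qclD. Qed.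

Definition locM_proj : {linear M -> locM} := mklin locM_proj_linear.

Lemma locM_projP x y : locM_proj x = locM_proj y <-> locM_rel x y.
Proof. exact: (qclP (p := locM_premodule)). Qed.

Lemma locM_proj_surj y : exists x, locM_proj x = y.
Proof. by exists (qrepr y); exact: qreprK. Qed.

End Modules.

Section Complexes.
Variables (T : idem_system) (X : complex R).

Definition locC_diff_fun n (x : locM T (X n)) : locM T (X (n + 1)) :=
  locM_proj T (X (n + 1)) (diff X n (qrepr x)).

Lemma locC_diff_proj n x :
  locC_diff_fun (locM_proj T (X n) x) = locM_proj T (X (n + 1)) (diff X n x).
Proof.
apply/locM_projP; have [t Tt e] := qrepr_rel (p := locM_premodule T (X n)) x.
by exists t => //; rewrite -!linearZ /= e.
Qed.

Lemma locC_diff_linear n : linear (@locC_diff_fun n).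
Proof.
move=> a x y; have [x' <-] := locM_proj_surj x; have [y' <-] := locM_proj_surj y.
by rewrite -linearP !locC_diff_proj -linearP -linearP.
Qed.

Lemma locC_diffK n x : locC_diff_fun (@locC_diff_fun n x) = 0.
Proof.
by have [x' <-] := locM_proj_surj x; rewrite !locC_diff_proj diffK linear0.
Qed.

Definition locC : complex R :=
  @Complex R (fun n => locM T (X n)) (fun n => mklin (@locC_diff_linear n)) locC_diffK.

Lemma locC_projC n x :
  locM_proj T (X (n + 1)) (diff X n x) = diff locC n (locM_proj T (X n) x).
Proof. by rewrite -locC_diff_proj. Qed.

Definition locC_proj : chain_map X locC :=
  @ChainMap R X locC (fun n => locM_proj T (X n)) locC_projC.

End Complexes.

Lemma bijective_quasi_iso A B (u : chain_map A B) :
  (forall n x, u n x = 0 -> x = 0) -> (forall n y, exists x, u n x = y) ->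
  quasi_iso u.
Proof.
move=> ui us; apply/quasi_isoP; split=> n.
  move=> x _ [y]; have [z <-] := us n y => e; exists z.
  by apply/eqP; rewrite -subr_eq0; apply/eqP/ui; rewrite linearB /= e -cmapC subrr.
move=> y cy; have [x e] := us _ y; subst y; exists x; last first.
  by rewrite subrr; exact: boundary0.
by apply: ui; rewrite cmapC.
Qed.

Lemma chain_factor A B B' (g : chain_map A B) (g' : chain_map A B') :
  (forall n y, exists x, g n x = y) ->
  (forall n x, g n x = 0 -> g' n x = 0) ->
  exists u : chain_map B B', forall n x, u n (g n x) = g' n x.
Proof.
move=> gs gg; pose r n y := projT1 (cid (gs n y)).
have rK n y : g n (r n y) = y := projT2 (cid (gs n y)).
have gE n x y : g n x = y -> g' n (r n y) = g' n x.
  move=> e; apply/eqP; rewrite -subr_eq0; apply/eqP; rewrite -linearB.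
  by apply: gg; rewrite linearB /= rK e subrr.
have ul n : linear (fun y => g' n (r n y)).
  by move=> a x y; rewrite -linearP; apply: gE; rewrite linearP /= !rK.
have uC n y : g' (n + 1) (r (n + 1) (diff B n y)) = diff B' n (g' n (r n y)).
  by rewrite -cmapC; apply: gE; rewrite cmapC rK.
by exists (@ChainMap R _ _ (fun n => mklin (@ul n)) uC) => n x; exact: gE.
Qed.

(** These three properties determine the localisation up to isomorphism under
    [A].  They are easy to check for cones, sums, iterated localisations and
    tensor products, which are so recognised as localisations. *)
Record is_loc (T : idem_system) A B (g : chain_map A B) : Prop := IsLoc {
  is_loc_surj : forall n y, exists x, g n x = y;
  is_loc_ker : forall n x, g n x = 0 -> exists2 t, T t & t *: x = 0;
  is_loc_id : forall t n (y : B n), T t -> t *: y = y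
}.

Lemma is_loc_locC T A : is_loc T (locC_proj T A).
Proof.
split=> [n y|n x|t n y Tt]; first exact: locM_proj_surj.
  move=> h; have /locM_projP[t Tt e] : locM_proj T (A n) x = locM_proj T (A n) 0.
    by rewrite linear0.
  by exists t; rewrite // e scaler0.
have [x <-] := locM_proj_surj y; rewrite -linearZ; apply/locM_projP.
by exists t; rewrite //= scalerA (idems_idem Tt).
Qed.

Lemma is_loc_kernel T A B (g : chain_map A B) n x :
  is_loc T g -> g n x = 0 <-> exists2 t, T t & t *: x = 0.
Proof.
move=> lg; split=> [|[t Tt e]]; first exact: is_loc_ker lg _ _.
by rewrite -(is_loc_id lg (g n x) Tt) -linearZ /= e linear0.
Qed.

Lemma is_loc_unique T A B B' (g : chain_map A B) (g' : chain_map A B') :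
  is_loc T g -> is_loc T g' ->
  exists2 u : chain_map B B', quasi_iso u & forall n x, u n (g n x) = g' n x.
Proof.
move=> lg lg'; have gg n x : g n x = 0 <-> g' n x = 0.
  by rewrite (is_loc_kernel _ lg) (is_loc_kernel _ lg').
have [u uE] := chain_factor (is_loc_surj lg) (fun n x => iffLR (gg n x)).
exists u => //; apply: bijective_quasi_iso => n y.
  by have [x <-] := is_loc_surj lg y; rewrite uE => /gg.
by have [x <-] := is_loc_surj lg' y; exists (g n x).
Qed.

Lemma is_loc_refl (T : idem_system) A :
  (forall t n (x : A n), T t -> t *: x = x) -> is_loc T (chain_id A).
Proof.
move=> h; split=> [n y|n x /= ->|//]; first by exists y.
by have [t Tt] := idems_ne T; exists t; rewrite // scaler0.
Qed.

Lemma is_loc_cone T A A' B B' (f : chain_map A A') (g : chain_map A B)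
    (g' : chain_map A' B') :
  is_loc T g -> is_loc T g' ->
  exists (fB : chain_map B B') (h : chain_map (cone f) (cone fB)), is_loc T h.
Proof.
move=> lg lg'; have [|fB fBE] := chain_factor (g' := chain_comp f g') (is_loc_surj lg).
  move=> n x /(is_loc_kernel _ lg)[t Tt e]; apply/(is_loc_kernel _ lg').
  by exists t; rewrite // -linearZ /= e linear0.
exists fB.
have hl n : linear (fun p : cone f n => (g (n + 1) p.1, g' n p.2) : cone fB n).
  by move=> a p q; apply: cone_eq; rewrite /= linearP.
have hC n (p : cone f n) : (g (n + 1 + 1) (diff (cone f) n p).1,
    g' (n + 1) (diff (cone f) n p).2) =
    diff (cone fB) n (g (n + 1) p.1, g' n p.2) :> cone fB (n + 1).
  apply: cone_eq; rewrite /= ?linearN ?linearD ?cmapC //=.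
  by have /= -> := fBE (n + 1) p.1.
exists (@ChainMap R _ _ (fun n => mklin (@hl n)) hC); split.
- move=> n [y z]; have [x <-] := is_loc_surj lg y.
  by have [w <-] := is_loc_surj lg' z; exists (x, w).
- move=> n [x w] /= [/(is_loc_ker lg)[t Tt e] /(is_loc_ker lg')[t' Tt' e']].
  exists (t * t'); first exact: idemsM.
  apply: (cone_eq (f := f)).
    by change ((t * t') *: x = 0); rewrite mulrC -scalerA e scaler0.
  by change ((t * t') *: w = 0); rewrite -scalerA e' scaler0.
- move=> t n [y z] Tt; apply: (cone_eq (f := fB)).
    exact: (is_loc_id lg y Tt).
  exact: (is_loc_id lg' z Tt).
Qed.

Lemma is_loc_dsum T I (A B : I -> complex R) (g : forall i, chain_map (A i) (B i)) :
  (forall i, is_loc T (g i)) -> is_loc T (dsumC_map g).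
Proof.
move=> lg; split=> [n|n x e|t n y Tt].
- apply: dsumC_ind => [|i y z [z' <-]]; first by exists 0; rewrite linear0.
  have [y' <-] := is_loc_surj (lg i) y; exists (dsumC_inj A i n y' + z').
  by rewrite (linearD (dsumC_map g n)) dsumC_map_inj.
- have [s ->] := dsumC_decomp x.
  apply: (big_ind (fun z : dsumC A n => exists2 t, T t & t *: z = 0)).
  + by have [t Tt] := idems_ne T; exists t; rewrite // scaler0.
  + move=> u v [t Tt tu] [t' Tt' tv]; exists (t * t'); first exact: idemsM.
    rewrite -scalerA !scalerDr tv scaler0 addr0.
    by rewrite scaler_comm tu scaler0.
  + move=> i _; have [|t Tt ti] := is_loc_ker (lg i) (x := dsumC_proj A i n x).
      by rewrite -dsumC_proj_map e (linear0 (dsumC_proj B i n)).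
    by exists t; rewrite // -(linearZZ (dsumC_inj A i n)) ti (linear0 (dsumC_inj A i n)).
- move: y; apply: dsumC_ind => [|i y z e]; first by rewrite scaler0.
  by rewrite scalerDr e -linearZ /= (is_loc_id (lg i) y Tt).
Qed.

End Localization.

(** * Pieces of a complex and its localisation at a prime *)
Section Pieces.
Variable R : comPzRingType.
Implicit Types (X Y A B : complex R) (e h : R).

Definition idem e : Prop := e * e = e.

Lemma idem0 : idem 0. Proof. exact: mulr0. Qed.
Lemma idem1 : idem 1. Proof. exact: mulr1. Qed.
Lemma idemM e h : idem e -> idem h -> idem (e * h).
Proof. by rewrite /idem => ee hh; rewrite mulrACA ee hh. Qed.
Lemma idemC e : idem e -> idem (1 - e).
Proof.
rewrite /idem => ee; have -> : (1 - e) * (1 - e) = 1 - e - e + e * e by ring.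
by rewrite ee subrK.
Qed.
Lemma idemU_l e h : idem e -> (e + h - e * h) * e = e.
Proof.
move=> ee; have -> : (e + h - e * h) * e = e * e + h * e - e * e * h by ring.
by rewrite ee [h * e]mulrC addrK.
Qed.
Lemma idemU_r e h : idem h -> (e + h - e * h) * h = h.
Proof. by move=> hh; rewrite -[e + h]addrC [e * h]mulrC idemU_l. Qed.
Lemma idemU e h : idem e -> idem h -> idem (e + h - e * h).
Proof.
move=> ee hh; rewrite /idem [X in _ * X](_ : _ = e + h * (1 - e)); last by ring.
by rewrite mulrDr mulrA idemU_l // idemU_r //; ring.
Qed.

Definition idem_single e (ee : idem e) : idem_system R.
Proof.
refine (@IdemSystem R [set e] _ _ _); first by exists e.
  by move=> _ ->.
by move=> _ _ -> ->.
Defined.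

(** A model of the direct summand [e X]: the quotient by what [e] kills. *)
Definition piece e (ee : idem e) X : complex R := locC (idem_single ee) X.

Lemma chain_scaleC a X n (x : X n) : a *: diff X n x = diff X n (a *: x).
Proof. by rewrite linearZ. Qed.

Lemma scale_linear a (M : lmodType R) : linear (fun x : M => a *: x).
Proof. by move=> b x y; rewrite scalerDr !scalerA mulrC. Qed.

Definition chain_scale a X : chain_map X X :=
  @ChainMap R X X (fun n => mklin (@scale_linear a (X n))) (@chain_scaleC a X).

Lemma piece_section e (ee : idem e) X :
  exists u : chain_map (piece ee X) X,
    forall n x, u n (locC_proj (idem_single ee) X n x) = e *: x.
Proof.
have lp := is_loc_locC (idem_single ee) X.
apply: (chain_factor (g' := chain_scale e X)); first exact: is_loc_surj lp.
by move=> n x /(is_loc_ker lp)[_ ->].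
Qed.

Lemma prime_idemC (P : Spec R) e : idem e -> ~ P e -> P (1 - e).
Proof.
move=> ee Pe; have [//|//|//] := @primeM _ P e (1 - e).
by rewrite mulrBr mulr1 ee subrr; exact: prime0.
Qed.

Lemma prime_idemN (P : Spec R) e : P e -> ~ P (1 - e).
Proof. by move=> Pe /(primeD Pe); rewrite addrC subrK; exact: prime1. Qed.

(** Over an absolutely flat ring, localising at these idempotents is localising
    at [P]. *)
Definition prime_idems (P : Spec R) : idem_system R.
Proof.
refine (@IdemSystem R [set e | idem e /\ ~ P e] _ _ _).
- by exists 1; split; [exact: idem1|exact: prime1].
- by move=> t [].
- by move=> t u [it Pt] [iu Pu]; split; [exact: idemM|move=> /primeM[]].
Defined.

Section Loc.
Variable L : complex R -> Prop.
Hypothesis locL : localising L.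

Lemma localising_is_loc T A B B' (g : chain_map A B) (g' : chain_map A B') :
  is_loc T g -> is_loc T g' -> L B <-> L B'.
Proof. by move=> lg /(is_loc_unique lg)[u qu _]; exact: localising_quasi_iso qu. Qed.

Lemma localising_piece e (ee : idem e) X : L X -> L (piece ee X).
Proof.
have [u uE] := piece_section ee X.
have lp := is_loc_locC (idem_single ee) X.
apply: (localising_retract locL (i := u) (p := locC_proj _ _)) => n y.
have [x <-] := is_loc_surj lp y.
by rewrite uE linearZ; apply: is_loc_id lp _ _ _ _.
Qed.

(** The fibre of [Y -> Y_P] is the union of the pieces [e Y] with [e] in [P].
    The devissage runs over the complexes [A] whose homology is [P]-torsion and
    all of whose pieces on idempotents of [P] are in [L]. *)
Lemma localising_fibre (P : Spec R) Y :
  (forall e (ee : idem e), P e -> L (piece ee Y)) ->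
  L (cone (locC_proj (prime_idems P) Y)).
Proof.
move=> LY.
pose T A := (forall n (x : A (n + 1)), cycle x ->
    exists e, [/\ idem e, P e & boundary (x - e *: x)]) /\
  (forall e (ee : idem e), P e -> L (piece ee A)).
apply: (localising_devissage locL (T := T)); last first.
  have lp := is_loc_locC (prime_idems P) Y.
  split=> [n [x y'] c|e ee Pe].
    have [y yE] := is_loc_surj lp y'; subst y'.
    pose q := locC_proj (prime_idems P) Y.
    have pxy : q (n + 1 + 1) (x + diff Y (n + 1) y) = 0.
      by rewrite (linearD (q (n + 1 + 1))) cmapC; exact: (congr1 snd c).
    have [t [it Pt] txy] := is_loc_ker lp pxy.
    exists (1 - t); split; [exact: idemC|exact: prime_idemC|].
    exists (t *: y, 0); rewrite scalerBl scale1r opprB [LHS]addrC subrK.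
    apply: (cone_eq (f := q)).
      change (t *: x = - diff Y (n + 1) (t *: y)); apply/eqP.
      by rewrite -subr_eq0 opprK linearZ -scalerDr txy.
    change (t *: q (n + 1) y = q (n + 1) (t *: y) + diff (locC (prime_idems P) Y) n 0).
    by rewrite (linear0 (diff (locC (prime_idems P) Y) n)) addr0 linearZ.
  have [fB [h lh]] := is_loc_cone (locC_proj (prime_idems P) Y)
    (is_loc_locC (idem_single ee) Y)
    (is_loc_locC (idem_single ee) (locC (prime_idems P) Y)).
  apply/(localising_is_loc (is_loc_locC _ _) lh); apply: localising_cone => //; first exact: LY.
  apply: localising_acyclic => // n x _; suff -> : x = 0 by exact: boundary0.
  have le := is_loc_locC (idem_single ee) (locC (prime_idems P) Y).
  have [y <-] := is_loc_surj le x; have [z <-] := is_loc_surj lp y.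
  apply/(is_loc_kernel _ le); exists e => //.
  rewrite -[X in e *: X](is_loc_id lp (t := 1 - e)); last first.
    by split; [exact: idemC|exact: prime_idemN].
  by rewrite scalerA mulrBr mulr1 ee subrr scale0r.
(* The sum of the pieces of [A] hits all of the torsion homology. *)
move=> A [A1 A2]; pose I := {e : R | idem e /\ P e}.
pose ei (i : I) := proj1_sig i; have ii (i : I) : idem (ei i) := (proj2_sig i).1.
have Pi (i : I) : P (ei i) := (proj2_sig i).2.
pose S (i : I) := projT1 (cid (piece_section (ii i) A)).
have SE i := projT2 (cid (piece_section (ii i) A)).
pose F := dsumC (fun i => piece (ii i) A); pose f : chain_map F A := dsumC_lift S.
have f_inj i n x : f n (dsumC_inj (fun i => piece (ii i) A) i n x) = S i n x.
  exact: (dsumC_lift_inj S).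
have fs : hom_surj f.
  move=> n x cx; have [e [ie Pe b]] := A1 n x cx; pose i : I := exist _ e (conj ie Pe).
  exists (dsumC_inj (fun i => piece (ii i) A) i _ (locC_proj (idem_single (ii i)) A _ x)).
    by apply: cmap_cycle; apply: cmap_cycle.
  by rewrite f_inj /S SE.
exists F, f; split=> //; first by apply: localising_dsum => // i; exact: A2.
split=> [n [phi y] c|e ee Pe].
  (* An idempotent that fixes the component of the cycle in the sum leaves a
     cycle of [A], which becomes a boundary in the cone. *)
  have [e [ie Pe ephi]] : exists e, [/\ idem e, P e & e *: phi = phi].
    clear c; move: phi; apply: dsumC_ind => [|i x z [e [ie Pe ez]]].
      by exists 0; rewrite scaler0; split; [exact: idem0|exact: prime0|].
    (* The union of the two idempotents fixes what either of them fixes. *)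
    exists (ei i + e - ei i * e); split; first exact: idemU.
      rewrite -mulN1r; apply: primeD; first exact: primeD.
      by apply: primeMl; apply: primeMl.
    have xE : ei i *: x = x.
      by apply: (is_loc_id (is_loc_locC (idem_single (ii i)) A)).
    rewrite scalerDr -[in LHS]ez scalerA idemU_r // ez.
    by rewrite -linearZ /= -[in LHS]xE scalerA idemU_l // xE.
  exists e; split=> //.
  have c2 : f (n + 1 + 1) phi + diff A (n + 1) y = 0 := congr1 snd c.
  have [|psi cpsi [z zE]] := fs n (y - e *: y).
    rewrite /cycle linearB linearZ /=.
    have -> : diff A (n + 1) y = - f _ phi by apply/eqP; rewrite -addr_eq0 [X in X == 0]addrC c2.
    by rewrite scalerN -linearZ /= ephi; zmod.
  exists (psi, z); apply: cone_eq.
    change (phi - e *: phi = - diff F (n + 1) psi).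
    by rewrite ephi cpsi subrr oppr0.
  change (y - e *: y = f (n + 1) psi + diff A n z).
  by rewrite -zE; zmod.
have [fB [h lh]] := is_loc_cone f (is_loc_locC (idem_single ee) F)
    (is_loc_locC (idem_single ee) A).
apply/(localising_is_loc (is_loc_locC _ _) lh); apply: localising_cone => //; last exact: A2.
apply/(localising_is_loc (is_loc_locC _ _)).
  by apply: is_loc_dsum => i; exact: (is_loc_locC (idem_single ee)).
by apply: localising_dsum => // i; apply: localising_piece; exact: A2.
Qed.

Lemma localising_localization (P : Spec R) Y : L Y -> L (locC (prime_idems P) Y).
Proof.
move=> LY; apply: (localising_cone_target locL (f := locC_proj (prime_idems P) Y)) => //.
by apply: localising_fibre => e ee _; exact: localising_piece.
Qed.

Lemma is_loc_piece_piece e h (ee : idem e) (hh : idem h) (eh : idem (e * h)) X :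
  is_loc (idem_single eh)
    (chain_comp (locC_proj (idem_single hh) X)
                (locC_proj (idem_single ee) (piece hh X))).
Proof.
have lh := is_loc_locC (idem_single hh) X.
have le := is_loc_locC (idem_single ee) (piece hh X).
split=> [n z|n x|_ n z ->].
- by have [y <-] := is_loc_surj le z; have [x <-] := is_loc_surj lh y; exists x.
- move=> /(is_loc_ker le)[_ ->]; rewrite -linearZ => /(is_loc_ker lh)[_ -> hex].
  by exists (e * h); rewrite // mulrC -scalerA.
- have [y <-] := is_loc_surj le z; rewrite -scalerA.
  rewrite (is_loc_id le) //; have [x <-] := is_loc_surj lh y.
  by rewrite -linearZ (is_loc_id lh).
Qed.

Lemma localising_piece_piece e h (ee : idem e) (hh : idem h) (eh : idem (e * h)) X :
  L (piece eh X) <-> L (piece ee (piece hh X)).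
Proof. exact: localising_is_loc (is_loc_locC _ _) (is_loc_piece_piece ee hh eh X). Qed.

End Loc.
End Pieces.

(** * Absolutely flat rings and their residue fields *)
Section AbsolutelyFlat.
Variable R : comPzRingType.
Hypothesis flatR : absolutely_flat R.

Lemma flat_idem (r : R) : exists2 e, idem e & e * r = r /\ exists x, e = r * x.
Proof.
have [x rx] := flatR r; exists (r * x); last first.
  by split; [rewrite [RHS]rx; ring|exists x].
rewrite /idem; have -> : r * x * (r * x) = r ^+ 2 * x * x by ring.
by rewrite -rx.
Qed.

Lemma flat_inv_mod (P : Spec R) c : ~ P c -> exists w, P (1 - c * w).
Proof.
move=> Pc; have [x cx] := flatR c; exists x.
have [|//|//] := @primeM _ P c (1 - c * x).
have -> : c * (1 - c * x) = c - c ^+ 2 * x by ring.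
by rewrite -cx subrr; exact: prime0.
Qed.

Lemma Spec_eq (P Q : Spec R) : (forall r, P r <-> Q r) -> P = Q.
Proof.
case: P Q => [p p1 p2 p3 p4 p5] [q q1 q2 q3 q4 q5] /= pq.
have e : p = q by apply/funext => r; exact/propext.
by subst q; congr PrimeIdeal; exact: Prop_irrelevance.
Qed.

Lemma flat_separate (P Q : Spec R) : P <> Q ->
  exists2 t, prime_idems P t & Q t.
Proof.
move=> PQ; apply: contrapT => nt; apply: PQ; apply: Spec_eq => r.
have [e ie [er [x ex]]] := flat_idem r.
split=> [Pr|Qr]; apply: contrapT => nr; apply: nt.
  exists (1 - e).
    by split; [exact: idemC|apply: prime_idemN; rewrite ex mulrC; exact: primeMl].
  apply: prime_idemC => // Qe; apply: nr; rewrite -er mulrC; exact: primeMl.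
exists e; last by rewrite ex mulrC; exact: primeMl.
by split=> // Pe; apply: nr; rewrite -er mulrC; exact: primeMl.
Qed.

Section Residue.
Variable P : Spec R.

Definition res1 : residue P := qcl (p := residue_premodule P) (Prefrac 1 (@prime1 R P)).

Lemma res_gen (q : residue P) : exists c, q = c *: res1.
Proof.
rewrite -(qreprK q); case: (qrepr q) => n d Pd.
have [w Pw] := flat_inv_mod Pd; exists (n * w); rewrite /res1 -qclZ; apply/qclP.
change (P (n * 1 - n * w * 1 * d)).
have -> : n * 1 - n * w * 1 * d = n * (1 - d * w) by ring.
exact: primeMl.
Qed.

Lemma res1_eq0 c : c *: res1 = 0 <-> P c.
Proof.
have eP : P (c * 1 * 1 - 0 * 1) <-> P c by rewrite !mulr1 subr0.
rewrite /res1 -qclZ; apply: iff_trans eP.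
exact: (qclP (p := residue_premodule P) _ (frac_zero P)).
Qed.

Lemma res_killed a (q : residue P) : P a -> a *: q = 0.
Proof.
by move=> Pa; have [c ->] := res_gen q; rewrite scaler_comm
  (iffRL (res1_eq0 a)) // scaler0.
Qed.

(** A numerator with denominator [1]; it exists because [R / P] is a field. *)
Definition rnum (q : residue P) : R := projT1 (cid (res_gen q)).
Lemma rnumK q : rnum q *: res1 = q.
Proof. exact/esym/(projT2 (cid (res_gen q))). Qed.

Section Killed.
Variable M : lmodType R.
Hypothesis PM : forall a (x : M), P a -> a *: x = 0.

(** The choice made in [rnum] is invisible on modules killed by [P]. *)
Lemma rnum_eq q c (x : M) : q = c *: res1 -> rnum q *: x = c *: x.
Proof.
move=> qc; apply/eqP; rewrite -subr_eq0 -scalerBl; apply/eqP/PM/res1_eq0.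
by rewrite scalerBl rnumK qc subrr.
Qed.

Lemma rnumP a q q' (x : M) : rnum (a *: q + q') *: x = a *: (rnum q *: x) + rnum q' *: x.
Proof.
rewrite scalerA -scalerDl; apply: rnum_eq.
by rewrite scalerDl -scalerA !rnumK.
Qed.

Lemma res_lift_linear (x : M) : linear (fun q => rnum q *: x).
Proof. by move=> a q q'; exact: rnumP. Qed.

Definition res_lift (x : M) : {linear residue P -> M} := mklin (res_lift_linear x).

Lemma res_lift1 x : res_lift x res1 = x.
Proof. by rewrite -[RHS]scale1r; apply: rnum_eq; rewrite scale1r. Qed.

(** Linear forms over the field [R / P] separate a vector from a subspace: a
    subspace [S] maximal among those that contain [N] and avoid [z] is a
    hyperplane complementary to the line of [z]. *)
Lemma res_functional (N : set M) z : N 0 ->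
    (forall a x y, N x -> N y -> N (a *: x + y)) -> ~ N z ->
  exists phi : {linear M -> residue P}, (forall x, N x -> phi x = 0) /\ phi z = res1.
Proof.
move=> N0 NP Nz.
(* The closure conditions admit the empty set, the union of the empty chain. *)
pose good (S : set M) := [/\ forall a x y, S x -> S y -> S (a *: x + y),
  forall x y, N x -> S y -> S (x + y) & ~ S z].
have [F Fgood totF|S [[SP SN Sz] Smax]] := @Zorn_bigcup M good.
  split.
  - move=> a x y [X FX Xx] [Y FY Yy].
    have [XY|YX] := totF X Y FX FY.
      by exists Y => //; have [h _ _] := Fgood Y FY; apply: h => //; exact: XY.
    by exists X => //; have [h _ _] := Fgood X FX; apply: h => //; exact: YX.
  - move=> x y Nx [Y FY Yy]; exists Y => //.
    by have [_ h _] := Fgood Y FY; exact: h.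
  - by move=> [Y FY Yz]; have [_ _] := Fgood Y FY.
have S0 : S 0.
  apply: contrapT => nS0; apply: (Smax N).
    split; last by move=> NS; apply/nS0/NS.
    move=> x Sx; case: nS0; rewrite -(addNr x) -scaleN1r; exact: SP.
  split=> // x y Nx Ny; rewrite -[x]scale1r; exact: NP.
have NS x : N x -> S x by move=> Nx; rewrite -[x]addr0; exact: SN.
have SZ a x : S x -> S (a *: x) by move=> Sx; rewrite -[_ *: _]addr0; exact: SP.
have SB x y : S x -> S y -> S (x - y).
  by move=> Sx Sy; rewrite addrC -scaleN1r; exact: SP.
have zS c : S (c *: z) -> P c.
  move=> Scz; apply: contrapT => /flat_inv_mod[w Pw]; apply: Sz.
  have -> : z = w *: (c *: z); last exact: SZ.
  apply/eqP; rewrite -subr_eq0 -{1}[z]scale1r scalerA mulrC -scalerBl.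
  exact/eqP/PM.
have span m : exists c, S (m - c *: z).
  have [Sm|Sm] := pselect (S m); first by exists 0; rewrite scale0r subr0.
  pose S' := [set x | exists2 y, S y & exists c, x = y + c *: m].
  have [s Ss [c zE]] : S' z.
    apply: contrapT => nz; apply: (Smax S').
      split; first by move=> x Sx; exists x => //; exists 0; rewrite scale0r addr0.
      move=> S'S; apply: Sm; apply: S'S; exists 0 => //; exists 1.
      by rewrite scale1r add0r.
    split=> // [a _ _ [x Sx [c ->]] [y Sy [d ->]]|x _ Nx [y Sy [c ->]]].
      exists (a *: x + y); first exact: SP.
      by exists (a * c + d); rewrite scalerDr scalerDl scalerA; zmod.
    by exists (x + y); [exact: SN|exists c; rewrite addrA].
  have Pc : ~ P c.
    by move=> Pc; apply: Sz; rewrite zE (PM m Pc) addr0.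
  have [w Pw] := flat_inv_mod Pc; exists w.
  have -> : m - w *: z = (1 - c * w) *: m - w *: s.
    by rewrite zE scalerDr scalerBl scale1r scalerA [w * c]mulrC; zmod.
  by rewrite (PM m Pw); apply: SB => //; exact: SZ.
pose c m := projT1 (cid (span m)).
have cE m : S (m - c m *: z) := projT2 (cid (span m)).
have c_uniq m d : S (m - d *: z) -> c m *: res1 = d *: res1.
  move=> Sd; apply/eqP; rewrite -subr_eq0 -scalerBl; apply/eqP/res1_eq0/zS.
  by have := SB _ _ Sd (cE m); congr S; rewrite scalerBl; zmod.
have phil : linear (fun m => c m *: res1).
  move=> a x y; rewrite scalerA -scalerDl; apply: c_uniq.
  have := SP a _ _ (cE x) (cE y); congr S.
  by rewrite scalerBr scalerDl scalerA; zmod.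
exists (mklin phil); split=> [x /NS Sx|] /=.
  by rewrite (c_uniq _ 0) ?scale0r ?subr0.
by rewrite (c_uniq _ 1) ?scale1r // subrr.
Qed.

End Killed.

End Residue.
End AbsolutelyFlat.

(** * Complexes over a residue field *)
Section Stalks.
Variable R : comPzRingType.
Implicit Types (X A : complex R) (M : lmodType R).

(** A module placed in degree [m]: the sum over the proofs of [n = m] saves
    all casts between the modules in equal degrees. *)
Definition stalk_at M (m : int) : complex R :=
  @Complex R (fun n => dsum (fun _ : n = m => M)) (fun _ => \0) (fun _ _ => erefl).

Definition stalk_at_in M m : {linear M -> stalk_at M m m} :=
  dsum_inj (fun _ : m = m => M) erefl.

Lemma stalk_at_in_inj M m x : stalk_at_in M m x = 0 -> x = 0.
Proof.
move=> e; rewrite -(dsum_proj_inj (M := fun _ : m = m => M) (i := erefl) x).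
by rewrite [X in dsum_proj _ _ X]e linear0.
Qed.

Lemma stalk_at_inP M m (x : stalk_at M m m) : exists y, x = stalk_at_in M m y.
Proof.
move: x; apply: dsum_ind => [|e y _ [z ->]]; first by exists 0; rewrite linear0.
by exists (y + z); rewrite linearD (Prop_irrelevance e erefl).
Qed.

Lemma stalk_at_out M m n (x : stalk_at M m n) : n <> m -> x = 0.
Proof. by move=> nm; move: x; apply: dsum_ind => // e. Qed.

Lemma stalk_at_ind M m (Q : forall n, stalk_at M m n -> Prop) :
  (forall n, Q n 0) -> (forall y, Q m (stalk_at_in M m y)) -> forall n x, Q n x.
Proof.
move=> Q0 Qi n x; have [e|ne] := pselect (n = m); last by rewrite (stalk_at_out x ne).
by subst n; have [y ->] := stalk_at_inP x.
Qed.

Section Lift.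
Variables (M : lmodType R) (m : int) (X : complex R) (phi : {linear M -> X m}).
Hypothesis dphi : forall x, diff X m (phi x) = 0.

Definition stalk_at_lift_fun n : {linear stalk_at M m n -> X n} :=
  dsum_lift (fun e : n = m => eq_rect m (fun k => {linear M -> X k}) phi n (esym e)).

Lemma stalk_at_lift_in x : stalk_at_lift_fun m (stalk_at_in M m x) = phi x.
Proof. by rewrite [LHS]dsum_lift_inj. Qed.

Lemma stalk_at_liftC n (x : stalk_at M m n) :
  stalk_at_lift_fun (n + 1) (diff (stalk_at M m) n x) = diff X n (stalk_at_lift_fun n x).
Proof.
rewrite (linear0 (stalk_at_lift_fun (n + 1))); move: n x.
apply: stalk_at_ind => [n|y]; first by rewrite !linear0.
by rewrite stalk_at_lift_in dphi.
Qed.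

Definition stalk_at_lift : chain_map (stalk_at M m) X :=
  @ChainMap R _ _ stalk_at_lift_fun stalk_at_liftC.

Lemma stalk_at_lift_quasi_iso :
  (forall x, phi x = 0 -> x = 0) -> (forall y, exists x, phi x = y) ->
  (forall n, n <> m -> forall y : X n, y = 0) -> quasi_iso stalk_at_lift.
Proof.
move=> pi ps pn; apply: bijective_quasi_iso => n x.
  move: n x; apply: stalk_at_ind => // x e.
  by rewrite (pi x) ?linear0 // -stalk_at_lift_in.
have [e|ne] := pselect (n = m); last by exists 0; rewrite linear0 (pn n ne x).
subst n; have [y <-] := ps x; exists (stalk_at_in M m y); exact: stalk_at_lift_in.
Qed.

End Lift.

Section Project.
Variables (M : lmodType R) (m : int) (X : complex R).
Variable phi : {linear X (m + 1) -> M}.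
Hypothesis phid : forall x, phi (diff X m x) = 0.

Definition stalk_at_proj_fun n : {linear X n -> stalk_at M (m + 1) n} :=
  match pselect (n = m + 1) with
  | left e => eq_rect (m + 1) (fun k => {linear X k -> stalk_at M (m + 1) k})
      (lcomp phi (stalk_at_in M (m + 1))) n (esym e)
  | right _ => \0
  end.

Lemma stalk_at_proj_in x : stalk_at_proj_fun (m + 1) x = stalk_at_in M (m + 1) (phi x).
Proof.
rewrite /stalk_at_proj_fun; case: pselect => // e.
by rewrite (Prop_irrelevance e erefl).
Qed.

Lemma stalk_at_projC n (x : X n) :
  stalk_at_proj_fun (n + 1) (diff X n x) =
  diff (stalk_at M (m + 1)) n (stalk_at_proj_fun n x).
Proof.
rewrite [RHS]/=; have [e|ne] := pselect (n = m); last first.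
  by apply: stalk_at_out => /addIr.
by subst n; rewrite stalk_at_proj_in phid linear0.
Qed.

Definition stalk_at_proj : chain_map X (stalk_at M (m + 1)) :=
  @ChainMap R _ _ stalk_at_proj_fun stalk_at_projC.

End Project.

Section Loc.
Variable L : complex R -> Prop.
Hypothesis locL : localising L.

Lemma localising_stalk_at0 M : L (stalk M) <-> L (stalk_at M 0).
Proof.
symmetry; pose phi : {linear M -> stalk M 0} := idfun.
apply: (localising_quasi_iso locL (f := stalk_at_lift (phi := phi) (fun _ => erefl))).
apply: stalk_at_lift_quasi_iso => [//|y|[[|n]|n] n0 y]; first by exists y.
- by case: n0.
- exact: thinmx0.
- exact: thinmx0.
Qed.

Lemma localising_stalk_atS M m : L (stalk_at M m) <-> L (stalk_at M (m + 1)).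
Proof.
apply: (iff_trans _ (iff_sym (localising_shift locL _))).
pose phi : {linear M -> shift (stalk_at M (m + 1)) m} := stalk_at_in M (m + 1).
have dphi x : diff (shift (stalk_at M (m + 1))) m (phi x) = 0 by rewrite /= oppr0.
apply: (localising_quasi_iso locL (f := stalk_at_lift dphi)).
apply: stalk_at_lift_quasi_iso => [x|y|n nm y].
- exact: stalk_at_in_inj.
- by have [x ->] := stalk_at_inP y; exists x.
- by apply: (@stalk_at_out M (m + 1) (n + 1)) => /addIr.
Qed.

Lemma localising_stalk_at M m : L (stalk M) <-> L (stalk_at M m).
Proof.
apply: (iff_trans (localising_stalk_at0 M)); elim/int_ind: m => [//|n IHn|n IHn].
  apply: (iff_trans IHn); have := localising_stalk_atS M n.
  by rewrite -[X in stalk_at M (X + 1)]/(n%:Z) -PoszD addn1.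
apply: (iff_trans IHn); have := localising_stalk_atS M (- n.+1%:Z).
have -> : - n.+1%:Z + 1 = - n%:Z :> int by rewrite intS; ring.
exact: iff_sym.
Qed.

Section Prime.
Hypothesis flatR : absolutely_flat R.
Variable P : Spec R.

(** Every cycle of a complex of [k(P)]-vector spaces is the value at [1] of a
    map from a shift of [k(P)].  The sum over all cycles is surjective in
    homology and its cone is killed by [P] again. *)
Lemma localising_killed A : L (stalk (residue P)) ->
  (forall a n (x : A n), P a -> a *: x = 0) -> L A.
Proof.
move=> Lk; move: A; apply: (localising_devissage locL) => A PA.
pose I := {n : int & {z : A (n + 1) | cycle z}}.
pose F (i : I) := stalk_at (residue P) (projT1 i + 1).
have dphi (i : I) (q : residue P) : diff A (projT1 i + 1)
    (res_lift flatR (fun a => @PA a (projT1 i + 1)) (proj1_sig (projT2 i)) q) = 0.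
  by rewrite /= linearZ /= (proj2_sig (projT2 i)) scaler0.
pose f := dsumC_lift (fun i => stalk_at_lift (dphi i)).
exists (dsumC F), f; split.
- by apply: localising_dsum => // i; exact/localising_stalk_at.
- move=> n z cz; pose i : I := existT _ n (exist _ z cz).
  exists (dsumC_inj F i _ (stalk_at_in (residue P) (n + 1) (res1 P))).
    exact: (cmap_cycle (dsumC_inj F i)).
  rewrite (dsumC_lift_inj (fun i => stalk_at_lift (dphi i)) (i := i)).
  rewrite [X in z - X](stalk_at_lift_in (X := A)) res_lift1 subrr.
  exact: boundary0.
- move=> a n [x y] Pa; apply: (cone_eq (f := f)); last exact: (PA a n y Pa).
  change (a *: x = 0); move: x.
  apply: dsumC_ind => [|i x x' e]; first by rewrite scaler0.
  rewrite scalerDr e addr0 -linearZ /=; have -> : a *: x = 0; last exact: (linear0 (dsumC_inj F i _)).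
  move: (n + 1) x; apply: stalk_at_ind => [k|q]; first by rewrite scaler0.
  rewrite -(linearZZ (stalk_at_in (residue P) (projT1 i + 1))) (res_killed flatR) //.
  exact: linear0.
Qed.

(** A cycle [z] that is not a boundary gives a map from a shift of [k(P)]; a
    linear form with value [1] at [z] that vanishes on boundaries is a
    retraction of it, so that a shift of [k(P)] is a direct factor. *)
Lemma localising_residue A : (forall a n (x : A n), P a -> a *: x = 0) ->
  ~ acyclic A -> L A -> L (stalk (residue P)).
Proof.
move=> PA nA LA; have [n [z cz bz]] : exists n, exists2 z : A (n + 1), cycle z & ~ boundary z.
  apply: contrapT => h; apply: nA => n z cz; apply: contrapT => bz; apply: h.
  by exists n, z.
have [|phi [phid phiz]] := res_functional flatR (fun a => @PA a (n + 1))
    (boundary0 _ _) _ bz.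
  by move=> a x y bx; apply: boundaryD; exact: boundaryZ.
have dphi (q : residue P) : diff A (n + 1)
    (res_lift flatR (fun a => @PA a (n + 1)) z q) = 0.
  by rewrite /= linearZ /= cz scaler0.
apply/(localising_stalk_at _ (n + 1)).
apply: (localising_retract locL (i := stalk_at_lift dphi)
  (p := stalk_at_proj (phi := phi) (fun x => phid _ (boundary_diff x)))) LA.
apply: stalk_at_ind => [k|q]; first by rewrite !linear0.
rewrite [X in stalk_at_proj _ _ X](stalk_at_lift_in (X := A)).
rewrite [LHS]stalk_at_proj_in; congr (stalk_at_in _ _ _).
by rewrite /= linearZ /= phiz rnumK.
Qed.

End Prime.
End Loc.
End Stalks.

(** * The tensor product with a residue field *)
Section TensorResidue.
Variable R : comPzRingType.
Hypothesis flatR : absolutely_flat R.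
Variable P : Spec R.
Implicit Types X Y : complex R.

Section Bilinear.
Variables (M N Q : lmodType R) (b : M -> N -> Q).
Hypothesis b_linear_l : forall n, linear (b^~ n).
Hypothesis b_linear_r : forall m, linear (b m).

(** The universal property of the tensor product, on formal sums. *)
Lemma tensor_bilinear (s t : seq (M * N)) : tensor_rel s t ->
  \sum_(p <- s) b p.1 p.2 = \sum_(p <- t) b p.1 p.2.
Proof.
have bl0 n : b 0 n = 0 by exact: (linear0 (mklin (b_linear_l n))).
have blD m m' n : b (m + m') n = b m n + b m' n.
  exact: (linearD (mklin (b_linear_l n))).
have brD m n n' : b m (n + n') = b m n + b m n'.
  exact: (linearD (mklin (b_linear_r m))).
have blZ a m n : b (a *: m) n = a *: b m n.
  exact: (linearZZ (mklin (b_linear_l n))).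
have brZ a m n : b m (a *: n) = a *: b m n.
  exact: (linearZZ (mklin (b_linear_r m))).
elim=> {s t} [s|s t _ ->|s t u _ -> _ ->|s s' t t' _ IHs _ IHt|s t|n|m m' n|m n n'|a m n] //.
- by rewrite !big_cat /= IHs IHt.
- by rewrite !big_cat [LHS]addrC.
- by rewrite big_seq1 big_nil bl0.
- by rewrite !big_cons !big_nil /= !addr0 blD.
- by rewrite !big_cons !big_nil /= !addr0 brD.
- by rewrite !big_seq1 /= blZ brZ.
Qed.

End Bilinear.

Definition res_tens (M : lmodType R) (q : residue P) (x : M) : tensor (residue P) M :=
  qcl (p := tensor_premodule (residue P) M) [:: (q, x)].

Lemma res_tens_linear_r (M : lmodType R) q : linear (@res_tens M q).
Proof.
move=> a x y; rewrite /res_tens -qclZ -qclD; apply/qclP.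
apply: tensor_trans (tensor_Dr _ _ _) _.
apply: (@tensor_cat _ _ _ [:: _] _ [:: _] _); last exact: tensor_refl.
exact/tensor_sym/tensor_Zlr.
Qed.

Lemma res_tensZ (M : lmodType R) a q (x : M) : res_tens (a *: q) x = res_tens q (a *: x).
Proof. by apply/qclP; exact: tensor_Zlr. Qed.

Lemma res_tens_scale (M : lmodType R) a q (x : M) : a *: res_tens q x = res_tens (a *: q) x.
Proof. by rewrite res_tensZ; exact/esym/(linearZZ (mklin (res_tens_linear_r q))). Qed.

Lemma mtensor_unitC X n (x : X n) :
  res_tens (res1 P) (diff X n x) =
  diff (mtensor (residue P) X) n (res_tens (res1 P) x).
Proof. by rewrite /= tensor_mapE. Qed.

Definition mtensor_unit X : chain_map X (mtensor (residue P) X) :=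
  @ChainMap R X (mtensor (residue P) X)
    (fun n => mklin (@res_tens_linear_r (X n) (res1 P))) (@mtensor_unitC X).

Lemma res_tens_ind (M : lmodType R) (Q : tensor (residue P) M -> Prop) :
  Q 0 -> (forall q x z, Q z -> Q (res_tens q x + z)) -> forall z, Q z.
Proof.
move=> Q0 QD z; rewrite -(qreprK z); elim: (qrepr z) => [|[q x] s IHs] //.
rewrite (_ : qcl _ = res_tens q x + qcl (p := tensor_premodule (residue P) M) s).
  exact: QD.
by rewrite -qclD.
Qed.

Lemma locC_killed X a n (x : locC (prime_idems P) X n) :
  P a -> a *: x = 0.
Proof.
have lX := is_loc_locC (prime_idems P) X.
have [f fi [fa [w fw]]] := flat_idem flatR a => Pa.
have Pf : P f by rewrite fw mulrC; exact: primeMl.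
have T1f : prime_idems P (1 - f) by split; [exact: idemC|exact: prime_idemN].
by rewrite -(is_loc_id lX x T1f) scalerA mulrBr mulr1 mulrC fa subrr scale0r.
Qed.

(** Surjectivity holds since [k(P)] is a cyclic module.  What [x |-> 1 (x) x]
    kills is found by mapping [k(P) (x) X] to the localisation of [X], which is
    killed by [P] and so admits multiplication by elements of [k(P)]. *)
Lemma is_loc_mtensor X : is_loc (prime_idems P) (mtensor_unit X).
Proof.
have tensE (M : lmodType R) q (x : M) :
    res_tens q x = res_tens (res1 P) (rnum flatR q *: x).
  by rewrite -res_tensZ rnumK.
split=> [n z|n x e|t n z [it Pt]].
- move: z; apply: res_tens_ind => [|q x z [y <-]]; first by exists 0; rewrite linear0.
  exists (rnum flatR q *: x + y).
  by rewrite (linearD (mtensor_unit X n)) tensE.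
- pose T := prime_idems P; pose N := locC T X n; have lT := is_loc_locC T X.
  have PN a (y : N) : P a -> a *: y = 0 by exact: locC_killed.
  pose b (q : residue P) (x : X n) : N := rnum flatR q *: locC_proj T X n x.
  have bl y : linear (b^~ y) by move=> a q q'; exact: (rnumP flatR PN).
  have br q : linear (b q).
    by move=> a y y'; rewrite /b linearP scalerDr /= scaler_comm.
  have /qclP/(tensor_bilinear bl br) :
      qcl (p := tensor_premodule (residue P) (X n)) [:: (res1 P, x)] =
      qcl (p := tensor_premodule (residue P) (X n)) [::] by exact: e.
  rewrite big_seq1 big_nil /b (rnum_eq flatR PN (c := 1)) ?scale1r //.
  exact: (is_loc_ker lT).
- move: z; apply: res_tens_ind => [|q x z IHz]; first exact: scaler0.
  rewrite scalerDr IHz res_tens_scale; congr (res_tens _ _ + _).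
  apply/eqP; rewrite -subr_eq0 -{2}[q]scale1r -scalerBl -opprB scaleNr oppr_eq0.
  by apply/eqP/(res_killed flatR)/prime_idemC.
Qed.

End TensorResidue.

(** * Complexes with vanishing localisation *)
Section LocalClass.
Variable R : comPzRingType.
Implicit Types X Y Z A : complex R.

Lemma disomorphic_dzero X : disomorphic X (dzero R) <-> acyclic X.
Proof.
split=> [/disomorphicP[A [f [s [qf qs]]]]|aX].
  by apply/(acyclic_qi qf)/(acyclic_qi qs); exact: acyclic_dzero.
apply: (disomorphic_quasi_iso (f := chain_zero X (dzero R))).
exact: acyclic_quasi_iso (@acyclic_dzero R).
Qed.

(** Acyclicity of the localisation, expressed in the complex itself. *)
Definition locally_acyclic (T : idem_system R) X : Prop :=
  forall n (x : X (n + 1)), cycle x -> exists2 t, T t & boundary (t *: x).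

Section Class.
Variable T : idem_system R.

Lemma acyclic_is_loc A B (g : chain_map A B) : is_loc T g ->
  acyclic B <-> locally_acyclic T A.
Proof.
move=> lg; split=> [aB n x cx|NA n y cy].
  have [y e] := aB n _ (cmap_cycle g cx); have [z zy] := is_loc_surj lg y; subst y.
  have [|t Tt txz] := is_loc_ker lg (x := x - diff A n z).
    by rewrite linearB /= e -cmapC subrr.
  exists t => //; exists (t *: z); apply/eqP.
  by rewrite -subr_eq0 linearZ -scalerBr txz.
have [x xy] := is_loc_surj lg y; subst y.
have [t Tt tdx] : exists2 t, T t & t *: diff A (n + 1) x = 0.
  by apply: (is_loc_ker lg); rewrite cmapC.
have [|u Tu [z zE]] := NA n (t *: x); first by rewrite /cycle linearZ.
exists (g n z); rewrite -cmapC -zE !linearZ /=.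
by rewrite (is_loc_id lg (g _ x) Tt) (is_loc_id lg (g _ x) Tu).
Qed.

Lemma is_loc_quasi_iso A A' B B' (f : chain_map A A') (g : chain_map A B)
    (g' : chain_map A' B') (fB : chain_map B B') :
  is_loc T g -> is_loc T g' -> (forall n x, fB n (g n x) = g' n (f n x)) ->
  quasi_iso f -> quasi_iso fB.
Proof.
move=> lg lg' fBE /quasi_isoP[fi fs]; apply/quasi_isoP; split=> n.
  move=> y cy [z' e]; have [x xy] := is_loc_surj lg y; subst y.
  have [z zz'] := is_loc_surj lg' z'; subst z'.
  have [t Tt tdx] : exists2 t, T t & t *: diff A (n + 1) x = 0.
    by apply: (is_loc_ker lg); rewrite cmapC.
  have [|u Tu ufz] := is_loc_ker lg' (x := f _ x - diff A' n z).
    by rewrite linearB /= -fBE e -cmapC subrr.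
  have [||v vE] := fi n (u *: (t *: x)).
  - by rewrite /cycle 2!linearZ /= tdx scaler0.
  - exists (t *: (u *: z)); rewrite !linearZ /= [RHS]scaler_comm.
    apply/eqP; rewrite -subr_eq0 scaler_comm [X in _ - X]scaler_comm.
    by rewrite -!scalerBr ufz scaler0.
  exists (g n v); rewrite -cmapC -vE !linearZ /=.
  by rewrite (is_loc_id lg (g _ x) Tt) (is_loc_id lg (g _ x) Tu).
move=> y cy; have [x xy] := is_loc_surj lg' y; subst y.
have [t Tt tdx] : exists2 t, T t & t *: diff A' (n + 1) x = 0.
  by apply: (is_loc_ker lg'); rewrite cmapC.
have [|z cz b] := fs n (t *: x); first by rewrite /cycle linearZ.
exists (g _ z); first exact: cmap_cycle.
have := cmap_boundary g' b; rewrite linearB linearZ /= (is_loc_id lg' (g' _ x) Tt).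
by rewrite fBE.
Qed.

Lemma locally_acyclic_qi X Y (f : chain_map X Y) :
  quasi_iso f -> locally_acyclic T X <-> locally_acyclic T Y.
Proof.
move=> qf; have lX := is_loc_locC T X; have lY := is_loc_locC T Y.
have [|fT fTE] := chain_factor (g' := chain_comp f (locC_proj T Y)) (is_loc_surj lX).
  move=> n x /(is_loc_kernel _ lX)[t Tt e]; apply/(is_loc_kernel _ lY).
  by exists t; rewrite // -linearZ /= e linear0.
apply: (iff_trans (iff_sym (acyclic_is_loc lX))).
apply: (iff_trans _ (acyclic_is_loc lY)).
exact: (acyclic_qi (is_loc_quasi_iso lX lY fTE qf)).
Qed.

Lemma locally_acyclic_cone X Y (f : chain_map X Y) :
  locally_acyclic T X -> locally_acyclic T Y -> locally_acyclic T (cone f).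
Proof.
have lX := is_loc_locC T X; have lY := is_loc_locC T Y.
have [fT [h lh]] := is_loc_cone f lX lY.
move=> /(acyclic_is_loc lX) aX /(acyclic_is_loc lY) aY; apply/(acyclic_is_loc lh).
exact: (iffLR (acyclic_qi (cone_in_quasi_iso fT aX)) aY).
Qed.

(** A coproduct in D(R) is only known by its universal property.  By uniqueness
    the map from [C] to its localisation agrees in D(R) with the zero map, as
    both have zero restriction to each [X k]: the restriction of the former
    factors through the acyclic localisation of [X k]. *)
Lemma locally_acyclic_coproduct (I : Type) (X : I -> complex R) C
    (i : forall k, dmor (X k) C) :
  is_coproduct i -> (forall k, locally_acyclic T (X k)) -> locally_acyclic T C.
Proof.
move=> cop NX; pose CT := locC T C; pose q := locC_proj T C.
have lC := is_loc_locC T C.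
have [h [_ hU]] := cop CT (fun k => dof (chain_zero (X k) CT)).
have /hU[W [u [v [/= qu nu du]]]] :
    forall k, deq (dcomp (i k) (dof q)) (dof (chain_zero (X k) CT)).
  move=> k; pose A := dapex (i k); pose s : chain_map C A := dden (i k).
  pose x : chain_map (X k) A := dnum (i k).
  have lA := is_loc_locC T A; have lX := is_loc_locC T (X k).
  have [|sT sTE] := chain_factor (g' := chain_comp s (locC_proj T A)) (is_loc_surj lC).
    move=> n y /(is_loc_kernel _ lC)[t Tt e]; apply/(is_loc_kernel _ lA).
    by exists t; rewrite // -linearZ /= e linear0.
  have [|xT xTE] := chain_factor (g' := chain_comp x (locC_proj T A)) (is_loc_surj lX).
    move=> n y /(is_loc_kernel _ lX)[t Tt e]; apply/(is_loc_kernel _ lA).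
    by exists t; rewrite // -linearZ /= e linear0.
  have aX : acyclic (locC T (X k)) by apply/(acyclic_is_loc lX).
  have qs : quasi_iso sT := is_loc_quasi_iso lC lA sTE (dden_qi (i k)).
  have qin := cone_in_quasi_iso xT aX.
  (* Dividing the localised apex by the localisation of [X k] changes nothing
     up to quasi-isomorphism, and makes the restriction null-homotopic. *)
  apply: (@deq_dcompl _ _ _ _ (i k) (dof q) (dof (chain_zero (X k) CT)) (cone xT)
    (chain_comp (locC_proj T A) (cone_in xT)) (chain_comp sT (cone_in xT))
    (chain_comp sT (cone_in xT))).
  - by apply: homotopic_eq => n y; congr (cone_in xT n _); rewrite [RHS](sTE n).
  - apply: cmap_eq_quasi_iso (quasi_iso_comp qs qin); by [].
  - pose H n (y : X k (n + 1)) : cone xT n := (locC_proj T (X k) _ y, 0).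
    have Hl n : linear (H n).
      move=> a y y'; apply: (cone_eq (f := xT)); first exact: (linearP (locC_proj T (X k) _)).
      by change (0 = a *: 0 + 0 :> locC T A n); rewrite scaler0 addr0.
    exists (fun n => mklin (Hl n)) => n y; apply: (cone_eq (f := xT)).
      change (0 - 0 = - diff (locC T (X k)) (n + 1) (locC_proj T (X k) (n + 1) y) +
        locC_proj T (X k) (n + 1 + 1) (diff (X k) (n + 1) y)).
      by rewrite -(cmapC (locC_proj T (X k))); zmod.
    change (locC_proj T A (n + 1) (x (n + 1) y) - sT (n + 1) 0 =
      xT (n + 1) (locC_proj T (X k) (n + 1) y) + diff (locC T A) n 0 + 0).
    rewrite (linear0 (sT (n + 1))) (linear0 (diff (locC T A) n)) xTE.
    by rewrite [chain_comp _ _ _ _]/=; zmod.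
  - exact: homotopic_eq.
have /hU[W' [u' [v' [/= qu' nu' du']]]] :
    forall k, deq (dcomp (i k) (dof (chain_zero C CT))) (dof (chain_zero (X k) CT)).
  move=> k; apply: (@deq_dcompl _ _ _ _ (i k) (dof (chain_zero C CT))
    (dof (chain_zero (X k) CT)) CT (chain_zero _ _) (chain_id _) (chain_id _)).
  - exact: homotopic_eq.
  - exact: quasi_iso_comp (quasi_iso_id _) (quasi_iso_id _).
  - exact: homotopic_eq.
  - exact: homotopic_eq.
move=> n x cx.
have [hi hs] := iffLR (quasi_isoP _) (dden_qi h).
have [y cy xy] := hs n _ (cmap_cycle (dnum h) cx).
have by_ : boundary y.
  have [ui _] := iffLR (quasi_isoP _) qu'; apply: ui => //.
  have h1 := cmap_boundary v' xy.
  have h2 := homotopic_boundary nu' cx; have h3 := homotopic_boundary du' cy.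
  have := boundaryN (boundaryD h1 (boundaryD h2 (boundaryN h3))).
  rewrite [v' _ _]linearB [chain_comp _ _ _ x]/= [chain_comp _ _ _ x]/=.
  rewrite [X in boundary X -> _](_ : _ = u' (n + 1) y); first by [].
  rewrite (linear0 (u' (n + 1))) [chain_comp _ _ _ y]/= [chain_comp _ _ _ y]/=.
  by zmod.
have bx : boundary (q (n + 1) x).
  have [ui _] := iffLR (quasi_isoP _) qu; apply: ui; first exact: cmap_cycle.
  have bh : boundary (dnum h (n + 1) x).
    by apply: boundary_trans xy _; exact: cmap_boundary.
  exact: homotopic_boundaryE nu cx (cmap_boundary v bh).
have [z' zE] := bx; have [z zz'] := is_loc_surj lC z'; subst z'.
have [|t Tt txz] := is_loc_ker lC (x := x - diff C n z).
  by rewrite (linearB (q (n + 1))) zE cmapC subrr.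
exists t => //; exists (t *: z); apply/eqP.
by rewrite -subr_eq0 linearZ -scalerBr txz.
Qed.

(** The third object of an exact triangle is isomorphic to the cone of a chain
    map between complexes isomorphic to the other two. *)
Lemma localising_locally_acyclic : localising (locally_acyclic T).
Proof.
have Niso X Y : disomorphic X Y -> locally_acyclic T X -> locally_acyclic T Y.
  move=> /disomorphicP[A [f [s [qf qs]]]] NX.
  by apply/(locally_acyclic_qi qs)/(locally_acyclic_qi qf).
split; last first.
  by move=> I X C i; exact: locally_acyclic_coproduct.
split=> //.
- move=> n x _; have [t Tt] := idems_ne T; exists t => //.
  by rewrite (rV0_eq0 x) scaler0; exact: boundary0.
- move=> X; split=> NX.
    move=> n x cx; have [|t Tt [z zE]] := NX (n + 1) x.
      by apply/eqP; rewrite -oppr_eq0; apply/eqP.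
    by exists t => //; exists (- z); rewrite /= linearN opprK.
  apply: int_succ_ind => n x cx.
  have [|t Tt [z zE]] := NX n x; first by rewrite /cycle /= cx oppr0.
  by exists t => //; exists (- z); rewrite linearN.
- move=> X Y Z u v w [A [B [f [a [b [c [[ia ib ic] _]]]]]]] NX NY.
  apply: (Niso (cone f)); first by apply: disomorphic_sym; exists c.
  by apply: locally_acyclic_cone; [apply: Niso NX; exists a|apply: Niso NY; exists b].
Qed.

End Class.

Section Support.
Hypothesis flatR : absolutely_flat R.

Lemma mtensor_acyclic (P : Spec R) X :
  disomorphic (mtensor (residue P) X) (dzero R) <->
  locally_acyclic (prime_idems P) X.
Proof.
apply: iff_trans (disomorphic_dzero _) _.
exact: acyclic_is_loc (is_loc_mtensor flatR P X).
Qed.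

Lemma residue_stalk_killed (P : Spec R) a n (x : stalk (residue P) n) :
  P a -> a *: x = 0.
Proof.
move=> Pa; case: n x => [[|n]|n] x; [exact: (res_killed flatR)|exact: thinmx0..].
Qed.

Lemma stalk_locally_acyclic (P Q : Spec R) : P <> Q ->
  locally_acyclic (prime_idems P) (stalk (residue Q)).
Proof.
move=> /(flat_separate flatR)[t Pt Qt] n x _; exists t => //.
by rewrite residue_stalk_killed //; exact: boundary0.
Qed.

Lemma stalk_not_locally_acyclic (P : Spec R) :
  ~ locally_acyclic (prime_idems P) (stalk (residue P)).
Proof.
move=> /(_ (Negz 0) (res1 P) erefl)[t [it Pt] [z]].
change (t *: res1 P = 0 -> False).
by move/res1_eq0/Pt.
Qed.

End Support.
End LocalClass.

(** * Isolated points of closed subsets of the spectrum *)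
Section Ideals.
Variable R : comPzRingType.

Record is_ideal (J : set R) : Prop := IsIdeal {
  ideal0 : J 0;
  idealD : forall x y, J x -> J y -> J (x + y);
  idealMl : forall a x, J x -> J (a * x)
}.

Lemma idealB J x y : is_ideal J -> J x -> J y -> J (x - y).
Proof.
by move=> iJ Jx Jy; apply: (idealD iJ) => //; rewrite -mulN1r; exact: (idealMl iJ).
Qed.

(** An ideal [S] maximal among those without [a] is prime: if neither [x] nor
    [y] is in [S], then [a = a * a] is in [S + (x * y)]. *)
Lemma prime_avoiding (J : set R) a : is_ideal J -> idem a -> ~ J a ->
  exists P : Spec R, ~ P a.
Proof.
move=> iJ ia Ja.
(* The closure conditions admit the empty set, the union of the empty chain. *)
pose good (S : set R) := [/\ forall x y, S x -> S y -> S (x + y),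
  forall b x, S x -> S (b * x) & ~ S a].
have [F Fgood totF|S [[SD SM Sa] Smax]] := @Zorn_bigcup R good.
  split.
  - move=> x y [X FX Xx] [Y FY Yy].
    have [XY|YX] := totF X Y FX FY.
      by exists Y => //; have [h _ _] := Fgood Y FY; apply: h => //; exact: XY.
    by exists X => //; have [h _ _] := Fgood X FX; apply: h => //; exact: YX.
  - move=> b x [Y FY Yx]; exists Y => //.
    by have [_ h _] := Fgood Y FY; exact: h.
  - by move=> [Y FY Ya]; have [_ _] := Fgood Y FY.
have S0 : S 0.
  apply: contrapT => nS0; apply: (Smax J).
    split; last by move=> JS; apply/nS0/JS/(ideal0 iJ).
    by move=> x Sx; case: nS0; rewrite -(mul0r x); exact: SM.
  by split=> //; [exact: (idealD iJ)|exact: (idealMl iJ)].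
have span x : ~ S x -> exists s b, S s /\ a = s + b * x.
  move=> Sx; pose S' := [set y | exists s b, S s /\ y = s + b * x].
  apply: contrapT => nS'; apply: (Smax S').
    split; first by move=> y Sy; exists y, 0; rewrite mul0r addr0.
    by move=> S'S; apply: Sx; apply: S'S; exists 0, 1; rewrite mul1r add0r.
  split=> // [_ _ [s [b [Ss ->]]] [s' [b' [Ss' ->]]]|c _ [s [b [Ss ->]]]].
    exists (s + s'), (b + b'); split; [exact: SD|ring].
  by exists (c * s), (c * b); split; [exact: SM|ring].
have S1 : ~ S 1 by move=> S1; apply: Sa; rewrite -(mulr1 a); exact: SM.
have prS x y : S (x * y) -> S x \/ S y.
  move=> Sxy; apply: contrapT => /not_orP[/span[s [b [Ss ab]]] /span[s' [b' [Ss' ab']]]].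
  apply: Sa; rewrite -ia {1}ab ab'.
  have -> : (s + b * x) * (s' + b' * y) =
    (s' + b' * y) * s + b * x * s' + b * b' * (x * y) by ring.
  by apply: (SD); [apply: (SD)|]; apply: (SM).
by exists (PrimeIdeal S0 SD SM S1 prS).
Qed.

End Ideals.

Section Generation.
Variables (S R : comPzRingType) (eta : {rmorphism S -> R}).
Hypothesis approx : absolutely_flat_approximation eta.

Record subring_type (Q : {pred R}) := SubringType {
  subring_val : R;
  subring_valP : subring_val \in Q
}.

HB.instance Definition _ Q := [isSub for @subring_val Q].
HB.instance Definition _ Q := gen_eqMixin (subring_type Q).
HB.instance Definition _ Q := gen_choiceMixin (subring_type Q).

(** By the universal property a subring that is absolutely flat and contains
    the image of [S] receives a map from [R]; composed with the inclusion it is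
    the identity of [R], by uniqueness. *)
Lemma approx_subring (q : {pred R}) (T : subComPzRingType q) :
  (forall s, eta s \in q) ->
  (forall r, r \in q -> exists2 x, x \in q & r = r ^+ 2 * x) ->
  forall r, r \in q.
Proof.
move=> qeta qflat r; have [flatR univ] := approx.
pose f0 (s : S) : T := Sub (eta s) (qeta s).
have f0K s : val (f0 s) = eta s by exact: SubK.
have f0_nmod : nmod_morphism f0.
  by split=> [|x y]; apply: val_inj; rewrite ?rmorphD /= !f0K (rmorph0, rmorphD) ?rmorph0.
have f0_monoid : monoid_morphism f0.
  by split=> [|x y]; apply: val_inj; rewrite ?rmorphM /= !f0K (rmorph1, rmorphM) ?rmorph1.
pose f : {rmorphism S -> T} := HB.pack f0
  (GRing.isNmodMorphism.Build S T f0 f0_nmod)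
  (GRing.isMonoidMorphism.Build S T f0 f0_monoid).
have flatT : absolutely_flat T.
  move=> t; have [x qx tx] := qflat _ (valP t).
  exists (Sub x qx : T); apply: val_inj.
  by rewrite rmorphM rmorphXn /= SubK.
have [g [gf _]] := univ T f flatT.
have [h [_ hU]] := univ R eta flatR.
have vg : (val \o g : {rmorphism R -> R}) =1 h.
  by apply: hU => s /=; rewrite gf f0K.
have id_h : (idfun : {rmorphism R -> R}) =1 h by exact: hU.
by rewrite -[r]/(idfun r) (id_h r) -vg; exact: valP.
Qed.

Lemma approx_generated (Q : set R) : Q 1 ->
  (forall x y, Q x -> Q y -> Q (x - y)) -> (forall x y, Q x -> Q y -> Q (x * y)) ->
  (forall s, Q (eta s)) ->
  (forall r, Q r -> exists2 x, Q x & r = r ^+ 2 * x) ->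
  forall r, Q r.
Proof.
move=> Q1 QB QM Qeta Qflat r.
pose q : {pred R} := [pred x | `[< Q x >]].
have qring : subring_closed q.
  split; first exact/asboolP.
    by move=> x y /asboolP Qx /asboolP Qy; apply/asboolP; exact: QB.
  by move=> x y /asboolP Qx /asboolP Qy; apply/asboolP; exact: QM.
pose T : subComPzRingType q := HB.pack (subring_type q)
  (GRing.SubChoice_isSubComPzRing.Build R q (subring_type q) qring).
apply/asboolP; apply: (approx_subring (q := q) T) => [s|{}r /asboolP/Qflat[x Qx e]].
  exact/asboolP.
by exists x => //; apply/asboolP.
Qed.

Section Atom.
Hypothesis noethS : noetherian_space (Spec S).
Variable J : set R.
Hypotheses (idealJ : is_ideal J) (J1 : ~ J 1).

Definition colon (g : R) : set R := [set r | J (g * r)].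

Lemma colon_ideal g : is_ideal (colon g).
Proof.
split=> [|x y|a x]; rewrite /colon /=.
- by rewrite mulr0; exact: ideal0 idealJ.
- by rewrite mulrDr; exact: idealD idealJ _ _.
- by rewrite mulrCA; exact: idealMl idealJ _ _.
Qed.

(** When every element of [S] is zero or invertible modulo [K], the elements of
    [R] that are congruent to a fraction of elements of [S] form an absolutely
    flat subring, hence all of [R]; and such fractions are zero or
    invertible. *)
Lemma generated_zero_or_unit (K : set R) : is_ideal K ->
  (forall s, K (eta s) \/ exists x, K (1 - eta s * x)) ->
  forall r, K r \/ exists x, K (1 - r * x).
Proof.
move=> iK dich; have [flatR _] := approx.
have KM a x : K x -> K (x * a) by rewrite mulrC; exact: (idealMl iK).
pose Q : set R := [set r | exists s t u, K (1 - eta t * u) /\ K (r - eta s * u)].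
have Qdich r : Q r -> K r \/ exists x, K (1 - r * x) /\ Q x.
  move=> [s [t [u [tu rs]]]]; have [Ks|[y sy]] := dich s.
    by left; have := idealD iK rs (KM u _ Ks); rewrite subrK.
  right; exists (eta t * y); split; last first.
    exists t, s, y; split=> //; rewrite subrr; exact: (ideal0 iK).
  have -> : 1 - r * (eta t * y) = - (eta t * y) * (r - eta s * u) +
    (eta s * y) * (1 - eta t * u) + (1 - eta s * y) by ring.
  by apply: (idealD iK) => //; apply: (idealD iK); apply: (idealMl iK).
have all_Q : forall r, Q r.
  apply: approx_generated.
  - exists 1, 1, 1; rewrite !rmorph1 mulr1 subrr; split; exact: (ideal0 iK).
  - move=> x y [s [t [u [tu xs]]]] [s' [t' [u' [tu' ys]]]].
    exists (s * t' - s' * t), (t * t'), (u * u'); rewrite rmorphB !rmorphM; split.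
      have -> : 1 - eta t * eta t' * (u * u') =
        1 - eta t * u + eta t * u * (1 - eta t' * u') by ring.
      by apply: (idealD iK) => //; exact: (idealMl iK).
    have -> : x - y - (eta s * eta t' - eta s' * eta t) * (u * u') =
        (x - eta s * u) + eta s * u * (1 - eta t' * u') -
        ((y - eta s' * u') + eta s' * u' * (1 - eta t * u)) by ring.
    by apply: (idealB iK); apply: (idealD iK) => //; exact: (idealMl iK).
  - move=> x y [s [t [u [tu xs]]]] [s' [t' [u' [tu' ys]]]].
    exists (s * s'), (t * t'), (u * u'); rewrite !rmorphM; split.
      have -> : 1 - eta t * eta t' * (u * u') =
        1 - eta t * u + eta t * u * (1 - eta t' * u') by ring.
      by apply: (idealD iK) => //; exact: (idealMl iK).
    have -> : x * y - eta s * eta s' * (u * u') =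
        y * (x - eta s * u) + eta s * u * (y - eta s' * u') by ring.
    by apply: (idealD iK); exact: (idealMl iK).
  - move=> s; exists s, 1, 1; rewrite rmorph1 !mulr1 !subrr; split; exact: (ideal0 iK).
  (* The quasi-inverse [r * x ^+ 2], unlike [x], vanishes modulo [K] when [r]
     does. *)
  - move=> r Qr; have [x rx] := flatR r; exists (r * x ^+ 2); last first.
      have -> : r ^+ 2 * (r * x ^+ 2) = (r ^+ 2 * x) * (r * x) by ring.
      by rewrite -rx; have -> : r * (r * x) = r ^+ 2 * x by ring.
    have [Kr|[y [ry [s [t [u [tu ys]]]]]]] := Qdich r Qr.
      exists 0, 1, 1; rewrite rmorph0 rmorph1 mul0r mulr1 subrr subr0; split.
        exact: (ideal0 iK).
      exact: KM.
    exists s, t, u; split=> //.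
    have -> : r * x ^+ 2 - eta s * u = (y - eta s * u) + (r * x ^+ 2 - y) by ring.
    apply: (idealD iK) => //.
    (* Both [y] and [r * x ^+ 2] are inverse to [r] modulo [K]. *)
    have rr : r * (r * x ^+ 2) = r * x.
      have -> : r * (r * x ^+ 2) = (r ^+ 2 * x) * x by ring.
      by rewrite -rx.
    have -> : r * x ^+ 2 - y = (1 - r * y) * (r * x ^+ 2) + y * (r * (r * x ^+ 2) - 1).
      by ring.
    apply: (idealD iK); first exact: KM; apply: (idealMl iK).
    have rx0 : r * (1 - r * x) = 0.
      have -> : r * (1 - r * x) = r - r ^+ 2 * x by ring.
      by rewrite -rx subrr.
    rewrite rr -opprB -mulN1r; apply: (idealMl iK).
    have -> : 1 - r * x = (1 - r * y) * (1 - r * x) + y * (r * (1 - r * x)) by ring.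
    by rewrite rx0 mulr0 addr0; exact: KM.
move=> r; have [|[x [Kx _]]] := Qdich r (all_Q r); first by left.
by right; exists x.
Qed.

Lemma zeros_closed (A : comPzRingType) (E : set A) : closed (zeros E).
Proof. by rewrite -[zeros E]setCK; apply: open_closedC; exists E. Qed.

(** The spectrum of [R / J] has an isolated point.  Starting from [1], cut down
    by idempotents coming from [S] as long as this splits the current piece into
    two parts that are nonzero modulo [J]; the corresponding closed subsets of
    [Spec S] decrease strictly, so that this stops.  A piece that cannot be
    split is a field, by [generated_zero_or_unit]. *)
Lemma colon_prime :
  exists2 g, idem g & exists P : Spec R, forall r, P r <-> J (g * r).
Proof.
apply: contrapT => no_atom; have [flatR _] := approx.
pose e s := s2val (cid2 (flat_idem flatR (eta s))).
have ie s : idem (e s) := s2valP (cid2 (flat_idem flatR (eta s))).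
have eE s : e s * eta s = eta s /\ exists x, e s = eta s * x :=
  s2valP' (cid2 (flat_idem flatR (eta s))).
(* [G l] is the idempotent of the closed set where all elements of [l] vanish. *)
pose G (l : seq S) := \prod_(s <- l) (1 - e s).
have iG l : idem (G l).
  by apply: big_ind => [|x y|s _]; [exact: idem1|exact: idemM|exact: idemC].
have split_step (l : seq S) : exists s, ~ J (G l) ->
    ~ J (G l * e s) /\ ~ J (G l * (1 - e s)).
  apply: contrapT => nos; have JG : ~ J (G l).
    by move=> JG; apply: nos; exists 0.
  have dich s : J (G l * e s) \/ J (G l * (1 - e s)).
    apply: contrapT => /not_orP[J1' J2']; apply: nos; exists s => _; split=> //.
  apply: no_atom; exists (G l) => //; pose K := colon (G l).
  have iK : is_ideal K := colon_ideal (G l).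
  have K1 : ~ K 1 by rewrite /K /colon /= mulr1.
  have unitK := generated_zero_or_unit iK.
  have prK x y : K (x * y) -> K x \/ K y.
    move=> Kxy; have [s|Kx|[z xz]] := unitK _ x; [|by left|right].
      have [es [w ew]] := eE s; have [Je|Je] := dich s; [left|right].
        by rewrite /K /colon /= -es mulrA mulrC; exact: (idealMl idealJ).
      by exists w; rewrite -ew.
    have -> : y = y * (1 - x * z) + z * (x * y) by ring.
    by apply: (idealD iK); exact: (idealMl iK).
  by exists (PrimeIdeal (ideal0 iK) (idealD iK) (idealMl iK) K1 prK) => r.
have [nxt nxtE] := choice split_step.
pose l n := iter n (fun l => nxt l :: l) [::].
have JG n : ~ J (G (l n)).
  elim: n => [|n /nxtE[_ h]]; first by rewrite /G big_nil.
  by rewrite /G /= big_cons mulrC.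
pose F n : set (Spec S) := zeros [set s | s \in l n].
have [|n P FP s sl|N FN] := noethS (F := F).
- by move=> n; exact: zeros_closed.
- by apply: FP; rewrite /= inE; apply/orP; right.
(* A prime of [R] in the discarded part of stage [N] contracts to a point of
   [F N] outside [F N.+1]. *)
pose s := nxt (l N); pose a := G (l N) * e s.
have [Q Qa] : exists Q : Spec R, ~ Q a.
  by apply: (prime_avoiding idealJ); [exact: idemM|case: (nxtE _ (JG N))].
have P0 : Q (eta 0) by rewrite rmorph0; exact: prime0.
have PD x y : Q (eta x) -> Q (eta y) -> Q (eta (x + y)).
  by rewrite rmorphD; exact: primeD.
have PM b x : Q (eta x) -> Q (eta (b * x)) by rewrite rmorphM; exact: primeMl.
have P1 : ~ Q (eta 1) by rewrite rmorph1; exact: prime1.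
have Ppr x y : Q (eta (x * y)) -> Q (eta x) \/ Q (eta y).
  by rewrite rmorphM; exact: primeM.
pose P := PrimeIdeal P0 PD PM P1 Ppr.
have FNP : F N P.
  move=> t /= tl; have [<- _] := eE t; rewrite mulrC; apply: primeMl.
  apply: contrapT => /(prime_idemC (ie t)) Qt; apply: Qa.
  rewrite /a /G (big_rem t) //= -mulrA mulrC; exact: primeMl.
have : F N.+1 P by rewrite (FN N.+1).
move=> /(_ s); rewrite /= inE eqxx => /(_ isT) Qs; apply: Qa.
by have [_ [x es]] := eE s; rewrite /a es; apply: primeMl; rewrite mulrC; apply: primeMl.
Qed.

End Atom.
End Generation.

(** * The local-to-global principle *)
Section LocalToGlobal.
Variables (S R : comPzRingType) (eta : {rmorphism S -> R}).
Hypothesis noethS : noetherian_space (Spec S).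
Hypothesis approx : absolutely_flat_approximation eta.
Variable L : complex R -> Prop.
Hypothesis locL : localising L.

Lemma localising_piece_mul e h (ee : idem e) (hh : idem h) X (eh : idem (e * h)) :
  L (piece hh X) -> L (piece eh X).
Proof. by move=> Lh; apply/(localising_piece_piece locL ee hh); exact: localising_piece. Qed.

(** The piece of the union of [e] and [h] is an extension of the piece of
    [(1 - e) * h] by that of [e]. *)
Lemma localising_piece_union e h (ee : idem e) (hh : idem h) X
    (eh : idem (e + h - e * h)) :
  L (piece ee X) -> L (piece hh X) -> L (piece eh X).
Proof.
move=> Le Lh; pose g := e + h - e * h; have ik : idem ((1 - e) * h).
  by apply: idemM => //; exact: idemC.
have le := is_loc_locC (idem_single ee) X.
have lg := is_loc_locC (idem_single eh) X.
have lk := is_loc_locC (idem_single ik) X.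
have gE : g * e = e by exact: idemU_l.
have gK : g * ((1 - e) * h) = (1 - e) * h.
  by rewrite mulrCA idemU_r.
have gD : g = e + (1 - e) * h by rewrite /g; ring.
have ek : (1 - e) * h * e = 0.
  by rewrite mulrAC mulrBl mul1r ee subrr mul0r.
have [|i iE] := chain_factor (g := locC_proj (idem_single ee) X)
  (g' := chain_comp (chain_scale e X) (locC_proj (idem_single eh) X)) (is_loc_surj le).
  move=> n x /(is_loc_ker le)[_ -> ex].
  by change (locC_proj (idem_single eh) X n (e *: x) = 0); rewrite ex linear0.
have {}iE n x : i n (locC_proj (idem_single ee) X n x) =
    locC_proj (idem_single eh) X n (e *: x) by exact: iE.
have [|p pE] := chain_factor (g := locC_proj (idem_single eh) X)
  (g' := locC_proj (idem_single ik) X) (is_loc_surj lg).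
  move=> n x /(is_loc_ker lg)[_ -> gx]; apply/(is_loc_kernel _ lk).
  by exists ((1 - e) * h); rewrite // -gK mulrC -scalerA gx scaler0.
apply: (localising_ext locL (i := i) (p := p)) => //; last first.
  by apply: localising_piece_mul Lh; exact: idemC.
move=> n; split.
- move=> y; have [x <-] := is_loc_surj le y; rewrite iE.
  move=> /(is_loc_ker lg)[_ ->]; rewrite scalerA gE => ex.
  by apply/(is_loc_kernel _ le); exists e.
- move=> y; have [x <-] := is_loc_surj lg y; rewrite pE.
  move=> /(is_loc_ker lk)[_ -> kx].
  exists (locC_proj (idem_single ee) X n x); rewrite iE.
  apply/eqP; rewrite -subr_eq0 -linearB; apply/eqP.
  apply/(is_loc_kernel _ lg); exists g => //.
  by rewrite scalerBr scalerA gE gD scalerDl kx addr0 subrr.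
- move=> y; have [x <-] := is_loc_surj le y; rewrite iE pE.
  apply/(is_loc_kernel _ lk); exists ((1 - e) * h) => //.
  by rewrite scalerA ek scale0r.
- move=> y; have [x <-] := is_loc_surj lk y.
  by exists (locC_proj (idem_single eh) X n x); rewrite pE.
Qed.

(** If [X] is not in [L], the idempotents [e] with [e X] in [L] generate a
    proper ideal [J].  At an isolated point [P] of its zero set, with isolating
    idempotent [g], the complex [g X] is an extension of its localisation at
    [P], which is that of [X], by a complex built from pieces in [L]; so [g] is
    in [J] after all. *)
Lemma local_to_global X :
  (forall P : Spec R, L (locC (prime_idems P) X)) -> L X.
Proof.
move=> LX; have [flatR _] := approx; apply: contrapT => nLX.
pose J : set R := [set r | exists2 h, h * r = r & exists hh : idem h, L (piece hh X)].
have iJ : is_ideal J.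
  split.
  - exists 0; first by rewrite mulr0.
    exists (idem0 R); apply: localising_acyclic => // n x _.
    have l0 := is_loc_locC (idem_single (idem0 R)) X.
    rewrite -(is_loc_id l0 x (t := 0)) // scale0r; exact: boundary0.
  - move=> x y [e ex [ee Le]] [h hy [hh Lh]]; exists (e + h - e * h).
      rewrite mulrDr -{1}ex -{1}hy mulrA idemU_l // ex.
      by rewrite mulrA idemU_r // hy.
    by exists (idemU ee hh); exact: localising_piece_union Le Lh.
  - by move=> a x [h hx Lh]; exists h; rewrite // mulrCA hx.
have J_piece e (ee : idem e) : J e -> L (piece ee X).
  move=> [h he [hh Lh]]; have eh : e * h = e by rewrite mulrC.
  suff : L (piece (idemM ee hh) X) by move: (idemM ee hh); rewrite eh => ee';
    rewrite (Prop_irrelevance ee' ee).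
  exact: localising_piece_mul Lh.
have J1 : ~ J 1.
  move=> /(J_piece 1 (idem1 R)) L1; apply: nLX.
  apply/(localising_is_loc locL _ (is_loc_locC (idem_single (idem1 R)) X)); last exact: L1.
  by apply: is_loc_refl => _ n x ->; exact: scale1r.
have [g ig [P PE]] := colon_prime approx noethS iJ J1.
have Pg : ~ P g by move/PE; rewrite ig -[g]mulr1 => /PE; exact: prime1.
pose Y := piece ig X; have lY := is_loc_locC (idem_single ig) X.
have lYP := is_loc_locC (prime_idems P) Y.
have lXYP : is_loc (prime_idems P)
    (chain_comp (locC_proj (idem_single ig) X) (locC_proj (prime_idems P) Y)).
  split=> [n z|n x|t n z Tt]; last exact: (is_loc_id lYP z Tt).
    by have [y <-] := is_loc_surj lYP z; have [x <-] := is_loc_surj lY y; exists x.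
  move=> /(is_loc_ker lYP)[t Tt]; rewrite -linearZ => /(is_loc_ker lY)[_ -> gx].
  exists (g * t); last by rewrite -scalerA.
  by apply: (idemsM (i := prime_idems P)).
have LYP : L (locC (prime_idems P) Y).
  by apply/(localising_is_loc locL lXYP (is_loc_locC _ _)).
suff LY : L Y.
  apply: (@prime1 R P); apply/PE; rewrite mulr1; exists g => //; by exists ig.
apply: (localising_cone_source locL LYP); apply: (localising_fibre locL) => e ee /PE Jge.
apply/(localising_piece_piece locL ee ig (idemM ee ig)).
by apply: J_piece; rewrite mulrC.
Qed.

End LocalToGlobal.

(** * Localising classes and subsets of the spectrum *)
Lemma localising_generated (R : comPzRingType) (C : complex R -> Prop) :
  localising (generated C).
Proof.
split; [split|].
- by move=> L locL _; exact: localising_dzero.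
- move=> X Y xy CX L locL CL; case: (locL) => [[_ h _ _] _].
  by apply: h xy _; exact: CX.
- move=> X; split=> CX L locL CL; first exact: (iffLR (localising_shift locL X) (CX L locL CL)).
  exact: (iffRL (localising_shift locL X) (CX L locL CL)).
- move=> X Y Z u v w t CX CY L locL CL; case: (locL) => [[_ _ _ h] _].
  by apply: h t _ _; [exact: CX|exact: CY].
- move=> I X Y i cop CX L locL CL; case: (locL) => [_ h].
  by apply: h cop _ => k; exact: CX.
Qed.

Lemma generated_sub (R : comPzRingType) (C : complex R -> Prop) X :
  C X -> generated C X.
Proof. by move=> CX L _; exact. Qed.

Section Classification.
Variables (S R : comPzRingType) (eta : {rmorphism S -> R}).
Hypothesis noethS : noetherian_space (Spec S).
Hypothesis approx : absolutely_flat_approximation eta.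

Let flatR : absolutely_flat R := approx.1.

(** The complexes with acyclic localisation at [P] form a localising class; it
    contains [k(Q)] exactly when [P <> Q]. *)
Lemma sigma_tau (W : set (Spec R)) : sigma (tau W) = W.
Proof.
apply/seteqP; split=> [P [X WX nX]|P WP].
  apply: contrapT => nWP; apply: nX; apply/mtensor_acyclic => //.
  apply: (WX _ (localising_locally_acyclic (prime_idems P))) => _ [Q WQ ->].
  by apply: stalk_locally_acyclic => // PQ; apply: nWP; rewrite PQ.
exists (stalk (residue P)); first by apply: generated_sub; exists P.
by move=> /(mtensor_acyclic flatR); exact: stalk_not_locally_acyclic.
Qed.

(** One inclusion finds [k(P)] inside the localisation at [P] of an object of
    [L]; the other rebuilds an object of [L] from its localisations. *)
Lemma tau_sigma (L : complex R -> Prop) : localising L -> tau (sigma L) = L.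
Proof.
move=> locL; apply/funext => X; apply/propext; split=> [|LX].
  apply=> // _ [P [Y LY nY] ->].
  apply: (localising_residue locL flatR (P := P) (A := locC (prime_idems P) Y)).
  - by move=> a n x; exact: locC_killed flatR P Y a n x.
  - move=> aY; apply: nY; apply/(mtensor_acyclic flatR).
    exact/(acyclic_is_loc (is_loc_locC _ _)).
  - exact: localising_localization.
have locT : localising (tau (sigma L)) by exact: localising_generated.
apply: (local_to_global noethS approx locT) => P.
have [aX|naX] := pselect (acyclic (locC (prime_idems P) X)).
  exact: localising_acyclic.
apply: (localising_killed locT flatR (P := P)); last first.
  by move=> a n x; exact: locC_killed flatR P X a n x.
apply: generated_sub; exists P => //; exists X => // /(mtensor_acyclic flatR) h.
exact/naX/(acyclic_is_loc (is_loc_locC _ _)).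
Qed.

End Classification.

Theorem theorem4p20 (S R : comPzRingType) (eta : {rmorphism S -> R}) :
  noetherian_space (Spec S) ->
  absolutely_flat_approximation eta ->
  [/\ forall W : set (Spec R), localising (tau W),
      forall W : set (Spec R), sigma (tau W) = W,
      forall L : complex R -> Prop, localising L -> tau (sigma L) = L &
      forall W W' : set (Spec R),
        W `<=` W' <-> (forall X : complex R, tau W X -> tau W' X)].
Proof.
move=> noethS approx; split=> [W|W|L|W W'].
- exact: localising_generated.
- exact: sigma_tau approx W.
- exact: tau_sigma noethS approx L.
split=> [WW' X WX L locL W'L|WW'].
  by apply: WX => // Y [P /WW' W'P YP]; apply: W'L; exists P.
rewrite -(sigma_tau approx W) -(sigma_tau approx W') => P [X WX nX].
by exists X => //; exact: WW'.
Qed.
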